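(* Let $\Phi\in\mathcal S_{\mathcal L}+\mathcal W_{\mathcal L}$. Then the specific free energy functional $$\mathcal H(\cdot|\Phi):\mathcal P_{\mathcal L}(\Omega,\mathcal F^\nabla)\to\mathbb R\cup\{\infty\},\qquad \mu\mapsto\lim_{n\to\infty}n^{-d}\mathcal H_{\Pi_n}(\mu|\Phi)$$ is well-defined, affine, bounded below, and lower-semicontinuous, and for each $C\in\mathbb R$ its lower level set $$M_C:=\{\mu\in\mathcal P_{\mathcal L}(\Omega,\mathcal F^\nabla):\mathcal H(\mu|\Phi)\le C\}$$ is a compact Polish space, with respect to the topology of local convergence as well as with respect to the topology of weak local convergence. In fact, the two topologies coincide on each set $M_C$.
   Context: **Height functions.** Fix $d\ge2$ and $E\in\{\mathbb Z,\mathbb R\}$ with Borel $\sigma$-algebra $\mathcal E$ and reference measure $\lambda$ (counting measure if $E=\mathbb Z$, Lebesgue measure if $E=\mathbb R$). $\Omega$ is the set of functions (height functions) $\phi:\mathbb Z^d\to E$. $\Lambda\subset\subset\mathbb Z^d$ means that $\Lambda$ is a finite subset; $\Pi_n=[0,n)^d\cap\mathbb Z^d$; $d_1$ is the graph metric of the square lattice. For $\Lambda\subset\mathbb Z^d$: $\mathcal F_\Lambda=\sigma(\phi(x):x\in\Lambda)$, $\mathcal F=\mathcal F_{\mathbb Z^d}$, $\mathcal F^\nabla_\Lambda=\sigma(\phi(y)-\phi(x):x,y\in\Lambda)$, $\mathcal F^\nabla=\mathcal F^\nabla_{\mathbb Z^d}$. $\mathcal L$ is a fixed full-rank sublattice of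 $\mathbb Z^d$, $\Theta=\{\theta_x:x\in\mathcal L\}$ with $\theta_x(y)=y+x$, and $(\theta\phi)(x)=\phi(\theta x)$. $\mathcal P_{\mathcal L}(\Omega,\mathcal F^\nabla)$ is the set of probability measures on $(\Omega,\mathcal F^\nabla)$ under which $\phi$ and $\theta\phi$ have the same distribution for all $\theta\in\Theta$. **Potentials.** A periodic gradient potential is a family $\Phi=(\Phi_\Lambda)_{\Lambda\subset\subset\mathbb Z^d}$ of $\mathcal F^\nabla_\Lambda$-measurable functions $\Phi_\Lambda:\Omega\to\mathbb R\cup\{\infty\}$ with $\Phi_\Lambda\equiv0$ if $|\Lambda|\le1$ and $\Phi_{\theta\Lambda}(\phi)=\Phi_\Lambda(\theta\phi)$ for $\theta\in\Theta$. For $\Lambda\subset\subset\mathbb Z^d$ and $\Lambda\subset\Delta\subset\mathbb Z^d$ put $H^\Phi_{\Lambda,\Delta}=\sum_{\Gamma\subset\subset\mathbb Z^d,\,\Gamma\subset\Delta,\,\Gamma\cap\Lambda\ne\emptyset}\Phi_\Gamma$, $H_\Lambda=H_{\Lambda,\mathbb Z^d}$, $H^0_\Lambda=H_{\Lambda,\Lambda}$. **Local Lipschitz constraints.** An admissible graph is an $\mathcal L$-invariant edge set $\mathbb A$ on $\mathbb Z^d$ making $(\mathbb Z^d,\mathbb A)$ a connected graph of bounded degree. An admissible quasimetric is a function $q:\mathbb Z^d\times\mathbb Z^d\to\mathbb R$ with $q(x,x)=0$, $q(x,y)+q(y,x)>0$ for $x\neq y$, $q(x,z)\le q(x,y)+q(y,z)$,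 and $q(\theta x,\theta y)=q(x,y)$ for $\theta\in\Theta$. A local Lipschitz constraint is a pair $(\mathbb A,q)$ of such objects such that $p\le q$ for every admissible quasimetric $p$ with $p(x,y)\le q(x,y)$ for all $\{x,y\}\in\mathbb A$; without loss of generality $\mathbb A$ contains the edges of the square lattice. For sufficiently small $\varepsilon\ge0$, $q_\varepsilon$ is the largest admissible quasimetric with $q_\varepsilon(x,y)\le q(x,y)-\varepsilon$ for all $\{x,y\}\in\mathbb A$. A function $\phi$ is $q$-Lipschitz if $\phi(y)-\phi(x)\le q(x,y)$ for all $x,y$, and $q$-Lipschitz at $z$ if this holds for all $\{x,y\}\in\mathbb A$ containing $z$. **Strong interactions $\mathcal S_{\mathcal L}$.** Periodic gradient potentials $\Psi$ that are nonnegative, of finite range ($\Psi_\Lambda\equiv0$ when the $d_1$-diameter of $\Lambda$ exceeds some constant), Lipschitz (there is a local Lipschitz constraint $(\mathbb A,q)$, with $q$ integer-valued if $E=\mathbb Z$, such that $\Psi_\Lambda(\phi)=\infty$ iff $\Lambda=\{x,y\}\in\mathbb A$ and $\phi(y)-\phi(x)>q(x,y)$ for some $x,y$), and, if $E=\mathbb R$, locally bounded: for all small $\varepsilon>0$ there is $C_\varepsilon<\infty$ with $H^\Psi_{\{x\}}(\phi)\le C_\varepsilon$ for all $x$ and all $\phi\in\Omega$ that are $q_\varepsilon$-Lipschitz at $x$. **Weak interactions $\mathcal W_{\mathcal L}$.** Periodic gradient potentials $\Xi$ with $\|\Xi\|:=\sup_{x,\phi}\sum_{\Lambda\ni x}|\Xi_\Lambda(\phi)|<\infty$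 and with amenable lower exterior bound $e^-(\Lambda):=\sup_{\phi}\sum_{\Delta\subset\subset\mathbb Z^d,\ \Delta\cap\Lambda\neq\emptyset,\ \Delta\not\subset\Lambda}|\Xi_\Delta(\phi)|$. A function $f\ge0$ on finite subsets of $\mathbb Z^d$ is amenable if it is $\Theta$-invariant, $f(\Lambda\cup\Delta)\le f(\Lambda)+f(\Delta)$ for disjoint $\Lambda,\Delta$, and $f(\Lambda_n)=o(|\Lambda_n|)$ along every Van Hove sequence (finite $\Lambda_n$ with $|\Lambda_n|\to\infty$, $|\partial\Lambda_n|/|\Lambda_n|\to0$, $\partial\Lambda$ being the set of vertices adjacent to $\Lambda$). $\Phi\in\mathcal S_{\mathcal L}+\mathcal W_{\mathcal L}$ means $\Phi=\Psi+\Xi$ with $\Psi\in\mathcal S_{\mathcal L}$, $\Xi\in\mathcal W_{\mathcal L}$. **Free energy.** Relative entropy: $\mathcal H(\mu|\nu)=\mu(\log\frac{d\mu}{d\nu})$ if $\mu\ll\nu$ and $\infty$ otherwise. $\lambda^{\Lambda-1}$ is the measure on $(\Omega,\mathcal F^\nabla_\Lambda)$ which, for any choice of $x\in\Lambda$, corresponds to $\lambda^{\Lambda\smallsetminus\{x\}}$ under $\phi\mapsto(\phi(y)-\phi(x))_{y\in\Lambda\smallsetminus\{x\}}$. Then $\mathcal H_\Lambda(\mu|\Phi):=\mathcal H(\mu|_{\mathcal F^\nabla_\Lambda}\,|\,\lambda^{\Lambda-1})+\mu(H^0_\Lambda)$, with $\infty-\infty=\infty$. **Topologies.** A cylinder function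 is a function on $\Omega$ that is $\mathcal F_\Lambda$-measurable for some finite $\Lambda$; it is continuous if it is continuous for uniform convergence on $\Omega$. The topology of local convergence (resp. weak local convergence) on $\mathcal P(\Omega,\mathcal F^\nabla)$ is the coarsest one making $\mu\mapsto\mu(f)$ continuous for all ($\mathcal F^\nabla$-measurable) bounded cylinder functions (resp. bounded continuous cylinder functions) $f$. *)

(* Defs.v *)
From HB Require Import structures.
From mathcomp Require Import all_boot all_order all_algebra finmap.
From mathcomp Require Import all_classical all_reals all_analysis.
From mathcomp Require Import measurable_realfun.

Set Implicit Arguments.
Unset Strict Implicit.
Unset Printing Implicit Defensive.
Import Order.TTheory GRing.Theory Num.Theory numFieldNormedType.Exports.

Local Open Scope classical_set_scope.
Local Open Scope ring_scope.

HB.instance Definition _ := isPointed.Build int 0.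
HB.instance Definition _ := @isMeasurable.Build default_measure_display
  int discrete_measurable discrete_measurable0
  discrete_measurableC discrete_measurableU.

Variant height_kind := IntegerHeights | RealHeights.

Definition height_display (R : realType) (k : height_kind) : measure_display :=
  match k with
  | IntegerHeights => default_measure_display
  | RealHeights => (R.-ocitv.-measurable).-sigma%mdisp
  end.

Definition heights (R : realType) (k : height_kind) :
    measurableType (height_display R k) :=
  match k with
  | IntegerHeights => int
  | RealHeights => measurableTypeR R
  end.

Definition height0 (R : realType) (k : height_kind) : heights R k :=
  match k with IntegerHeights => (0 : int) | RealHeights => (0 : R) end.

Definition height_sub (R : realType) (k : height_kind) :
    heights R k -> heights R k -> heights R k :=
  match k with
  | IntegerHeights => fun a b : int => a - b
  | RealHeights => fun a b : R => a - b
  end.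

Definition height_val (R : realType) (k : height_kind) : heights R k -> R :=
  match k with
  | IntegerHeights => fun z : int => z%:~R
  | RealHeights => fun x : R => x
  end.

Lemma sigma_finite_counting_int (R : realType) :
  sigma_finite [set: int] (@counting int R).
Proof.
exists (fun n : nat => [set z : int | (`|z| <= n)%N]).
  by apply/seteqP; split => // z _; exists `|z|%N => /=.
move=> n; split => //; rewrite /counting asboolT ?ltry//.
pose s := [seq Posz i | i <- iota 0 n.+1] ++ [seq - Posz i | i <- iota 0 n.+1].
apply: (@sub_finite_set _ _ [set` s]); last exact: finite_seq.
move=> z zn; change (z \in s); rewrite mem_cat; apply/orP.
have zi : `|z|%N \in iota 0 n.+1 by rewrite mem_iota.
case: z zn zi => m _ zi; [left|right]; apply/mapP.
- by exists m.
- by exists m.+1 => //; rewrite NegzE.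
Qed.

HB.instance Definition _ (R : realType) :=
  @Measure_isSigmaFinite.Build _ int R (@counting int R)
    (sigma_finite_counting_int R).

Definition ref_measure (R : realType) (k : height_kind) :
    {sigma_finite_measure set (heights R k) -> \bar R} :=
  match k return {sigma_finite_measure set (heights R k) -> \bar R} with
  | IntegerHeights => @counting int R
  | RealHeights => @lebesgue_measure R
  end.

Section height_lemmas.
Context (R : realType) (k : height_kind).

Lemma height_sub0 (a : heights R k) : height_sub a (height0 R k) = a.
Proof. by case: k a => a; exact: subr0. Qed.

Lemma measurable_height_sub dT (T : measurableType dT) (f g : T -> heights R k) :
  measurable_fun setT f -> measurable_fun setT g ->
  measurable_fun setT (fun t => height_sub (f t) (g t)).
Proof.
case: k f g => /= f g mf mg; last exact: (@measurable_funB _ T R setT f g).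
move=> _ B _; rewrite setTI.
rewrite (_ : _ @^-1` B = \bigcup_(z in [set: int])
   (f @^-1` [set z] `&` g @^-1` [set w | B (z - w)])); last first.
  apply/seteqP; split => [t Bt|t [z _ [/= <-]]]//.
  by exists (f t).
apply: countable_bigcupT_measurable => [|z]; first exact: countableP.
apply: measurableI; rewrite -[X in measurable X]setTI;
  [exact: mf|exact: mg].
Qed.

End height_lemmas.

Section pushforward_sigma_finite.
Context d1 d2 (T1 : measurableType d1) (T2 : measurableType d2) (R : realType).
Variables (m : {sigma_finite_measure set T1 -> \bar R}).
Variables (f : T1 -> T2) (g : T2 -> T1).
Hypotheses (mf : measurable_fun [set: T1] f) (mg : measurable_fun [set: T2] g).
Hypothesis fK : cancel f g.

Definition pushforward_sf of measurable_fun [set: T1] f &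
  measurable_fun [set: T2] g & cancel f g := pushforward m f.

Local Notation mu := (pushforward_sf mf mg fK).

Let mu0 : mu set0 = 0%E. Proof. exact: measure0. Qed.

Let mu_ge0 A : (0 <= mu A)%E. Proof. exact: measure_ge0. Qed.

Let mu_sigma_additive : semi_sigma_additive mu.
Proof.
exact: (@measure_semi_sigma_additive _ _ _ (pushforward m f : {measure set T2 -> \bar R})).
Qed.

HB.instance Definition _ := isMeasure.Build _ _ _ mu mu0 mu_ge0 mu_sigma_additive.

Let mu_sigma_finite : sigma_finite [set: T2] mu.
Proof.
have [F TF Foo] := sigma_finiteT m.
exists (fun n => g @^-1` F n).
  by rewrite -preimage_bigcup -TF preimage_setT.
move=> n; split; first by rewrite -[X in measurable X]setTI; apply: mg => //; exact: (Foo n).1.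
rewrite /pushforward_sf /pushforward -comp_preimage.
by rewrite (_ : g \o f = id) ?preimage_id ?(Foo n).2//; apply/funext.
Qed.

HB.instance Definition _ :=
  Measure_isSigmaFinite.Build _ _ _ mu mu_sigma_finite.

End pushforward_sigma_finite.

Section product_sigma_finite.
Context d1 d2 (T1 : measurableType d1) (T2 : measurableType d2) (R : realType).
Variables (m1 : {sigma_finite_measure set T1 -> \bar R}).
Variables (m2 : {sigma_finite_measure set T2 -> \bar R}).

(* Alias: sigma-finiteness is not inferred by unification on m1 \x m2 itself. *)
Definition product_sf : set (T1 * T2) -> \bar R := (m1 \x m2)%E.

HB.instance Definition _ := Measure.copy product_sf (m1 \x m2)%E.

Let product_sf_sigma_finite : sigma_finite [set: T1 * T2] product_sf.
Proof.
have /sigma_finiteP[F [TF ndF Foo]] := sigma_finiteT m1.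
have /sigma_finiteP[G [TG ndG Goo]] := sigma_finiteT m2.
exists (fun n => F n `*` G n).
 rewrite -setXTT TF TG predeqE => -[x y]; split.
    move=> [/= [n _ Fnx] [k _ Gky]]; exists (maxn n k) => //; split.
    - by move: x Fnx; exact/subsetPset/ndF/leq_maxl.
    - by move: y Gky; exact/subsetPset/ndG/leq_maxr.
  by move=> [n _ []/= ? ?]; split; exists n.
move=> k; have [? ?] := Foo k; have [? ?] := Goo k.
split; first exact: measurableX.
by rewrite /product_sf product_measure1E// lte_mul_pinfty// ge0_fin_numE.
Qed.

HB.instance Definition _ :=
  Measure_isSigmaFinite.Build _ _ _ product_sf product_sf_sigma_finite.

End product_sigma_finite.

Section power_measure.
Context dE (E : measurableType dE) (R : realType).
Variable lambda : {sigma_finite_measure set E -> \bar R}.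

Definition tuple_cons n (p : E * n.-tuple E) : n.+1.-tuple E :=
  [tuple of p.1 :: p.2].

Definition tuple_uncons n (t : n.+1.-tuple E) : E * n.-tuple E :=
  (thead t, [tuple of behead t]).

Lemma tuple_consK n : cancel (@tuple_cons n) (@tuple_uncons n).
Proof. by move=> [a t]; congr pair; exact/val_inj. Qed.

Lemma measurable_tuple_cons n : measurable_fun setT (@tuple_cons n).
Proof. exact: measurable_cons. Qed.

Lemma measurable_tuple_uncons n : measurable_fun setT (@tuple_uncons n).
Proof.
apply/measurable_fun_pair; first exact: measurable_tnth.
exact: measurable_behead.
Qed.

Fixpoint power_measure n : {sigma_finite_measure set (n.-tuple E) -> \bar R} :=
  match n with
  | 0 => \d_([tuple] : 0.-tuple E)
  | n'.+1 => @pushforward_sf _ _ (E * n'.-tuple E)%type (n'.+1.-tuple E) R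
      (product_sf lambda (power_measure n')) (@tuple_cons n') (@tuple_uncons n')
      (@measurable_tuple_cons n') (@measurable_tuple_uncons n') (@tuple_consK n')
  end.

End power_measure.

Definition relative_entropy d (T : measurableType d) (R : realType)
    (mu : probability T R) (nu : {sigma_finite_measure set T -> \bar R}) :
    \bar R :=
  if `[< mu `<< nu >] then
    (\int[mu]_x lne (Radon_Nikodym (charge_of_finite_measure mu) nu x))%E
  else +oo%E.

Notation Zd d := 'rV[int]_d.

(* The graph metric of the square lattice is the l^1 distance. *)
Definition d1 d (x y : Zd d) : nat :=
  (\sum_(i < d) `|(x ord0 i - y ord0 i)%R|)%N.

Definition box d (n : nat) : {fset (Zd d)} :=
  [fset (map_mx (fun k : 'I_n => k%:Z) v) | v : 'rV['I_n]_d]%fset.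

Definition shift_fset d (x : Zd d) (Lambda : {fset (Zd d)}) : {fset (Zd d)} :=
  [fset (y + x)%R | y in Lambda]%fset.

(* The set below is finite, so that fset_set does not default to fset0. *)
Definition outer_boundary d (Lambda : {fset (Zd d)}) : {fset (Zd d)} :=
  fset_set [set y | y \notin Lambda /\ exists2 x, x \in Lambda & d1 x y = 1%N].

(* L is spanned over Z by the rows of a nonsingular integer matrix. *)
Definition full_rank_sublattice d (L : set (Zd d)) : Prop :=
  exists2 M : 'M[int]_d, \det M != 0 & L = [set c *m M | c in [set: Zd d]].

Definition van_hove d (Lambda : nat -> {fset (Zd d)}) (R : realType) : Prop :=
  (#|` Lambda n| @[n --> \oo] --> \oo) /\
  ((#|` outer_boundary (Lambda n)|%:R / #|` Lambda n|%:R : R) @[n --> \oo] --> 0).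

Definition amenable (R : realType) d (L : set (Zd d)) (f : {fset (Zd d)} -> \bar R) :
    Prop :=
  [/\ forall Lambda, (0 <= f Lambda)%E,
      forall x Lambda, L x -> f (shift_fset x Lambda) = f Lambda,
      forall Lambda Delta, [disjoint Lambda & Delta]%fset ->
        (f (Lambda `|` Delta)%fset <= f Lambda + f Delta)%E &
      forall Lambda_ : nat -> {fset (Zd d)}, van_hove Lambda_ R ->
        (f (Lambda_ n) * (#|` Lambda_ n|%:R^-1)%:E)%E @[n --> \oo] --> 0%E].

Definition admissible_graph d (L : set (Zd d)) (A : rel (Zd d)) : Prop :=
  [/\ symmetric A,
      irreflexive A,
      forall t x y, L t -> A (x + t) (y + t) = A x y,
      forall x y, exists2 p : seq (Zd d), path A x p & last x p = y &
      exists D : nat, forall x (s : seq (Zd d)),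
        uniq s -> all (A x) s -> (size s <= D)%N].

Definition admissible_quasimetric (R : realType) d (L : set (Zd d))
    (q : Zd d -> Zd d -> R) : Prop :=
  [/\ forall x, q x x = 0,
      forall x y, x != y -> 0 < q x y + q y x,
      forall x y z, q x z <= q x y + q y z &
      forall t x y, L t -> q (x + t) (y + t) = q x y].

Definition local_lipschitz_constraint (R : realType) d (L : set (Zd d))
    (A : rel (Zd d)) (q : Zd d -> Zd d -> R) : Prop :=
  [/\ admissible_graph L A,
      admissible_quasimetric L q &
      forall p, admissible_quasimetric L p ->
        (forall x y, A x y -> p x y <= q x y) -> forall x y, p x y <= q x y].

(* qe is q_eps; such a largest quasimetric is unique when it exists. *)
Definition is_reduced_quasimetric (R : realType) d (L : set (Zd d))
    (A : rel (Zd d)) (q : Zd d -> Zd d -> R) (eps : R)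
    (qe : Zd d -> Zd d -> R) : Prop :=
  [/\ admissible_quasimetric L qe,
      forall x y, A x y -> qe x y <= q x y - eps &
      forall p, admissible_quasimetric L p ->
        (forall x y, A x y -> p x y <= q x y - eps) ->
        forall x y, p x y <= qe x y].

Section height_functions.
Context (R : realType) (k : height_kind) (d : nat).

Definition Omega := Zd d -> heights R k.

HB.instance Definition _ := Pointed.copy Omega (Zd d -> heights R k).

Definition shift_height (x : Zd d) (phi : Omega) : Omega := fun y => phi (y + x).

Definition coord_generator (S : set (Zd d)) : set (set Omega) :=
  \bigcup_(x in S)
    preimage_set_system setT (fun phi : Omega => phi x) measurable.

Definition grad_generator (S : set (Zd d)) : set (set Omega) :=
  \bigcup_(p in S `*` S)
    preimage_set_system setT
      (fun phi : Omega => height_sub (phi p.2) (phi p.1)) measurable.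

(* (Omega, F_S) and (Omega, F^nabla_S) *)
Definition coord_space (S : set (Zd d)) := g_sigma_algebraType (coord_generator S).
Definition grad_space (S : set (Zd d)) := g_sigma_algebraType (grad_generator S).

HB.instance Definition _ S := Measurable.on (coord_space S).
HB.instance Definition _ S := Measurable.on (grad_space S).

Lemma measurable_grad_space (S : set (Zd d)) x y : S x -> S y ->
  measurable_fun setT
    (fun phi : grad_space S => height_sub ((phi : Omega) y) ((phi : Omega) x)).
Proof.
move=> Sx Sy _ B mB; rewrite setTI; apply: sub_sigma_algebra.
by exists (x, y) => //; exists B => //; rewrite setTI.
Qed.

Section grad_ref_measure.
Variable Lambda : {fset Zd d}.

(* lambda^(Lambda - 1) does not depend on the base point x in Lambda; here x is *)
(* the first element of the canonical enumeration of Lambda. *)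
Definition base_point : Zd d := head 0 (enum_fset Lambda).
Definition other_points : seq (Zd d) := behead (enum_fset Lambda).

Definition gradient_map (phi : grad_space [set` Lambda]) :
    (size other_points).-tuple (heights R k) :=
  [tuple of [seq height_sub ((phi : Omega) y) ((phi : Omega) base_point)
            | y <- in_tuple other_points]].

(* A section of gradient_map, valued in the height functions which vanish at x *)
(* and outside of Lambda. *)
Definition gradient_section (v : (size other_points).-tuple (heights R k)) :
    grad_space [set` Lambda] :=
  (fun y => if y \in other_points
            then nth (height0 R k) v (index y other_points)
            else height0 R k) : Omega.

Lemma base_point_notin : base_point \notin other_points.
Proof.
rewrite /base_point /other_points; have := fset_uniq Lambda.
by case: (enum_fset _) => //= x s /andP[].
Qed.

Lemma gradient_sectionK : cancel gradient_section gradient_map.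
Proof.
move=> v; apply: (@eq_from_tnth _ _) => i.
rewrite tnth_map (tnth_nth 0) /= /gradient_section mem_nth//.
rewrite (negbTE base_point_notin) index_uniq//.
- by rewrite height_sub0 (tnth_nth (height0 R k)).
- have := fset_uniq Lambda; rewrite /other_points.
  by case: (enum_fset _) => //= x s /andP[].
Qed.

Lemma measurable_gradient_section : measurable_fun setT gradient_section.
Proof.
have mv y : measurable_fun setT (fun v => (gradient_section v : Omega) y).
  rewrite /gradient_section; case ys : (y \in other_points); last exact: measurable_cst.
  have ilt : (index y other_points < size other_points)%N by rewrite index_mem.
  rewrite (_ : (fun _ => _) = (@tnth _ _ ^~ (Ordinal ilt))).
    exact: measurable_tnth.
  by apply/funext => v; rewrite (tnth_nth (height0 R k)).
apply: (@measurability _ _ _ (grad_space [set` Lambda]) setT gradient_section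
  (grad_generator [set` Lambda]) erefl).
move=> _ [_ [[x y] _ [B mB <-]] <-]; rewrite setTI.
have := measurable_height_sub (mv y) (mv x) => /(_ measurableT B mB).
by rewrite !setTI.
Qed.

Lemma measurable_gradient_map : measurable_fun setT gradient_map.
Proof.
apply/measurable_fun_tnthP => i.
rewrite (_ : _ \o _ = fun phi : grad_space [set` Lambda] =>
  height_sub ((phi : Omega) (tnth (in_tuple other_points) i))
             ((phi : Omega) base_point)); last first.
  by apply/funext => phi /=; rewrite tnth_map.
have [y0 s0] : {y | enum_fset Lambda = y :: other_points}.
  rewrite /other_points; case: i; rewrite /other_points.
  by case: (enum_fset _) => // a s _ _; exists a.
apply: measurable_grad_space => /=.
- by rewrite -[_ \in Lambda]/(_ \in enum_fset Lambda) /base_point s0 mem_head.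
- rewrite -[_ \in Lambda]/(_ \in enum_fset Lambda) s0 in_cons.
  by apply/orP; right; rewrite (tnth_nth 0) mem_nth.
Qed.

Definition grad_ref_measure :
    {sigma_finite_measure set (grad_space [set` Lambda]) -> \bar R} :=
  @pushforward_sf _ _ ((size other_points).-tuple (heights R k))
    (grad_space [set` Lambda]) R
    (power_measure (ref_measure R k) (size other_points))
    gradient_section gradient_map
    measurable_gradient_section measurable_gradient_map gradient_sectionK.

(* grad_ref_measure is lambda^(Lambda - 1): it corresponds to the power of     *)
(* lambda under the gradient map based at base_point Lambda. *)
Lemma grad_ref_measureE B :
  grad_ref_measure (gradient_map @^-1` B) =
  power_measure (ref_measure R k) (size other_points) B.
Proof.
rewrite /grad_ref_measure /= /pushforward_sf /pushforward -comp_preimage.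
by rewrite (_ : _ \o _ = id)//; apply/funext => v; exact: gradient_sectionK.
Qed.

End grad_ref_measure.

Definition grad_prob := probability (grad_space setT) R.

HB.instance Definition _ := Choice.on grad_prob.

Section restriction.
Variables (S : set (Zd d)) (mu : grad_prob).

Lemma grad_space_sub (A : set Omega) :
  measurable (A : set (grad_space S)) -> measurable (A : set (grad_space setT)).
Proof.
apply: smallest_sub; first exact: smallest_sigma_algebra.
by move=> B [p [Sp1 Sp2] mB]; apply: sub_sigma_algebra; exists p.
Qed.

Definition grad_restriction : set (grad_space S) -> \bar R := mu.

Let r0 : grad_restriction set0 = 0%E. Proof. exact: measure0. Qed.
Let r_ge0 A : (0 <= grad_restriction A)%E. Proof. exact: measure_ge0. Qed.
Let r_sigma_additive : semi_sigma_additive grad_restriction.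
Proof.
move=> F mF tF mUF; apply: (@measure_semi_sigma_additive _ _ _ mu) => //.
- by move=> n; exact: grad_space_sub (mF n).
- exact: grad_space_sub mUF.
Qed.

HB.instance Definition _ :=
  isMeasure.Build _ _ _ grad_restriction r0 r_ge0 r_sigma_additive.

Let r_setT : grad_restriction setT = 1%E. Proof. exact: probability_setT. Qed.

HB.instance Definition _ :=
  Measure_isProbability.Build _ _ _ grad_restriction r_setT.

End restriction.

Section mixture.
Variables (t : {i01 R}) (mu nu : grad_prob).

Definition mixture : set (grad_space setT) -> \bar R :=
  measure_add (mscale (t%:num)%:nng mu) (mscale (1 - t%:num)%:nng nu).

HB.instance Definition _ := Measure.on mixture.

Lemma mixtureE A :
  mixture A = (t%:num%:E * mu A + (1 - t%:num)%:E * nu A)%E.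
Proof. by rewrite /mixture measure_addE. Qed.

Let mixture_setT : mixture setT = 1%E.
Proof.
rewrite mixtureE ?probability_setT !mule1 -EFinD.
by rewrite addrC subrK.
Qed.

HB.instance Definition _ := Measure_isProbability.Build _ _ _ mixture mixture_setT.

End mixture.

(* The set function underlying a library measure is also defined, without     *)
(* constraint, on non-measurable sets.  A measure on F^nabla is represented by *)
(* its unique extension which is zero there.                                  *)
Definition zero_off_measurable (mu : grad_prob) : Prop :=
  forall A, ~ measurable A -> mu A = 0%E.

Definition invariant_grad_prob (L : set (Zd d)) : set grad_prob :=
  [set mu | zero_off_measurable mu /\
    forall x, L x -> forall A : set (grad_space setT), measurable A ->
      mu (shift_height x @^-1` A) = mu A].

Definition potential := {fset Zd d} -> Omega -> \bar R.

Definition periodic_gradient_potential (L : set (Zd d)) (Phi : potential) : Prop :=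
  [/\ forall Lambda,
        measurable_fun setT (Phi Lambda : grad_space [set` Lambda] -> \bar R),
      forall Lambda phi, Phi Lambda phi != -oo%E,
      forall Lambda phi, (#|` Lambda| <= 1)%N -> Phi Lambda phi = 0%E &
      forall x Lambda phi, L x ->
        Phi (shift_fset x Lambda) phi = Phi Lambda (shift_height x phi)].

(* The unordered sum is the difference of the sums of the positive parts and *)
(* of the negative parts. *)
Definition hamiltonian (Phi : potential) (Lambda : {fset Zd d})
    (Delta : set (Zd d)) (phi : Omega) : \bar R :=
  let I := [set Gamma : {fset Zd d} |
             [set` Gamma] `<=` Delta /\ ~~ [disjoint Gamma & Lambda]%fset] in
  (\esum_(Gamma in I) maxe (Phi Gamma phi) 0 -
   \esum_(Gamma in I) maxe (- Phi Gamma phi) 0)%E.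

Definition lipschitz_at (A : rel (Zd d)) (q : Zd d -> Zd d -> R) (phi : Omega)
    (z : Zd d) : Prop :=
  forall y, A z y ->
    height_val (height_sub (phi y) (phi z)) <= q z y /\
    height_val (height_sub (phi z) (phi y)) <= q y z.

Definition finite_range (Psi : potential) : Prop :=
  exists N : nat, forall Lambda,
    (exists x y, [/\ x \in Lambda, y \in Lambda & (N < d1 x y)%N]) ->
    forall phi, Psi Lambda phi = 0%E.

Definition lipschitz_potential (A : rel (Zd d)) (q : Zd d -> Zd d -> R)
    (Psi : potential) : Prop :=
  forall Lambda phi, Psi Lambda phi = +oo%E <->
    exists x y, [/\ A x y, Lambda = [fset x; y]%fset &
                 q x y < height_val (height_sub (phi y) (phi x))].

(* The existence of q_eps for small eps is part of the condition. *)
Definition locally_bounded (L : set (Zd d)) (A : rel (Zd d))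
    (q : Zd d -> Zd d -> R) (Psi : potential) : Prop :=
  exists2 eps0 : R, 0 < eps0 & forall eps, 0 < eps <= eps0 ->
    exists2 qe, is_reduced_quasimetric L A q eps qe &
    exists C : R, forall x phi, lipschitz_at A qe phi x ->
      (hamiltonian Psi [fset x]%fset setT phi <= C%:E)%E.

Definition strong_interaction (L : set (Zd d)) (Psi : potential) : Prop :=
  [/\ periodic_gradient_potential L Psi,
      forall Lambda phi, (0 <= Psi Lambda phi)%E,
      finite_range Psi &
      exists A q,
      [/\ local_lipschitz_constraint L A q,
          k = IntegerHeights -> forall x y, q x y \is a Num.int,
          lipschitz_potential A q Psi &
          k = RealHeights -> locally_bounded L A q Psi]].

Definition potential_norm (Xi : potential) : \bar R :=
  ereal_sup [set s | exists x phi,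
    s = \esum_(Lambda in [set Lambda : {fset Zd d} | x \in Lambda])
          `|Xi Lambda phi|%E].

Definition lower_exterior_bound (Xi : potential) (Lambda : {fset Zd d}) : \bar R :=
  ereal_sup [set s | exists phi,
    s = \esum_(Delta in [set Delta : {fset Zd d} |
                 ~~ [disjoint Delta & Lambda]%fset /\
                 ~~ (Delta `<=` Lambda)%fset])
          `|Xi Delta phi|%E].

Definition weak_interaction (L : set (Zd d)) (Xi : potential) : Prop :=
  [/\ periodic_gradient_potential L Xi,
      (potential_norm Xi < +oo)%E &
      amenable L (lower_exterior_bound Xi)].

Definition strong_plus_weak (L : set (Zd d)) (Phi : potential) : Prop :=
  exists Psi Xi, [/\ strong_interaction L Psi, weak_interaction L Xi &
    forall Lambda phi, Phi Lambda phi = (Psi Lambda phi + Xi Lambda phi)%E].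

(* dual_adde is the addition of \bar R for which -oo + +oo = +oo. *)
Definition free_energy (Phi : potential) (Lambda : {fset Zd d}) (mu : grad_prob) :
    \bar R :=
  dual_adde
    (relative_entropy (@grad_restriction [set` Lambda] mu)
       (grad_ref_measure Lambda))
    (\int[mu]_phi hamiltonian Phi Lambda [set` Lambda] phi)%E.

Definition box_free_energy (Phi : potential) (mu : grad_prob) (n : nat) : \bar R :=
  ((n%:R ^- d)%:E * free_energy Phi (box d n) mu)%E.

Definition specific_free_energy (Phi : potential) (mu : grad_prob) : \bar R :=
  limn (box_free_energy Phi mu).

Definition bounded_grad_cylinder (f : Omega -> R) : Prop :=
  [/\ exists Lambda : {fset Zd d},
        measurable_fun setT (f : coord_space [set` Lambda] -> R),
      measurable_fun setT (f : grad_space setT -> R) &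
      exists M : R, forall phi, `|f phi| <= M].

(* Continuity for the topology of uniform convergence on Omega. *)
Definition sup_norm_continuous (f : Omega -> R) : Prop :=
  forall phi (e : R), 0 < e -> exists2 delta : R, 0 < delta &
    forall psi : Omega,
      (forall x, `|height_val (psi x) - height_val (phi x)| < delta) ->
      `|f psi - f phi| < e.

(* The coarsest topology making mu |-> mu(f) continuous for all f in F. *)
Definition test_topology (F : set (Omega -> R)) : topologicalType :=
  @sup_topology grad_prob (set_type F) (fun f =>
    Topological.class (initial_topology
      (fun mu : grad_prob => (\int[mu]_phi set_val f phi)%R : R))).

Definition local_topology : topologicalType :=
  test_topology bounded_grad_cylinder.

Definition weak_local_topology : topologicalType :=
  test_topology [set f | bounded_grad_cylinder f /\
                         sup_norm_continuous f].

End height_functions.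

Definition polish (R : realType) (T : topologicalType) : Prop :=
  (exists2 D : set T, countable D & dense D) /\
  exists (M : metricType R) (h : T -> M) (g : M -> T),
    [/\ cancel h g, cancel g h, continuous h & continuous g] /\
    (forall F : set_system M, ProperFilter F -> cauchy F -> exists x : M, F --> x).

(* Main.v *)
(* Once the energy of a large enough box has finite mean, the Lipschitz constraint
   bounds all nearest-neighbour slopes almost surely by a constant K.  Relative
   entropy plus energy on a finite set D is then a Donsker-Varadhan supremum,
   dv(D), of mu(g) over bounded tests g with int exp(g - H^0_D) <= 1 over the set
   of K-bounded slopes.  The sum of tests on two adjacent disjoint sets, corrected
   by a constant and by the exterior bound e^-, is a test on the union, so dv is
   superadditive up to errors that are negligible on boxes.  Hence the specific
   free energy is the supremum over the box sizes n of (dv(box n) - error(n)) / n^d: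
   the limit exists, is bounded below, and its lower level set M_C is cut out by
   explicit bounds on dv in each box.  Mixing two tests costs at most ln 2, which
   disappears after division by n^d; this gives affinity.

   On M_C the bounds on dv make the restrictions to each finite window uniformly
   absolutely continuous, so an ultrafilter limit of the probabilities of cylinder
   events is countably additive on each window.  It extends to F^nabla by inner
   regularity, since closed cylinder sets of K-bounded slope functions are compact
   modulo constants.  The limit lies in M_C again and is a limit in the topology of
   local convergence.  So M_C is compact for both topologies; countably many
   continuous cylinder functions separate its points, hence the two topologies
   agree on M_C and are metrizable, and the closedness of every M_C is lower
   semicontinuity. *)
From HB Require Import structures.
Require Import Defs.
From mathcomp Require Import all_boot all_order all_algebra finmap.
From mathcomp Require Import all_classical all_reals all_analysis.
From mathcomp Require Import measurable_realfun ring lra zify.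
Import Order.TTheory GRing.Theory Num.Theory numFieldNormedType.Exports.
Local Open Scope classical_set_scope.
Local Open Scope ring_scope.
Set Implicit Arguments.
Unset Strict Implicit.
Unset Printing Implicit Defensive.

(** * Relative entropy as a supremum over bounded tests *)

(** The single inequality [int exp(g - H^0_D) <= 1] is stable under products of tests and makes
    sense for infinite energies and entropies, so all estimates are made on tests. The reference
    measure on gradients has infinite mass; only its restriction to K-bounded slopes gives a finite
    tilted mass. For a small set D the quantity dv(D) is not the free energy of D, since a finite
    free energy there does not exclude slopes beyond K. The two agree on boxes that contain enough
    edges of the constraint graph, which suffices for the limit, while superadditivity is proved for
    dv on all finite sets. When a piece is added, the error must depend on that piece alone: hence
    only e^- of the added set enters, and one pair of neighbours joins the piece to the rest, at the
    cost of ln lambda([-K, K]). Tiles have a side divisible by N, where N Z^d lies in L, so that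
    they are translates under L; leftover sites are added one at a time at bounded cost. Compactness
    of slope-bounded configurations is used without a topology on Omega: closed means stable under
    limits of increments along one fixed ultrafilter on nat. *)

Section integral_lower_bound.
Context d (T : measurableType d) (R : realType).
Variable mu : {measure set T -> \bar R}.
Local Open Scope ereal_scope.

(** Here [F] need not be integrable: since its negative part is dominated by that of [l], its
    integral is a genuine difference. The logarithm of a density and the energy of a box are treated
    in this way. *)
Lemma integral_ge_integrable (l F : T -> \bar R) :
  mu.-integrable setT l -> measurable_fun setT F ->
  {ae mu, forall x, l x <= F x} ->
  \int[mu]_x F^\- x < +oo /\ \int[mu]_x l x <= \int[mu]_x F x.
Proof.
move=> il mF lF.
have ml : measurable_fun setT l by exact: measurable_int il.
have Fn : \int[mu]_x F^\- x <= \int[mu]_x l^\- x.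
  apply: ae_ge0_le_integral => //; [exact: measurable_funeneg..|].
  apply: filterS lF => x lFx _; rewrite !funenegE.
  by rewrite ge_max !le_max leeN2 lFx/= lexx orbT.
have Fp : \int[mu]_x l^\+ x <= \int[mu]_x F^\+ x.
  apply: ae_ge0_le_integral => //; [exact: measurable_funepos..|].
  apply: filterS lF => x lFx _; rewrite !funeposE.
  by rewrite ge_max !le_max lFx/= lexx orbT.
split; first by apply: le_lt_trans Fn _; exact: integral_funeneg_lt_pinfty.
by rewrite integralE [leRHS]integralE; exact: leeB.
Qed.

End integral_lower_bound.

Section truncation.
Context d (T : measurableType d) (R : realType).
Variable mu : {measure set T -> \bar R}.
Local Open Scope ereal_scope.

Lemma cvg_mine_nat (y : \bar R) : 0 <= y -> mine y n%:R%:E @[n --> \oo] --> y.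
Proof.
case: y => [r|_|//].
- rewrite lee_fin => r0; apply: cvg_near_cst.
  exists (Num.truncn r).+1 => //= n /= rn; apply/min_idPl.
  rewrite lee_fin; apply: le_trans (ltW (truncnS_gt r)) _.
  by rewrite ler_nat.
- rewrite (_ : (fun n => _) = fun n => n%:R%:E :> \bar R); first by apply/cvgenyP; exact: cvg_id.
  by apply/funext => n; apply/min_idPr; rewrite leey.
Qed.

(** Tests are bounded, so an unbounded function is reached only through its truncations; monotone
    convergence passes to the limit. *)
Lemma integral_truncation_le (f : T -> \bar R) (X : \bar R) :
  measurable_fun setT f -> (forall x, 0 <= f x) ->
  (forall n : nat, \int[mu]_x mine (f x) n%:R%:E <= X) -> \int[mu]_x f x <= X.
Proof.
move=> mf f0 fX.
have mfn n : measurable_fun setT (fun x => mine (f x) n%:R%:E).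
  by apply: measurable_mine => //; exact: measurable_cst.
have fE : \int[mu]_x f x = limn (fun n => \int[mu]_x mine (f x) n%:R%:E).
  rewrite -monotone_convergence//.
  - by apply: eq_integral => x _; apply/esym/cvg_lim => //; exact: cvg_mine_nat.
  - by move=> n x _; rewrite le_min f0 lee_fin ler0n.
  - move=> x _ n m nm; rewrite le_min !ge_min lexx/= lee_fin ler_nat nm.
    by rewrite orbT.
rewrite fE; apply: lime_le; last exact: nearW.
apply: ereal_nondecreasing_is_cvgn => n m nm; apply: ge0_le_integral => //.
- by move=> x _; rewrite le_min f0 lee_fin ler0n.
- move=> x _; rewrite le_min !ge_min lexx/= lee_fin ler_nat nm.
  by rewrite orbT.
Qed.

End truncation.

Lemma integrable_of_parts d (T : measurableType d) (R : realType)
    (mu : {measure set T -> \bar R}) (f : T -> \bar R) :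
  measurable_fun setT f -> (\int[mu]_x f^\+ x < +oo)%E ->
  (\int[mu]_x f^\- x < +oo)%E -> mu.-integrable setT f.
Proof.
move=> mf fp fn; apply/integrableP; split => //.
rewrite -/(abse \o f) fune_abse ge0_integralD//; first exact: lte_add_pinfty.
- exact: measurable_funepos.
- exact: measurable_funeneg.
Qed.

Section measurable_exp_log.
Context (R : realType).
Local Open Scope ereal_scope.

Lemma measurable_expeR : measurable_fun setT (@expeR R).
Proof.
rewrite (_ : @expeR R = fun x => if x == +oo then +oo else if x == -oo then 0
    else (expR (fine x))%:E); last by apply/funext; case.
apply: measurable_fun_ifT; [exact: measurable_fun_eqe|exact: measurable_cst|].
apply: measurable_fun_ifT; [exact: measurable_fun_eqe|exact: measurable_cst|].
apply/measurable_EFinP; apply: measurableT_comp; first exact: measurable_expR.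
exact: fine_measurable.
Qed.

Lemma measurable_lne : measurable_fun setT (@lne R).
Proof.
rewrite (_ : @lne R = fun x => if x == +oo then +oo else if x <= 0 then -oo
    else (ln (fine x))%:E); last first.
  by apply/funext => -[r| |] //=; rewrite leNye.
apply: measurable_fun_ifT; [exact: measurable_fun_eqe|exact: measurable_cst|].
apply: measurable_fun_ifT; [|exact: measurable_cst|].
  by apply: measurable_fun_lee => //; exact: measurable_cst.
apply/measurable_EFinP; apply: measurableT_comp; first exact: measurable_ln.
exact: fine_measurable.
Qed.

End measurable_exp_log.

Lemma maxeN_add (R : realType) (a w : \bar R) : (w != -oo ->
  maxe (- (a + w)) 0 <= maxe (- a) 0 + maxe (- w) 0)%E.
Proof.
case: a w => [a| |] [w| |]//= _.
- rewrite -!EFin_max -EFinD lee_fin ge_max; apply/andP; split.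
    by rewrite opprD lerD// le_max lexx.
  by rewrite addr_ge0// le_max lexx orbT.
- by rewrite [leLHS]max_r ?leNye// adde_ge0// le_max lexx orbT.
- by rewrite [leLHS]max_r ?leNye// adde_ge0// le_max lexx orbT.
- by rewrite [leLHS]max_r ?leNye// adde_ge0// le_max lexx orbT.
- by rewrite max_l ?leey// -EFin_max addye ?leey.
- by rewrite max_l ?leey// [X in (_ + X)%E]max_r ?leNye// addye ?leey.
Qed.

Lemma measurable_ltr_set d (T : measurableType d) (R : realType) (f g : T -> R) :
  measurable_fun setT f -> measurable_fun setT g ->
  measurable [set x | f x < g x].
Proof.
move=> mf mg.
have /(_ measurableT [set true] Logic.I) := measurable_fun_ltr mf mg.
by rewrite setTI.
Qed.

Lemma bounded_integrable d (T : measurableType d) (R : realType)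
    (m : {finite_measure set T -> \bar R}) (g : T -> R) (M : R) :
  measurable_fun setT g -> (forall x, (`|g x| <= M)%R) ->
  m.-integrable setT (EFin \o g).
Proof.
move=> mg gM; apply: measurable_bounded_integrable => //.
  exact: fin_num_fun_lty.
exists M; split; first exact: num_real.
by move=> x Mx y _ /=; apply: le_trans (gM y) (ltW Mx).
Qed.

(* Donsker-Varadhan without logarithms: the test functions [g] are normalised so *)
(* that their exponential integral is at most 1. *)
Section tilted_entropy.
Context d (T : measurableType d) (R : realType).
Variables (nu : {sigma_finite_measure set T -> \bar R}).
Variables (W : T -> \bar R) (S : set T) (b : R).
Local Open Scope ereal_scope.

(** The integral runs over [S] because [nu] may have infinite mass; when [nu S] is finite and [W] is
    bounded below, tests exist. *)
Definition tilted_test (g : T -> R) : Prop :=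
  [/\ measurable_fun setT g, exists M : R, forall x, (`|g x| <= M)%R &
      \int[nu]_(x in S) expeR ((g x)%:E - W x) <= 1].

Definition tilted_sup (mu : probability T R) :=
  ereal_sup [set \int[mu]_x (g x)%:E | g in tilted_test].

Variable mu : probability T R.
Hypotheses (mS : measurable S) (mW : measurable_fun setT W)
  (Wb : forall x, (- b)%:E <= W x) (nuS : nu S < +oo).

Let int_cst (c : R) : \int[mu]_x c%:E = c%:E.
Proof.
have := integral_cst mu measurableT c%:E; rewrite /cst => ->.
by rewrite -[RHS]mule1; congr (_ * _); exact: probability_setT.
Qed.

Lemma measurable_tilt (g : T -> R) : measurable_fun setT g ->
  measurable_fun setT (fun x => expeR ((g x)%:E - W x)).
Proof.
move=> mg; apply: measurableT_comp; first exact: measurable_expeR.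
by apply: emeasurable_funB => //; exact/measurable_EFinP.
Qed.

Lemma tilt_mass_fin (c : R) : exists2 Z : R, (0 <= Z)%R &
  \int[nu]_(x in S) expeR (c%:E - W x) <= Z%:E.
Proof.
exists (expR (c + b) * fine (nu S))%R.
  by rewrite mulr_ge0 ?expR_ge0 ?fine_ge0.
rewrite EFinM fineK ?ge0_fin_numE// -integral_cst//.
apply: ge0_le_integral => //.
- by move=> x _; exact: expeR_ge0.
- apply: measurable_funTS.
  by apply: measurable_tilt; exact: measurable_cst.
- by move=> x _; rewrite -[leRHS]/(expeR (c + b)%:E) lee_expeR EFinD leeD2l// leeNl.
Qed.

Lemma tilted_test_cst : exists c : R, tilted_test (fun=> c).
Proof.
have [Z Z0 ZS] := tilt_mass_fin 0.
(* [Z + 1] because the mass bound [Z] may be zero. *)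
exists (- ln (Z + 1))%R; split; first exact: measurable_cst.
  by eexists => x; exact: lexx.
rewrite (eq_integral (fun x => ((Z + 1)^-1)%R%:E * expeR (0%:E - W x))); last first.
  move=> x _; rewrite add0e expeRD/= expRN lnK// posrE; lra.
rewrite ge0_integralZl//; last 3 first.
- by apply: measurable_funTS; apply: measurable_tilt; exact: measurable_cst.
- by move=> x _; exact: expeR_ge0.
- by rewrite lee_fin invr_ge0; lra.
apply: (@le_trans _ _ (((Z + 1)^-1)%R%:E * Z%:E)).
  by rewrite lee_wpmul2l// lee_fin invr_ge0; lra.
by rewrite -EFinM lee_fin mulrC ler_pdivrMr; lra.
Qed.

Lemma tilted_test_ub g : tilted_test g -> \int[mu]_x (g x)%:E <= tilted_sup mu.
Proof. by move=> tg; apply: ereal_sup_ubound; exists g. Qed.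

Lemma tilted_sup_gtNy : -oo < tilted_sup mu.
Proof.
have [c tc] := tilted_test_cst.
apply: lt_le_trans (tilted_test_ub tc).
by rewrite int_cst ltNyr.
Qed.

(** Inside [S] the set [A] is invisible to [nu], so adding [n * \1_A] to a test does not change its
    exponential integral, while its mean under [mu] grows without bound. *)
Lemma tilted_sup_singular A : measurable A -> nu (A `&` S) = 0 -> 0 < mu A ->
  tilted_sup mu = +oo.
Proof.
move=> mA nuA muA; have [c [mc _ Zc]] := tilted_test_cst.
have test (n : nat) : tilted_test (fun x => n%:R * \1_A x + c)%R.
  split.
  - by apply: measurable_funD => //; apply: measurable_funM.
  - exists (n%:R + `|c|)%R => x; apply: le_trans (ler_normD _ _) _.
    rewrite lerD2r ger0_norm ?mulr_ge0//.
    by rewrite ler_piMr// indicE; case: (_ \in _).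
  - rewrite (ge0_negligible_integral (measurableI _ _ mA mS))//; last 2 first.
      apply: measurable_funTS; apply: measurable_tilt.
      by apply: measurable_funD => //; apply: measurable_funM.
    by move=> x _; exact: expeR_ge0.
    apply: le_trans Zc.
    rewrite (eq_integral (fun x => expeR (c%:E - W x))); last first.
      move=> x; rewrite inE/= => -[Sx nASx]; rewrite indicE memNset ?mulr0 ?add0r//.
      by move=> Ax; apply: nASx.
    apply: ge0_subset_integral => //; first exact: measurableD mS (measurableI _ _ mA mS).
      by apply: measurable_funTS; exact: measurable_tilt.
    by move=> x _; exact: expeR_ge0.
have Hn (n : nat) : (n%:R * fine (mu A) + c)%:E <= tilted_sup mu.
  apply: le_trans (tilted_test_ub (test n)).
  under eq_integral do rewrite EFinD EFinM.
  have i1 : mu.-integrable setT (fun x => n%:R%:E * (\1_A x)%:E).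
    apply: integrableZl => //; exact: integrable_indic.
  rewrite integralD//; last exact: finite_measure_integrable_cst.
  rewrite integralZl//; last exact: integrable_indic.
  rewrite integral_indic// setIT int_cst.
  by rewrite EFinD EFinM fineK// fin_num_measure.
have muA0 : (0 < fine (mu A))%R.
  by rewrite fine_gt0// muA/= ltey_eq fin_num_measure.
apply/eqyP => B B0; pose n := Num.truncn ((B + `|c|) / fine (mu A)).
apply: le_trans (Hn n.+1); rewrite lee_fin -lerBlDr.
have /ltW := truncnS_gt ((B + `|c|) / fine (mu A)).
rewrite -/n ler_pdivrMr//; apply: le_trans.
by rewrite lerD2l lerNl; exact: lerNnormlW.
Qed.

(** The functions [min(W^+, n) - c] are tests that track the energy itself, and their means tend to
    infinity with [n]. *)
Lemma tilted_sup_infinite_energy : \int[mu]_x W x = +oo -> tilted_sup mu = +oo.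
Proof.
move=> Woo; have iWp : \int[mu]_x W^\+ x = +oo.
  apply/eqP; rewrite -leye_eq -Woo integralE.
  rewrite geeDl// oppe_le0; exact: integral_ge0.
apply/eqP; rewrite -leye_eq.
(* Since [W^+ - W] is at most [|b|], the exponential integral of [min(W^+, n) - c] is at most
   [expR (|b| - c) * nu S], and this [c] makes it less than 1. *)
pose c := ln (expR `|b| * (fine (nu S) + 1)).
have S0 : (0 <= fine (nu S))%R by exact: fine_ge0.
have ec : expR c = (expR `|b| * (fine (nu S) + 1))%R.
  by rewrite lnK// posrE mulr_gt0 ?expR_gt0//; lra.
have mWp : measurable_fun setT W^\+ by exact: measurable_funepos.
have mWn (n : nat) : measurable_fun setT (fun x => mine (W^\+ x) n%:R%:E).
  by apply: measurable_mine => //; exact: measurable_cst.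
have Wn0 (n : nat) x : 0 <= mine (W^\+ x) n%:R%:E.
  by rewrite le_min funepos_ge0 lee_fin ler0n.
have Wnfin (n : nat) x : mine (W^\+ x) n%:R%:E \is a fin_num.
  rewrite ge0_fin_numE//; apply: (@le_lt_trans _ _ n%:R%:E); last by rewrite ltry.
  by rewrite ge_min lexx orbT.
pose f (n : nat) x := fine (mine (W^\+ x) n%:R%:E).
have mf n : measurable_fun setT (f n).
  by apply: measurableT_comp; [exact: fine_measurable|exact: mWn].
have fb n x : (`|f n x| <= n%:R)%R.
  rewrite ger0_norm ?fine_ge0// -lee_fin fineK//.
  by rewrite ge_min lexx orbT.
have test n : tilted_test (fun x => f n x - c)%R.
  split; first by apply: measurable_funB.
    exists (n%:R + `|c|)%R => x; apply: le_trans (ler_normB _ _) _.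
    by rewrite lerD2r.
  apply: (@le_trans _ _ (\int[nu]_(x in S) (expR (`|b| - c))%:E)).
    apply: ge0_le_integral => //.
    - by move=> x _; exact: expeR_ge0.
    - by apply: measurable_funTS; apply: measurable_tilt; exact: measurable_funB.
    - move=> x _; rewrite -[leRHS]/(expeR (`|b| - c)%:E) lee_expeR.
      rewrite EFinB /f fineK// addeAC [leRHS]EFinB leeB//.
      have := Wb x; have -> : W^\+ x = maxe (W x) 0 by rewrite funeposE.
      case: (W x) => [w|_|//]; last by rewrite addeNy leNye.
      rewrite lee_fin => bw; apply: (@le_trans _ _ (maxe w%:E 0 - w%:E)).
        by apply: leeB => //; rewrite ge_min lexx.
      rewrite -EFin_max -EFinB lee_fin lerBlDr ge_max lerDr normr_ge0/=.
      by have := ler_norm b; lra.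
  have := integral_cst nu mS (expR (`|b| - c))%:E; rewrite /cst => ->.
  rewrite (_ : (_ * _) = (expR (`|b| - c) * fine (nu S))%:E); last first.
    by rewrite EFinM fineK// ge0_fin_numE.
  rewrite lee_fin expRD expRN ec invfM mulrA divff ?gt_eqF ?expR_gt0// mul1r mulrC.
  by rewrite ler_pdivrMr; lra.
have Hn n : \int[mu]_x mine (W^\+ x) n%:R%:E <= tilted_sup mu + c%:E.
  rewrite -leeBlDr//; apply: le_trans (tilted_test_ub (test n)).
  under [leRHS]eq_integral do rewrite EFinB.
  rewrite integralB_EFin//; last exact: finite_measure_integrable_cst.
    rewrite int_cst; apply: leeB => //.
    by under [leRHS]eq_integral do rewrite /f fineK//.
  exact: bounded_integrable (fb n).
have := integral_truncation_le mWp (fun x => funepos_ge0 _ _) Hn.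
by rewrite iWp !leye_eq; have := tilted_sup_gtNy; case: tilted_sup.
Qed.

Section absolutely_continuous.
Hypotheses (munu : mu `<< nu) (muS : mu (~` S) = 0) (iW : mu.-integrable setT W).

Let r x := fine (Radon_Nikodym_SigmaFinite.f mu nu x).

Let rE x : Radon_Nikodym_SigmaFinite.f mu nu x = (r x)%:E.
Proof. by rewrite fineK// Radon_Nikodym_SigmaFinite.f_fin_num. Qed.

Let r_ge0 x : (0 <= r x)%R.
Proof. by rewrite -lee_fin -rE Radon_Nikodym_SigmaFinite.f_ge0. Qed.

Let mr : measurable_fun setT r.
Proof.
apply: measurableT_comp; first exact: fine_measurable.
exact: measurable_int (Radon_Nikodym_SigmaFinite.f_integrable munu).
Qed.

Let r_gt0 : {ae mu, forall x, (0 < r x)%R}.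
Proof.
have mN : measurable [set x | (r x <= 0)%R].
  by rewrite -[X in measurable X]setTI; apply: measurable_fun_le.
exists [set x | (r x <= 0)%R]; split => //; last first.
  by move=> x /= /negP; rewrite -leNgt.
rewrite (Radon_Nikodym_SigmaFinite.f_integral munu mN).
rewrite (eq_integral (cst 0)) ?integral0// => x; rewrite inE/= => rx.
by rewrite rE; congr EFin; apply: le_anti; rewrite rx r_ge0.
Qed.

Let W_fin : {ae mu, forall x, W x \is a fin_num}.
Proof.
have := integrable_ae measurableT iW.
by apply: filterS => x; apply.
Qed.

Let S_ae : {ae mu, forall x, S x}.
Proof. by exists (~` S); split => //; exact: measurableC. Qed.

Let w x := fine (W x).

Let mw : measurable_fun setT w.
Proof. by apply: measurableT_comp => //; exact: fine_measurable. Qed.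

Let iw : mu.-integrable setT (EFin \o w).
Proof.
apply: (le_integrable measurableT _ _ iW); first exact/measurable_EFinP.
by move=> x _; rewrite /w /=; case: (W x) => //=; rewrite normr0 leey.
Qed.

Let entropyE : \int[mu]_x lne (Radon_Nikodym (charge_of_finite_measure mu) nu x)
  = \int[mu]_x lne (r x)%:E.
Proof.
apply: ae_eq_integral => //.
- apply: measurableT_comp; first exact: measurable_lne.
  exact: measurable_int (Radon_Nikodym_integrable _).
- by apply: measurableT_comp; [exact: measurable_lne|exact/measurable_EFinP].
have := ae_eq_Radon_Nikodym_SigmaFinite munu measurableT.
move=> [N [mN nuN0 subN]]; exists N; split => //.
  by have /null_content_dominatesP := munu; apply.
apply: subset_trans subN => x /= h1 h2; apply: h1 => _.
by rewrite -h2 ?rE.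
Qed.

Let mlr : measurable_fun setT (fun x => lne (r x)%:E).
Proof.
by apply: measurableT_comp; [exact: measurable_lne|exact/measurable_EFinP].
Qed.

(** The inequality [1 + t <= exp t] at [t = g - W - ln r] gives [ln r >= g - W + 1 - h] with
    [h = exp t]. The [mu]-integral of [h] is the [nu]-integral of [exp (g - W)] over a part of [S],
    hence at most 1. *)
Lemma entropy_ge_test g : tilted_test g ->
  \int[mu]_x (fun x => lne (r x)%:E)^\- x < +oo /\
  \int[mu]_x (g x)%:E - \int[mu]_x W x <= \int[mu]_x lne (r x)%:E.
Proof.
move=> [mg [M gM] Zg].
(* Off [E] the logarithm or [fine] could return a default value; [mu] gives full mass to [E]. *)
pose E := S `&` [set x | (0 < r x)%R] `&` [set x | W x < +oo].
have mE : measurable E.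
  apply: measurableI; first apply: measurableI => //.
    exact: measurable_ltr_set.
  rewrite -[X in measurable X]setTI; exact: emeasurable_fun_infty_o.
pose h x := (expR (g x - w x - ln (r x)) * \1_E x)%R.
have mh : measurable_fun setT h.
  apply: measurable_funM; last exact: measurable_indic.
  apply: measurableT_comp; first exact: measurable_expR.
  apply: measurable_funB; first exact: measurable_funB.
  by apply: measurableT_comp => //; exact: measurable_ln.
have h0 x : (0 <= h x)%R by rewrite mulr_ge0 ?expR_ge0.
have ih1 : \int[mu]_x (h x)%:E <= 1.
  rewrite -(Radon_Nikodym_SigmaFinite.change_of_variables munu) //; last first.
    exact/measurable_EFinP.
  apply: le_trans Zg; rewrite [leRHS]integral_mkcond.
  apply: ge0_le_integral => //.
  - by move=> x _; rewrite rE mule_ge0// lee_fin.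
  - under eq_fun do rewrite rE -EFinM.
    by apply/measurable_EFinP; exact: measurable_funM.
  - apply/(measurable_restrictT _ mS); apply: measurable_funTS.
    exact: measurable_tilt.
  - move=> x _; rewrite rE -EFinM /h indicE.
    have [xE|xE] := boolP (x \in E); last first.
      rewrite mulr0 mul0r patchE; case: ifPn => // _; exact: expeR_ge0.
    move: xE; rewrite inE => -[[Sx rx] Wx].
    rewrite mulr1 patchE mem_set// expRD expRN lnK// mulfVK ?gt_eqF//.
    have WE : W x = (w x)%:E.
      by rewrite fineK// fin_numE gt_eqF ?lt_eqF//; apply: lt_le_trans (Wb x); rewrite ltNyr.
    by rewrite WE -EFinB.
have ih : mu.-integrable setT (EFin \o h).
  apply/integrableP; split; first exact/measurable_EFinP.
  under eq_integral do rewrite /= ger0_norm//.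
  by apply: le_lt_trans ih1 _; rewrite ltry.
have ig : mu.-integrable setT (EFin \o g) by exact: bounded_integrable gM.
pose l x := ((g x)%:E - (w x)%:E) + (1 - (h x)%:E).
have igw : mu.-integrable setT (fun x => (g x)%:E - (w x)%:E).
  exact: integrableB.
have i1h : mu.-integrable setT (fun x => 1 - (h x)%:E).
  by apply: integrableB => //; exact: finite_measure_integrable_cst.
have il : mu.-integrable setT l by exact: integrableD.
have le_l : {ae mu, forall x, l x <= lne (r x)%:E}.
  apply: filterS3 r_gt0 W_fin S_ae => x rx Wx Sx.
  rewrite lne_EFin// /l /h indicE mem_set//; last first.
    by split => //=; rewrite ltey_eq Wx.
  rewrite mulr1 -!EFinD lee_fin.
  have := expR_ge1Dx (g x - w x - ln (r x)); lra.
have [Fn Fl] := integral_ge_integrable il mlr le_l; split => //.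
apply: le_trans Fl; rewrite /l integralD// integralB// integralB//; last first.
  exact: finite_measure_integrable_cst.
rewrite int_cst -[leLHS]adde0; apply: leeD; last first.
  by rewrite leeBrDr ?add0e//; exact: integrable_fin_num.
apply: leeB => //; rewrite le_eqVlt; apply/orP; left; apply/eqP.
apply: ae_eq_integral => //; first exact/measurable_EFinP.
by apply: filterS W_fin => x Wx _; rewrite /w fineK.
Qed.

Section clamped_test.
Variables (A e : R) (n : nat).
Hypothesis (Ae : \int[nu]_(x in S) expeR ((- A)%:E - W x) <= e%:E).

Let u x := lne (r x)%:E + W x.

Let mu_ : measurable_fun setT u. Proof. exact: emeasurable_funD. Qed.

(** The optimal test would be [u = ln r + W], for which [exp (u - W)] is the density [r]. Clamping
    by [- A] from below and by [n] from above makes it bounded; the lower clamp adds at most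
    [exp (- A - W)], a mass of at most [e]. *)
Definition clamped_density x := fine (mine (maxe (u x) (- A)%:E) n%:R%:E).

Let clE x : mine (maxe (u x) (- A)%:E) n%:R%:E = (clamped_density x)%:E.
Proof.
rewrite /clamped_density fineK// fin_numE; apply/andP; split.
  rewrite gt_eqF// lt_min ltNyr lt_max ltNyr orbT//.
by rewrite lt_eqF// gt_min ltry orbT.
Qed.

Lemma measurable_clamped_density : measurable_fun setT clamped_density.
Proof.
apply: measurableT_comp; first exact: fine_measurable.
apply: measurable_mine; last exact: measurable_cst.
by apply: measurable_maxe => //; exact: measurable_cst.
Qed.

Lemma clamped_density_bounded x : (`|clamped_density x| <= `|A| + n%:R)%R.
Proof.
rewrite ler_norml -!lee_fin -clE; apply/andP; split.
  rewrite le_min le_max !lee_fin; apply/andP; split.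
    by apply/orP; right; have := ler_norm A; have := ler0n R n; lra.
  by have := normr_ge0 A; have := ler0n R n; lra.
rewrite ge_min; apply/orP; right; rewrite lee_fin.
by have := normr_ge0 A; lra.
Qed.

Lemma expeR_clamped_density x :
  expeR ((clamped_density x - e)%:E - W x) <=
  (expR (- e))%:E * ((r x)%:E + expeR ((- A)%:E - W x)).
Proof.
rewrite EFinB addeAC expeRD [X in X <= _]muleC [expeR (- _)%E]/=.
rewrite lee_wpmul2l ?lee_fin ?expR_ge0//.
have cl_le : (clamped_density x)%:E <= maxe (u x) (- A)%:E.
  by rewrite -clE ge_min lexx.
have := Wb x; case WE : (W x) => [w0| |]// _; last first.
  by rewrite addeNy/= adde0 lee_fin.
have [rx|rx] := ltP 0%R (r x); last first.
  have -> : r x = 0%R by apply: le_anti; rewrite rx r_ge0.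
  rewrite add0e lee_expeR; apply: leeB => //; apply: le_trans cl_le _.
  by rewrite /u le0_lneNy ?lee_fin// addNye ge_max leNye lexx.
move: cl_le; rewrite /u WE lne_EFin// -EFinD -EFin_max lee_fin => cl_le.
rewrite -EFinB /= lee_fin.
apply: (@le_trans _ _ (expR (Num.max (ln (r x) + w0) (- A) - w0))%R).
  by rewrite ler_expR lerD2r.
rewrite /Num.max; case: ifPn => _.
  by rewrite lerDr.
by rewrite addrK lnK ?posrE// lerDl expR_ge0.
Qed.

(** The clamped density has exponential integral at most [1 + e <= expR e], which the subtraction of
    [e] absorbs. *)
Lemma tilted_test_clamped : tilted_test (fun x => clamped_density x - e)%R.
Proof.
split.
- by apply: measurable_funB => //; exact: measurable_clamped_density.
- exists (`|A| + n%:R + `|e|)%R => x; apply: le_trans (ler_normB _ _) _.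
  by rewrite lerD2r clamped_density_bounded.
have mt c : measurable_fun S (fun x => expeR (c%:E - W x)).
  by apply: measurable_funTS; apply: (@measurable_tilt (cst c)); exact: measurable_cst.
have mrS : measurable_fun S (fun x => (r x)%:E).
  by apply/measurable_EFinP; exact: measurable_funTS.
have rt0 x : 0 <= (r x)%:E + expeR ((- A)%:E - W x).
  by rewrite adde_ge0 ?lee_fin ?expeR_ge0.
apply: (@le_trans _ _ (\int[nu]_(x in S)
    ((expR (- e))%:E * ((r x)%:E + expeR ((- A)%:E - W x))))).
  apply: ge0_le_integral => //.
  - by move=> x _; exact: expeR_ge0.
  - apply: measurable_funTS; apply: measurable_tilt.
    by apply: measurable_funB => //; exact: measurable_clamped_density.
  - by apply: emeasurable_funM => //; exact: emeasurable_funD.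
  - by move=> x _; exact: expeR_clamped_density.
rewrite ge0_integralZl//; [|exact: emeasurable_funD].
rewrite ge0_integralD//; [|by move=> x _; rewrite lee_fin|by move=> x _; exact: expeR_ge0].
apply: (@le_trans _ _ ((expR (- e))%:E * (1 + e%:E))).
  rewrite lee_wpmul2l ?lee_fin ?expR_ge0//; apply: leeD => //.
  have -> : 1 = \int[nu]_x (r x)%:E.
    under eq_integral do rewrite -rE.
    rewrite -(Radon_Nikodym_SigmaFinite.f_integral munu measurableT).
    by apply/esym; exact: probability_setT.
  apply: ge0_subset_integral => //; first exact/measurable_EFinP.
  by move=> x _; rewrite lee_fin.
rewrite -EFinD -EFinM lee_fin expRN mulrC ler_pdivrMr ?expR_gt0// mul1r.
exact: expR_ge1Dx.
Qed.

Lemma truncation_le_clamped x :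
  mine (u^\+ x) n%:R%:E <= (clamped_density x)%:E + u^\- x.
Proof.
rewrite -clE funeposE funenegE.
case: (u x) => [t| |].
- rewrite -EFinN -!EFin_max -!EFin_min -EFinD lee_fin.
  have := ler0n R n; case: (leP t 0%R); case: (leP t (- A)%R); case: (leP (- t) 0)%R;
    case: (leP t n%:R); case: (leP (- A)%R n%:R); case: (leP 0%R n%:R); lra.
- rewrite max_l ?leey// max_l ?leey// max_r ?leNye// adde0.
  by rewrite le_min !ge_min !lexx !orbT leey.
- by rewrite [maxe (- -oo) 0]max_l ?leey// addey ?leey// -ltNye ?lt_min ?lt_max ?ltNyr ?orbT.
Qed.

End clamped_test.

(** Only the positive part of [ln r + W] can have an infinite integral, because [entropy_ge_test]
    controls the negative part of [ln r]. Each truncation of the positive part is bounded by a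
    clamped test plus the negative part. *)
Lemma tilted_sup_ge :
  \int[mu]_x lne (r x)%:E + \int[mu]_x W x <= tilted_sup mu.
Proof.
have [c tc] := tilted_test_cst.
have [rn _] := entropy_ge_test tc.
pose u x := lne (r x)%:E + W x.
have mu_ : measurable_fun setT u by exact: emeasurable_funD.
have un : \int[mu]_x u^\- x < +oo.
  apply: (@le_lt_trans _ _ (\int[mu]_x ((fun x => lne (r x)%:E)^\- x + W^\- x))).
    apply: ge0_le_integral => //.
    - exact: measurable_funeneg.
    - by apply: emeasurable_funD; exact: measurable_funeneg.
    - move=> x _; rewrite /u !funenegE; have := Wb x.
      by move=> Wx; apply: maxeN_add; rewrite -ltNye (lt_le_trans _ Wx)// ltNyr.
  rewrite ge0_integralD//; [|exact: measurable_funeneg..].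
  by apply: lte_add_pinfty => //; exact: integral_funeneg_lt_pinfty.
have un_fin : \int[mu]_x u^\- x \is a fin_num.
  by rewrite ge0_fin_numE//; exact: integral_ge0.
have iun : mu.-integrable setT u^\-.
  apply/integrableP; split; first exact: measurable_funeneg.
  by under eq_integral do rewrite gee0_abs//.
have uE : \int[mu]_x u x <= tilted_sup mu.
  apply/lee_addgt0Pr => e e0.
  have [Z Z0 Ze] := tilt_mass_fin 0.
  (* With this [A] the mass added by the lower clamp is at most [expR (- A) * Z <= e]. *)
  pose A := ln ((Z + 1) / e).
  have Ze1 : (0 < (Z + 1) / e)%R by rewrite divr_gt0//; lra.
  have Ae : \int[nu]_(x in S) expeR ((- A)%:E - W x) <= e%:E.
    rewrite (eq_integral (fun x => (expR (- A))%:E * expeR (0%:E - W x))); last first.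
      by move=> x _; rewrite add0e expeRD.
    rewrite ge0_integralZl//; last 2 first.
    - by apply: measurable_funTS; apply: (@measurable_tilt (cst 0%R)); exact: measurable_cst.
    - by move=> x _; exact: expeR_ge0.
    apply: le_trans (lee_wpmul2l _ Ze) _; first by rewrite lee_fin expR_ge0.
    rewrite -EFinM lee_fin expRN lnK ?posrE// invf_div mulrAC ler_pdivrMr; last lra.
    by rewrite ler_pM2l//; lra.
  rewrite integralE leeBlDr//.
  apply: integral_truncation_le => [|//|n]; first exact: measurable_funepos.
  have tcl := @tilted_test_clamped A e n Ae.
  have mcl := measurable_clamped_density A n.
  have icl : mu.-integrable setT (fun x => (clamped_density A n x)%:E).
    exact: bounded_integrable (clamped_density_bounded A n).
  have cl_le : \int[mu]_x (clamped_density A n x)%:E <= tilted_sup mu + e%:E.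
    rewrite -leeBlDr//; apply: le_trans (tilted_test_ub tcl).
    under [leRHS]eq_integral do rewrite EFinB.
    rewrite integralB//; last exact: finite_measure_integrable_cst.
    by rewrite int_cst.
  apply: (@le_trans _ _ (\int[mu]_x ((clamped_density A n x)%:E + u^\- x))).
    apply: ge0_le_integral => //.
    - by move=> x _; rewrite le_min funepos_ge0 lee_fin ler0n.
    - by apply: measurable_mine; [exact: measurable_funepos|exact: measurable_cst].
    - apply: emeasurable_funD; first exact/measurable_EFinP.
      exact: measurable_funeneg.
    - by move=> x _; exact: truncation_le_clamped.
  by rewrite integralD//; apply: leeD.
have [uoo|uoo] := eqVneq (\int[mu]_x u x) +oo.
  by move: uE; rewrite uoo leye_eq => /eqP ->; exact: leey.
apply: le_trans uE; rewrite -leeBrDr; last exact: integrable_fin_num.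
have iu : mu.-integrable setT u.
  apply: integrable_of_parts => //.
  rewrite ltey; apply: contra uoo => /eqP up; rewrite integralE up addye//.
  by move: un; case: (\int[mu]_x u^\- x).
rewrite -integralB//.
rewrite le_eqVlt; apply/orP; left; apply/eqP; apply: ae_eq_integral => //.
  exact: emeasurable_funB.
by apply: filterS W_fin => x Wx _; rewrite /u addeK.
Qed.

Lemma relative_entropy_ae_cont :
  dual_adde (relative_entropy mu nu) (\int[mu]_x W x) = tilted_sup mu.
Proof.
have Wfin := integrable_fin_num measurableT iW.
rewrite /relative_entropy asboolT// entropyE.
have -> (y : \bar R) : dual_adde y (\int[mu]_x W x) = y + \int[mu]_x W x.
  by move: Wfin; case: (\int[mu]_x W x) => // t _; case: y.
apply: le_anti; rewrite tilted_sup_ge/=.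
apply: ge_ereal_sup => _ [g tg <-].
by rewrite -leeBlDr//; have [] := entropy_ge_test tg.
Qed.

End absolutely_continuous.

Hypothesis muS : \int[mu]_x W x < +oo -> mu (~` S) = 0.

(** If the mean energy is infinite or [mu] is not absolutely continuous, both sides are [+oo]. In
    the remaining case [mu] must be carried by [S]; this is demanded for finite mean energy only,
    since in the application finiteness of the energy is what enforces the constraint. *)
Theorem relative_entropy_tilted :
  dual_adde (relative_entropy mu nu) (\int[mu]_x W x) = tilted_sup mu.
Proof.
have [Woo|Woo] := eqVneq (\int[mu]_x W x) +oo.
  by rewrite tilted_sup_infinite_energy// Woo /dual_adde; case: relative_entropy.
have Wlt : \int[mu]_x W x < +oo by rewrite ltey.
have iW : mu.-integrable setT W.
  have Wn : \int[mu]_x W^\- x < +oo.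
    apply: (@le_lt_trans _ _ (\int[mu]_x `|b|%:E)); last by rewrite int_cst ltry.
    apply: ge0_le_integral => //.
    - exact: measurable_funeneg.
    - move=> x _; rewrite funenegE ge_max lee_fin normr_ge0 andbT leeNl.
      apply: le_trans (Wb x); rewrite lee_fin lerN2; exact: ler_norm.
  apply: integrable_of_parts => //.
  rewrite ltey; apply: contra Woo => /eqP up; rewrite integralE up addye//.
  by move: Wn; case: (\int[mu]_x W^\- x).
have [munu|munu] := pselect (mu `<< nu).
  exact: relative_entropy_ae_cont (muS Wlt) iW.
rewrite /relative_entropy asboolF//.
have [A [mA nuA muA]] : exists A, [/\ measurable A, nu A = 0 & mu A != 0].
  apply/not_existsP => H; apply: munu; apply/null_content_dominatesP => A mA nuA.
  by apply/eqP/negPn/negP => muA; apply: (H A).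
rewrite (tilted_sup_singular mA).
- by move: (\int[mu]_x W x) Woo => [].
- by apply/eqP; rewrite -measure_le0 -nuA le_measure ?inE//; exact: measurableI.
- by rewrite lt0e muA/=.
Qed.

End tilted_entropy.

(** * Heights and the reference measures *)

Section heights_group.
Context (R : realType) (k : height_kind).
Local Notation E := (heights R k).
Local Notation lambda := (ref_measure R k).

Definition height_add : E -> E -> E :=
  match k with
  | IntegerHeights => fun a b : int => a + b
  | RealHeights => fun a b : R => a + b
  end.

Definition height_opp : E -> E :=
  match k with
  | IntegerHeights => fun a : int => - a
  | RealHeights => fun a : R => - a
  end.

Lemma height_0add a : height_add (height0 R k) a = a.
Proof. by rewrite /height_add; case: k a => a; exact: add0r. Qed.

Lemma height_addN a : height_add a (height_opp a) = height0 R k.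
Proof. by rewrite /height_add /height_opp; case: k a => a; exact: subrr. Qed.

Lemma height_sub_add2 a b c :
  height_sub (height_add a c) (height_add b c) = height_sub a b.
Proof.
rewrite /height_sub /height_add; case: k a b c => a b c;
  by rewrite opprD addrACA subrr addr0.
Qed.

Lemma height_valB (a b : E) :
  height_val (height_sub a b) = height_val a - height_val b.
Proof.
by rewrite /height_val /height_sub; case: k a b => a b//; rewrite rmorphB.
Qed.

Lemma height_val_inj : injective (@height_val R k).
Proof.
by rewrite /height_val; case: k => a b //; exact: intr_inj.
Qed.

Lemma measurable_height_val : measurable_fun setT (@height_val R k).
Proof.
rewrite /height_val; case: k => //.
Qed.

Lemma measurable_height_opp : measurable_fun setT height_opp.
Proof.
rewrite /height_opp; case: k => //=; exact: oppr_measurable.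
Qed.

Lemma measurable_height_addr c : measurable_fun setT (height_add ^~ c).
Proof.
rewrite /height_add; case: k c => c //.
by apply: measurable_funD.
Qed.

Lemma counting_bij (f g : int -> int) (B : set int) : cancel f g -> cancel g f ->
  @counting int R (f @^-1` B) = @counting int R B.
Proof.
move=> fK gK; have fE : f @^-1` B = g @` B.
  apply/seteqP; split => [x Bx|_ [x Bx <-]]; last by rewrite /= gK.
  by exists (f x).
have Bfin : finite_set (g @` B) <-> finite_set B.
  split => [gB|]; last exact: finite_image.
  suff -> : B = f @` (g @` B) by exact: finite_image.
  by rewrite image_comp; apply/seteqP; split => [x Bx|_ [x Bx <-]] /=;
    [exists x => //=; rewrite gK|rewrite gK].
rewrite fE /counting; have [fB|fB] := pselect (finite_set B); last first.
  by rewrite !asboolF// Bfin.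
rewrite !asboolT//; last by rewrite Bfin.
congr (_%:R%:E); rewrite fset_set_image//.
by rewrite card_imfset//=; exact: can_inj gK.
Qed.

Lemma ref_measure_opp B : measurable B -> lambda (height_opp @^-1` B) = lambda B.
Proof.
rewrite /ref_measure /height_opp; case: k B => B mB /=.
  by apply: counting_bij; exact: opprK.
exact: lebesgue_measureN.
Qed.

Lemma lebesgue_measure_translation (c : R) (A : set R) : measurable A ->
  lebesgue_measure ((fun x : R => x + c) @^-1` A) = lebesgue_measure A.
Proof.
move=> mA.
have mf : measurable_fun setT (fun x : measurableTypeR R => x + c : measurableTypeR R).
  by apply: measurable_funD.
apply/esym/(@lebesgue_measure_unique R (pushforward lebesgue_measure
  (fun x : measurableTypeR R => x + c : measurableTypeR R))) => //= _ [[a b]] _ <-.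
rewrite /pushforward /=.
have -> : (fun x : R => x + c) @^-1` `]a, b] = `](a - c)%R, (b - c)%R]%classic.
  by apply/seteqP; split => x /=; rewrite !in_itv/= ltrBlDr lerBrDr.
rewrite !lebesgue_measure_itv/= !lte_fin ltrD2r -!EFinD.
by have -> : (b - c - (a - c) = b - a :> R)%R by ring.
Qed.

Lemma ref_measure_add c B : measurable B ->
  lambda ((height_add ^~ c) @^-1` B) = lambda B.
Proof.
rewrite /ref_measure /height_add; case: k c B => c B mB /=.
  apply: (@counting_bij _ (fun x => x - c)) => x; [exact: addrK|exact: subrK].
exact: lebesgue_measure_translation.
Qed.

Local Open Scope ereal_scope.

Lemma integral_ref_invariant (f : E -> E) (F : E -> \bar R) :
  measurable_fun setT f ->
  (forall B, measurable B -> lambda (f @^-1` B) = lambda B) ->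
  measurable_fun setT F -> (forall a, 0 <= F a) ->
  \int[lambda]_a F (f a) = \int[lambda]_a F a.
Proof.
move=> mf fl mF F0.
rewrite -[LHS](@ge0_integral_pushforward _ _ _ _ _ f mf lambda setT F)//.
by apply: eq_measure_integral => A mA _; exact: fl.
Qed.

Lemma integral_ref_add c (F : E -> \bar R) :
  measurable_fun setT F -> (forall a, 0 <= F a) ->
  \int[lambda]_a F (height_add a c) = \int[lambda]_a F a.
Proof.
apply: integral_ref_invariant; first exact: measurable_height_addr.
by move=> B mB; exact: ref_measure_add.
Qed.

Lemma integral_ref_opp (F : E -> \bar R) :
  measurable_fun setT F -> (forall a, 0 <= F a) ->
  \int[lambda]_a F (height_opp a) = \int[lambda]_a F a.
Proof.
apply: integral_ref_invariant; first exact: measurable_height_opp.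
by move=> B mB; exact: ref_measure_opp.
Qed.

Definition height_ball (r : R) : set E := [set a | `|height_val a| <= r]%R.

Lemma measurable_height_ball r : measurable (height_ball r).
Proof.
rewrite -[X in measurable X]setTI.
have mnorm : measurable_fun setT (fun a : E => `|height_val a|%R).
  by apply: measurableT_comp => //; exact: measurable_height_val.
have -> : height_ball r = (fun a : E => `|height_val a|%R) @^-1` `]-oo, r]%classic.
  by apply/seteqP; split => a; rewrite /= in_itv.
exact: mnorm.
Qed.

Lemma finite_int_ball (r : R) : finite_set [set z : int | (`|z%:~R| <= r)%R].
Proof.
pose n := Num.truncn r.
pose s := ([seq Posz i | i <- iota 0 n.+1] ++ [seq - Posz i | i <- iota 0 n.+1])%R.
apply: (@sub_finite_set _ _ [set` s]); last exact: finite_seq.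
move=> z /= zr.
have zn : (`|z| <= n)%N.
  rewrite -ltnS -(ltr_nat R); apply: le_lt_trans (truncnS_gt r).
  by rewrite natr_absz intr_norm.
rewrite mem_cat; apply/orP.
have zi : `|z|%N \in iota 0 n.+1 by rewrite mem_iota.
case: z {zr zn} zi => m zi; [left|right]; apply/mapP.
- by exists m.
- by exists m.+1 => //; rewrite NegzE.
Qed.

Lemma ref_measure_ball_fin (r : R) :
  lambda (height_ball r) < +oo.
Proof.
rewrite /ref_measure /height_ball /height_val; case: k => /=.
  by rewrite /counting asboolT ?ltry//; exact: finite_int_ball.
rewrite (_ : [set a | _] = `[(- r)%R, r]%classic); last first.
  by apply/seteqP; split => x /=; rewrite in_itv/= ler_norml.
by rewrite lebesgue_measure_itv/=; case: ifP => // _; rewrite -EFinD ltry.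
Qed.

(** Makes the joining cost [ln (lambda (height_ball K))] nonnegative, as the limit argument on boxes
    requires. *)
Lemma ref_measure_ball_ge1 (r : R) : (1 <= r)%R ->
  1 <= lambda (height_ball r).
Proof.
move=> r1; rewrite /ref_measure /height_ball /height_val; case: k => /=.
  rewrite /counting asboolT; last exact: finite_int_ball.
  rewrite lee_fin ler1n cardfs_gt0; apply/fset0Pn; exists (0 : int).
  rewrite in_fset_set; last exact: finite_int_ball.
  by rewrite inE /= normr0; lra.
rewrite (_ : [set a | _] = `[(- r)%R, r]%classic); last first.
  by apply/seteqP; split => x /=; rewrite in_itv/= ler_norml.
rewrite lebesgue_measure_itv/= lte_fin ifT; last by lra.
by rewrite -EFinD lee_fin; lra.
Qed.

End heights_group.

(** * Iterated integrals over coordinates *)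

Section coordinate_integral.
Context (R : realType) (k : height_kind) (d : nat).
Local Notation E := (heights R k).
Local Notation lambda := (ref_measure R k).
Local Notation Om := (Omega R k d).
Local Notation CT := (coord_space R k (@setT (Zd d))).
Local Open Scope ereal_scope.

Definition update (phi : Om) (x : Zd d) (a : E) : Om :=
  fun y => if y == x then a else phi y.

(** Integration acts on whole configurations rather than on tuples, so that coordinates can be
    reordered, split into blocks and shifted together. *)
Fixpoint cint (s : seq (Zd d)) (F : Om -> \bar R) : Om -> \bar R :=
  if s is x :: s' then fun phi => \int[lambda]_a cint s' F (update phi x a)
  else F.

Definition cmeas (F : Om -> \bar R) := measurable_fun setT (F : CT -> \bar R).

Lemma measurable_coord (x : Zd d) : measurable_fun setT (fun phi : CT => (phi : Om) x).
Proof.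
move=> _ B mB; rewrite setTI; apply: sub_sigma_algebra.
by exists x => //; exists B => //; rewrite setTI.
Qed.

Lemma measurable_into_coord dT (T : measurableType dT) (f : T -> Om) :
  (forall y, measurable_fun setT (fun t => f t y)) ->
  measurable_fun setT (f : T -> CT).
Proof.
move=> mf; apply: (@measurability _ _ _ CT setT f (coord_generator setT) erefl).
move=> _ [_ [y _ [B mB <-]] <-]; rewrite setTI.
by have := mf y measurableT B mB; rewrite !setTI.
Qed.

Lemma measurable_update x :
  measurable_fun setT (fun p : E * CT => update p.2 x p.1 : CT).
Proof.
apply: measurable_into_coord => y; rewrite /update; case: (y == x).
  exact: measurable_fst.
by apply: (@measurableT_comp _ _ _ _ _ _ _ _ snd (measurable_coord y)).
Qed.

Lemma measurable_update1 phi x :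
  measurable_fun setT (fun a : E => update phi x a : CT).
Proof.
apply: measurable_into_coord => y; rewrite /update; case: (y == x) => //.
Qed.

Lemma cint_ge0 s F : (forall phi, 0 <= F phi) -> forall phi, 0 <= cint s F phi.
Proof.
by move=> F0; elim: s => //= x s IH phi; apply: integral_ge0 => a _; exact: IH.
Qed.

Lemma cmeas_cint s F : (forall phi, 0 <= F phi) -> cmeas F -> cmeas (cint s F).
Proof.
move=> F0 mF; elim: s => //= x s IH.
apply: (measurable_fun_fubini_tonelli_G
  (fun p : E * CT => cint s F (update p.2 x p.1))).
  by apply: (@measurableT_comp _ _ _ _ _ _ (cint s F : CT -> _)) => //; exact: measurable_update.
by move=> p; exact: cint_ge0.
Qed.

Lemma cmeas_update1 F phi x : cmeas F ->
  measurable_fun setT (fun a : E => F (update phi x a)).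
Proof.
move=> mF; apply: (@measurableT_comp _ _ _ _ _ _ (F : CT -> _)) => //.
exact: measurable_update1.
Qed.

Lemma cint_cat s1 s2 F : cint (s1 ++ s2) F = cint s1 (cint s2 F).
Proof. by elim: s1 => //= x s1 ->. Qed.

(* Coordinates outside [s] are frozen. *)
Lemma eq_cint s F G phi :
  (forall psi, (forall y, y \notin s -> psi y = phi y) -> F psi = G psi) ->
  cint s F phi = cint s G phi.
Proof.
elim: s phi => [|x s IH] phi FG /=; first exact: FG.
apply: eq_integral => a _; apply: IH => psi psiE; apply: FG => y.
by rewrite inE negb_or => /andP[yx ys]; rewrite psiE// /update (negbTE yx).
Qed.

Lemma le_cint s F G : (forall phi, 0 <= F phi) -> cmeas F -> cmeas G ->
  (forall phi, F phi <= G phi) -> forall phi, cint s F phi <= cint s G phi.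
Proof.
move=> F0 mF mG FG; elim: s => //= x s IH phi.
have G0 psi : 0 <= G psi by apply: le_trans (FG psi).
apply: ge0_le_integral => //.
- by move=> a _; exact: cint_ge0.
- by apply: cmeas_update1; exact: cmeas_cint.
- by apply: cmeas_update1; exact: cmeas_cint.
Qed.

Lemma cint_swap x y s F : x != y -> (forall phi, 0 <= F phi) -> cmeas F ->
  cint (x :: y :: s) F = cint (y :: x :: s) F.
Proof.
move=> xy F0 mF; apply/funext => phi /=.
transitivity (\int[lambda]_b \int[lambda]_a
    cint s F (update (update phi x a) y b)).
  apply: (@fubini_tonelli _ _ E E R lambda lambda (fun p : E * E =>
    cint s F (update (update phi x p.1) y p.2))).
    apply: (@measurableT_comp _ _ _ _ _ _ (cint s F : CT -> _)).
      exact: cmeas_cint.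
    apply: measurable_into_coord => z; rewrite /update.
    by case: (z == y); case: (z == x) => //;
      [exact: measurable_snd|exact: measurable_snd|exact: measurable_fst].
  by move=> p; exact: cint_ge0.
apply: eq_integral => b _; apply: eq_integral => a _; congr (cint s F).
apply/funext => z; rewrite /update.
by have [->|//] := eqVneq z y; rewrite eq_sym (negbTE xy).
Qed.

Lemma cint_move x s1 s2 F : x \notin s1 -> (forall phi, 0 <= F phi) -> cmeas F ->
  cint (s1 ++ x :: s2) F = cint (x :: s1 ++ s2) F.
Proof.
move=> xs F0 mF; elim: s1 xs => [//|y s1 IH].
rewrite inE negb_or => /andP[xy xs].
rewrite cat_cons -cint_swap// 1?eq_sym//.
by apply/funext => phi /=; apply: eq_integral => a _; rewrite IH.
Qed.

Lemma perm_cint s t F : uniq s -> perm_eq s t -> (forall phi, 0 <= F phi) ->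
  cmeas F -> cint s F = cint t F.
Proof.
move=> us st F0 mF; elim: s t us st => [|x s IH] t us st.
  by move: st; rewrite perm_sym => /perm_nilP ->.
have xt : x \in t by rewrite -(perm_mem st) mem_head.
have ut : uniq t by rewrite -(perm_uniq st).
move: st ut; case/splitPr: xt => t1 t2 st ut.
rewrite cint_move//; last first.
  by move: ut; rewrite uniq_catC /= mem_cat negb_or => /andP[/andP[]].
apply/funext => phi /=; apply: eq_integral => a _; rewrite (IH (t1 ++ t2))//.
  by case/andP: us.
by rewrite -(perm_cons x) (permPl st) -cat_rcons -cats1 -catA perm_catCA.
Qed.

Definition depends_on (S : set (Zd d)) (F : Om -> \bar R) :=
  forall phi psi, (forall x, S x -> phi x = psi x) -> F phi = F psi.

Lemma cint_depends_on S s F : depends_on S F ->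
  depends_on (S `\` [set` s]) (cint s F).
Proof.
move=> FS; elim: s => [|x s IH] /=.
  by move=> phi psi e; apply: FS => x Sx; apply: e.
move=> phi psi e; apply: eq_integral => a _; apply: IH => y [Sy ys].
rewrite /update; have [//|yx] := eqVneq y x; apply: e; split => //=.
by rewrite inE (negbTE yx).
Qed.

Definition raise (c : E) (phi : Om) : Om := fun x => height_add (phi x) c.

Lemma cint_raise c s F phi : (forall phi, 0 <= F phi) -> cmeas F ->
  cint s (F \o raise c) phi = cint s F (raise c phi).
Proof.
move=> F0 mF; elim: s phi => //= x s IH phi.
rewrite -[RHS](integral_ref_add c); last 2 first.
- by apply: cmeas_update1; exact: cmeas_cint.
- by move=> a; exact: cint_ge0.
apply: eq_integral => a _; rewrite IH; congr (cint s F).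
by apply/funext => y; rewrite /update /raise; case: ifP.
Qed.

Lemma cint_shift t s F phi :
  cint [seq x + t | x <- s]%R F phi =
  cint s (F \o shift_height (- t)) (shift_height t phi).
Proof.
elim: s phi => [|x s IH] phi /=.
  by congr F; apply/funext => y; rewrite /shift_height addrNK.
apply: eq_integral => a _; rewrite IH; congr cint.
by apply/funext => y; rewrite /shift_height /update (inj_eq (addIr t)).
Qed.

Lemma cmeas_indic (A : set Om) : measurable (A : set CT) ->
  cmeas (fun phi => (\1_A phi)%:E).
Proof. by move=> mP; apply/measurable_EFinP; exact: measurable_indic. Qed.

Lemma measurable_height_diff x y :
  measurable_fun setT (fun phi : CT => height_sub ((phi : Om) y) ((phi : Om) x)).
Proof. by apply: measurable_height_sub; exact: measurable_coord. Qed.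

Lemma grad_space_coord (S : set (Zd d)) (A : set Om) :
  measurable (A : set (grad_space R k S)) -> measurable (A : set CT).
Proof.
apply: smallest_sub; first exact: sigma_algebra_measurable.
move=> _ [[x y] _ [B mB <-]].
exact: measurable_height_diff.
Qed.

Lemma grad_space_mono (S S' : set (Zd d)) (A : set Om) : S `<=` S' ->
  measurable (A : set (grad_space R k S)) -> measurable (A : set (grad_space R k S')).
Proof.
move=> SS'; apply: smallest_sub; first exact: smallest_sigma_algebra.
move=> B [p [Sp1 Sp2] mB]; apply: sub_sigma_algebra; exists p => //.
by split; exact: SS'.
Qed.

Lemma measurable_fun_grad_coord dT (T : measurableType dT) (S : set (Zd d))
    (F : Om -> T) :
  measurable_fun setT (F : grad_space R k S -> T) ->
  measurable_fun setT (F : CT -> T).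
Proof.
move=> mF _ B mB; rewrite setTI; apply: (@grad_space_coord S).
by have := mF measurableT B mB; rewrite setTI.
Qed.

Lemma measurable_fun_grad_mono dT (T : measurableType dT) (S S' : set (Zd d))
    (F : Om -> T) : S `<=` S' ->
  measurable_fun setT (F : grad_space R k S -> T) ->
  measurable_fun setT (F : grad_space R k S' -> T).
Proof.
move=> SS' mF _ B mB; rewrite setTI; apply: (@grad_space_mono S) => //.
by have := mF measurableT B mB; rewrite setTI.
Qed.

(** The sets that do not separate [phi] from [psi] form a sigma-algebra, and it contains the
    generators. *)
Lemma grad_space_invariant (S : set (Zd d)) (A : set Om) phi psi :
  measurable (A : set (grad_space R k S)) ->
  (forall x y, S x -> S y ->
    height_sub (phi y) (phi x) = height_sub (psi y) (psi x)) ->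
  A phi -> A psi.
Proof.
move=> mA e.
suff : (A phi <-> A psi) by case.
move: A mA; apply: smallest_sub.
  split => //.
  - by move=> A /= [h1 h2]; split => -[_ h]; split => // h'; apply: h; [exact: h2|exact: h1].
  - by move=> F /= Fe; split => -[n _ Fn]; exists n => //; apply/Fe.
move=> _ [[x y] [/= Sx Sy] [B mB <-]] /=; rewrite /setI/=.
by rewrite (e x y).
Qed.

Lemma grad_fun_invariant dT (T : measurableType dT) (S : set (Zd d))
    (F : Om -> T) phi psi :
  (forall t : T, measurable [set t]) ->
  measurable_fun setT (F : grad_space R k S -> T) ->
  (forall x y, S x -> S y ->
    height_sub (phi y) (phi x) = height_sub (psi y) (psi x)) ->
  F phi = F psi.
Proof.
move=> m1 mF e.
have mA := mF measurableT [set F phi] (m1 _).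
by have [_ /= ->] := grad_space_invariant mA e (conj Logic.I erefl).
Qed.

Lemma grad_fun_raise (S : set (Zd d)) (F : Om -> \bar R) c :
  measurable_fun setT (F : grad_space R k S -> \bar R) -> F \o raise c = F.
Proof.
move=> mF; apply/funext => phi /=.
apply: (grad_fun_invariant _ mF) => [t|x y _ _]; first exact: emeasurable_set1.
exact: height_sub_add2.
Qed.

Lemma grad_fun_depends_on (S : set (Zd d)) (F : Om -> \bar R) :
  measurable_fun setT (F : grad_space R k S -> \bar R) -> depends_on S F.
Proof.
move=> mF phi psi e.
apply: (grad_fun_invariant _ mF) => [t|x y Sx Sy]; first exact: emeasurable_set1.
by rewrite !e.
Qed.

Lemma cint_pull s F G phi : (forall phi, 0 <= F phi) -> (forall phi, 0 <= G phi) ->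
  cmeas G -> depends_on (~` [set` s]) F ->
  cint s (fun psi => F psi * G psi) phi = F phi * cint s G phi.
Proof.
move=> F0 G0 mG; elim: s phi => [//|x s IH] phi FS /=.
rewrite -[RHS]ge0_integralZl//; last 2 first.
- by apply: cmeas_update1; exact: cmeas_cint.
- by move=> a _; exact: cint_ge0.
apply: eq_integral => a _; rewrite IH; last first.
  by move=> f g e; apply: FS => y /= ys; apply: e => /= ys'; apply: ys; rewrite inE ys' orbT.
congr (_ * _); apply: FS => y /= ys; rewrite /update; case: eqP => // yx.
by exfalso; apply: ys; rewrite yx mem_head.
Qed.

End coordinate_integral.

(** * Gradient reference measures as iterated integrals *)

Section reference_measure.
Context (R : realType) (k : height_kind) (d : nat).
Local Notation E := (heights R k).
Local Notation lambda := (ref_measure R k).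
Local Notation Om := (Omega R k d).
Local Notation CT := (coord_space R k (@setT (Zd d))).
Local Notation zero := ((fun=> height0 R k) : Om).
Local Open Scope ereal_scope.

Definition fill (s : seq (Zd d)) (phi : Om) n (v : n.-tuple E) : Om :=
  fun y => if y \in s then nth (height0 R k) v (index y s) else phi y.

Lemma measurable_fill s phi n : size s = n ->
  measurable_fun setT (fun v : n.-tuple E => fill s phi v : CT).
Proof.
move=> sn; apply: measurable_into_coord => y; rewrite /fill.
case ys : (y \in s) => //.
have ilt : (index y s < n)%N by rewrite -sn index_mem.
rewrite (_ : (fun _ => _) = (@tnth _ _ ^~ (Ordinal ilt))).
  exact: measurable_tnth.
by apply/funext => v; rewrite (tnth_nth (height0 R k)).
Qed.

Lemma fill_cons x s phi n (v : n.-tuple E) a : x \notin s ->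
  fill (x :: s) phi (tuple_cons (a, v)) = fill s (update phi x a) v.
Proof.
move=> xs; apply/funext => y; rewrite /fill /update inE/=.
by have [->|yx] := eqVneq y x; rewrite /= ?(negbTE xs)// eq_sym (negbTE yx).
Qed.

Lemma integral_power_measure s phi (F : Om -> \bar R) : uniq s ->
  (forall phi, 0 <= F phi) -> cmeas F ->
  \int[power_measure lambda (size s)]_v F (fill s phi v) = cint s F phi.
Proof.
move=> us F0 mF; elim: s us phi => [|x s IH] /=.
  move=> _ phi; rewrite integral_dirac//.
    by rewrite diracT mul1e; congr F; apply/funext.
  apply: (@measurableT_comp _ _ _ _ _ _ (F : CT -> _)) => //.
  exact: measurable_fill.
move=> /andP[xs us] phi.
have mFf : measurable_fun setT (fun v : (size s).+1.-tuple E => F (fill (x :: s) phi v)).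
  apply: (@measurableT_comp _ _ _ _ _ _ (F : CT -> _)) => //.
  exact: measurable_fill.
transitivity (\int[pushforward (lambda \x power_measure lambda (size s))
  (@tuple_cons _ _ (size s))]_v F (fill (x :: s) phi v)); first by [].
rewrite ge0_integral_pushforward//; last exact: measurable_tuple_cons.
rewrite preimage_setT fubini_tonelli1//; first last.
- by move=> p; exact: F0.
- by apply: measurableT_comp => //; exact: measurable_tuple_cons.
apply: eq_integral => a _; rewrite -IH//.
by apply: eq_integral => v _ /=; rewrite fill_cons.
Qed.

Lemma integral_grad_ref_measure (Lam : {fset Zd d}) (F : Om -> \bar R) :
  (forall phi, 0 <= F phi) ->
  measurable_fun setT (F : grad_space R k [set` Lam] -> \bar R) ->
  \int[grad_ref_measure R k Lam]_phi F phi = cint (other_points Lam) F zero.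
Proof.
move=> F0 mF.
have uo : uniq (other_points Lam).
  have := fset_uniq Lam; rewrite /other_points.
  by case: (enum_fset _) => //= x s /andP[].
rewrite -(integral_power_measure zero uo F0); last first.
  exact: measurable_fun_grad_coord mF.
transitivity (\int[pushforward (power_measure lambda (size (other_points Lam)))
  (@gradient_section R k d Lam)]_phi F phi); first by [].
rewrite ge0_integral_pushforward//; last exact: measurable_gradient_section.
Qed.

Definition grad_fun (S : set (Zd d)) (F : Om -> \bar R) :=
  (forall phi, 0 <= F phi) /\ measurable_fun setT (F : grad_space R k S -> \bar R).

(** Independence of the base point. After removal of the common coordinates, one integral has height
    [a] at [y] and zero at [x]; raising everything by [height_opp a] moves the zero to [y], and
    reflection invariance of [lambda] restores the sign of the height at [x]. *)
Lemma cint_base_point x y s t (F : Om -> \bar R) :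
  uniq (x :: s) -> perm_eq (x :: s) (y :: t) -> grad_fun [set` x :: s] F ->
  cint s F zero = cint t F zero.
Proof.
move=> us st [F0 mF].
have mFc : cmeas F by exact: measurable_fun_grad_coord mF.
have ut : uniq (y :: t) by rewrite -(perm_uniq st).
have [xy|xy] := eqVneq x y.
  rewrite -xy in st ut *; rewrite (@perm_cint _ _ _ s t)//.
    by case/andP: us.
  by rewrite -(perm_cons x).
have yins : y \in s.
  by have := perm_mem st y; rewrite !inE eqxx eq_sym (negbTE xy).
have xint : x \in t.
  by have := perm_mem st x; rewrite !inE eqxx (negbTE xy).
pose r := rem y s.
have sr : perm_eq s (y :: r) by exact: perm_to_rem.
have tr : perm_eq t (x :: r).
  rewrite -(perm_cons y) -(permPl st); apply: (@perm_trans _ (x :: y :: r)).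
    by rewrite perm_cons.
  exact/permPl/(perm_catCA [:: x] [:: y] r).
case/andP: (us) => xs us'; case/andP: (ut) => yt ut'.
rewrite (perm_cint us' sr F0 mFc) (perm_cint ut' tr F0 mFc) /=.
rewrite -[RHS]integral_ref_opp; last 2 first.
- by apply: cmeas_update1; exact: cmeas_cint.
- by move=> a; exact: cint_ge0.
apply: eq_integral => a _.
rewrite -[in LHS](grad_fun_raise (height_opp a) mF) cint_raise//.
apply: (cint_depends_on (grad_fun_depends_on mF)) => z [/= zs zr].
have : z \in [:: x; y].
  move: zs; rewrite !inE (perm_mem sr) inE => /or3P[->|->|/zr]//.
  by rewrite orbT.
rewrite !inE /raise /update => /orP[/eqP ->|/eqP ->].
  by rewrite (negbTE xy) eqxx height_0add.
by rewrite eqxx eq_sym (negbTE xy) height_addN.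
Qed.

Lemma enum_fset_consP (Lam : {fset Zd d}) : Lam != fset0 ->
  enum_fset Lam = base_point Lam :: other_points Lam.
Proof.
rewrite /base_point /other_points => /fset0Pn [x].
by rewrite -[_ \in _]/(x \in enum_fset Lam); case: (enum_fset _).
Qed.

Lemma integral_grad_ref_measure_perm (Lam : {fset Zd d}) x s (F : Om -> \bar R) :
  perm_eq (x :: s) (enum_fset Lam) -> grad_fun [set` Lam] F ->
  \int[grad_ref_measure R k Lam]_phi F phi = cint s F zero.
Proof.
move=> sL gF; have [F0 mF] := gF.
have Lam0 : Lam != fset0.
  apply/fset0Pn; exists x; rewrite -[_ \in _]/(x \in enum_fset Lam).
  by rewrite -(perm_mem sL) mem_head.
have us : uniq (x :: s) by rewrite (perm_uniq sL) fset_uniq.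
rewrite integral_grad_ref_measure//.
apply/esym/(@cint_base_point x (base_point Lam)) => //.
  by rewrite -enum_fset_consP.
split=> //; rewrite (_ : [set` x :: s] = [set` Lam])//.
by apply/seteqP; split => z /=; rewrite (perm_mem sL).
Qed.

Lemma measurable_shift_height (S S' : set (Zd d)) t :
  (forall x, S' x -> S (x + t)%R) ->
  measurable_fun setT (shift_height t : grad_space R k S -> grad_space R k S').
Proof.
move=> SS'.
apply: (@measurability _ _ _ (grad_space R k S') setT _ (grad_generator S') erefl).
move=> _ [_ [[x y] [/= Sx Sy] [B mB <-]] <-]; rewrite setTI.
have := @measurable_grad_space R k d S (x + t) (y + t) (SS' _ Sx) (SS' _ Sy).
by move=> /(_ measurableT B mB); rewrite !setTI.
Qed.

Lemma grad_fun_shift (S S' : set (Zd d)) t (F : Om -> \bar R) :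
  (forall x, S' x -> S (x + t)%R) -> grad_fun S' F ->
  grad_fun S (F \o shift_height t).
Proof.
move=> SS' [F0 mF]; split => [phi|]; first exact: F0.
apply: (@measurableT_comp _ _ _ (grad_space R k S) (grad_space R k S') _ F) => //.
exact: measurable_shift_height.
Qed.

Lemma mem_shift_fset t (Lam : {fset Zd d}) x :
  (x \in shift_fset t Lam) = ((x - t)%R \in Lam).
Proof.
apply/imfsetP/idP => [[y /= yL ->]|xL]; first by rewrite addrK.
by exists (x - t)%R => //; rewrite subrK.
Qed.

Lemma perm_enum_shift_fset t (Lam : {fset Zd d}) :
  perm_eq [seq x + t | x <- enum_fset Lam]%R (enum_fset (shift_fset t Lam)).
Proof.
apply: uniq_perm; [|exact: fset_uniq|].
  by rewrite map_inj_uniq ?fset_uniq//; exact: addIr.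
move=> x; rewrite -[RHS]/(x \in shift_fset t Lam) mem_shift_fset.
by have {1}-> : x = (x - t + t)%R by [rewrite subrK]; rewrite (mem_map (addIr t)).
Qed.

Lemma integral_grad_ref_measure_shift (Lam : {fset Zd d}) t (F : Om -> \bar R) :
  Lam != fset0 -> grad_fun [set` shift_fset t Lam] F ->
  \int[grad_ref_measure R k (shift_fset t Lam)]_phi F phi =
  \int[grad_ref_measure R k Lam]_phi F (shift_height (- t)%R phi).
Proof.
move=> L0 gF; have Lc := enum_fset_consP L0.
rewrite (@integral_grad_ref_measure_perm _ (base_point Lam + t)%R
  [seq x + t | x <- other_points Lam]%R)//; last first.
  by have := perm_enum_shift_fset t Lam; rewrite Lc.
rewrite cint_shift -(@integral_grad_ref_measure_perm Lam (base_point Lam))//.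
- by rewrite -Lc.
- apply: (grad_fun_shift _ gF) => x /=.
  by rewrite mem_shift_fset.
Qed.

Lemma perm_enum_fset_rem x (Lam : {fset Zd d}) : x \in Lam ->
  perm_eq (x :: rem x (enum_fset Lam)) (enum_fset Lam).
Proof. by move=> xL; rewrite perm_sym; exact: perm_to_rem. Qed.

(** Base the union at [x] and list [y] first among the points of [Del]. The height at [y] is then
    the only variable that links the two sets, and integrating it under the constraint produces the
    factor [lambda (height_ball K)]. *)
Lemma integral_grad_ref_measure_glue (Lam Del : {fset Zd d}) x y (K : R)
    (F G : Om -> \bar R) :
  [disjoint Lam & Del]%fset -> x \in Lam -> y \in Del ->
  grad_fun [set` Lam] F -> grad_fun [set` Del] G ->
  \int[grad_ref_measure R k (Lam `|` Del)%fset]_phi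
     (F phi * (G phi *
       (\1_[set phi : Om | (`|height_val (height_sub (phi y) (phi x))| <= K)%R] phi)%:E)) =
  \int[grad_ref_measure R k Lam]_phi F phi *
  (lambda (height_ball K) *
   \int[grad_ref_measure R k Del]_phi G phi).
Proof.
move=> LD xL yD gF gG; have [F0 mF] := gF; have [G0 mG] := gG.
pose s := rem x (enum_fset Lam); pose u := rem y (enum_fset Del).
have sL : perm_eq (x :: s) (enum_fset Lam) by exact: perm_enum_fset_rem.
have uD : perm_eq (y :: u) (enum_fset Del) by exact: perm_enum_fset_rem.
have us : uniq (x :: s) by rewrite (perm_uniq sL) fset_uniq.
have uu : uniq (y :: u) by rewrite (perm_uniq uD) fset_uniq.
have LDN z : z \in Lam -> z \in Del -> False.
  by move=> zL zD; move/fdisjointP : LD => /(_ z zL); rewrite zD.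
have memL z : (z \in x :: s) = (z \in Lam) by rewrite (perm_mem sL).
have memD z : (z \in y :: u) = (z \in Del) by rewrite (perm_mem uD).
set D := [set phi : Om | _].
pose B : set E := height_ball K.
have mB : measurable B by exact: measurable_height_ball.
have mD : measurable (D : set (grad_space R k [set` (Lam `|` Del)%fset])).
  have xU : [set` (Lam `|` Del)%fset] x by rewrite /= in_fsetU xL.
  have yU : [set` (Lam `|` Del)%fset] y by rewrite /= in_fsetU yD orbT.
  by have := measurable_grad_space xU yU measurableT mB; rewrite setTI.
have mDc : measurable (D : set CT) by exact: grad_space_coord mD.
have FGD : grad_fun [set` (Lam `|` Del)%fset]
    (fun phi => F phi * (G phi * (\1_D phi)%:E)).
  split=> [phi|]; first by rewrite !mule_ge0// lee_fin.
  apply: emeasurable_funM.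
    apply: measurable_fun_grad_mono mF => z /= zL.
    by rewrite in_fsetU zL.
  apply: emeasurable_funM; last by apply/measurable_EFinP; exact: measurable_indic.
  apply: measurable_fun_grad_mono mG => z /= zD.
  by rewrite in_fsetU zD orbT.
rewrite (@integral_grad_ref_measure_perm _ x (s ++ y :: u))//; last first.
  rewrite -cat_cons; apply: uniq_perm; rewrite ?fset_uniq//.
    rewrite cat_uniq us uu andbT; apply/hasPn => z /=.
    by rewrite memL memD => zD; apply/negP => zL; exact: LDN zL zD.
  move=> z; rewrite mem_cat memL memD.
  by rewrite -[RHS]/(z \in (Lam `|` Del)%fset) in_fsetU.
rewrite (integral_grad_ref_measure_perm sL gF) (integral_grad_ref_measure_perm uD gG).
rewrite cint_cat; set Z := cint u G zero.
have Z0 : 0 <= Z by exact: cint_ge0.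
have mFc : cmeas F by exact: measurable_fun_grad_coord mF.
have mGc : cmeas G by exact: measurable_fun_grad_coord mG.
have mDi : cmeas (fun phi => (\1_D phi)%:E) by exact: cmeas_indic.
transitivity (cint s (fun psi => cst (lambda B * Z) psi * F psi) zero); last first.
  have c0 : 0 <= lambda B * Z by exact: mule_ge0.
  have -> := @cint_pull R k d s (cst (lambda B * Z)) F zero (fun=> c0) F0 mFc
    (fun _ _ _ => erefl).
  by rewrite /cst muleC.
apply: eq_cint => psi psi0; rewrite /cst/= muleC.
have psix : psi x = height0 R k.
  by apply: psi0; case/andP: us.
transitivity (F psi * cint (y :: u) (fun phi => G phi * (\1_D phi)%:E) psi).
  apply: (@cint_pull _ _ _ (y :: u)) => //.
  - by move=> phi; rewrite mule_ge0// lee_fin.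
  - by apply: emeasurable_funM.
  - move=> f g e; apply: (grad_fun_depends_on mF) => z /= zL.
    by apply: e => /=; rewrite memD => zD; exact: LDN zL zD.
congr (_ * _) => /=.
transitivity (\int[lambda]_a ((\1_B a)%:E * Z)).
  apply: eq_integral => a _.
  have -> : (fun phi => G phi * (\1_D phi)%:E) = (fun phi => (\1_D phi)%:E * G phi).
    by apply/funext => phi; rewrite muleC.
  rewrite (@cint_pull _ _ _ u (fun phi => (\1_D phi)%:E))//; last first.
    move=> f g e; have uxy z : z \in [:: x; y] -> f z = g z.
      move=> zxy; apply: e => /= zu; move: zxy; rewrite !inE => /orP[/eqP zx|/eqP zy].
        by apply: (LDN x) => //; rewrite -memD inE -zx zu orbT.
      by case/andP: uu; rewrite -zy zu.
    rewrite !indicE; congr (_%:R%:E); congr (nat_of_bool _).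
    apply/idP/idP; rewrite !inE /D /=; rewrite !uxy ?mem_head// inE ?mem_head ?orbT//.
  congr (_ * _).
    rewrite !indicE; congr (_%:R%:E); congr (nat_of_bool _).
    have xy : x != y by apply/eqP => xy; apply: (LDN x) => //; rewrite xy.
    have DB : D (update psi y a) = B a.
      by rewrite /D /B /= /update eqxx (negbTE xy) psix height_sub0.
    by apply/idP/idP; rewrite !inE DB.
  (* Given height [a] at [y], the rest of [Del] integrates as if [y] had height zero, since [G] does
     not see the constant [a]. *)
  rewrite /Z -[in RHS](grad_fun_raise a mG) cint_raise//.
  apply: (cint_depends_on (grad_fun_depends_on mG)) => z [/= zD zu].
  move: zD; rewrite -memD inE (negbTE (introN idP zu)) orbF => /eqP ->.
  by rewrite /update eqxx /raise height_0add.
rewrite ge0_integralZr//.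
  by rewrite integral_indic// setIT.
by apply/measurable_EFinP; exact: measurable_indic.
Qed.

(** Seen from the base point, such configurations lie in a product of balls, each of finite
    [lambda]-measure. *)
Lemma grad_ref_measure_bounded_fin (Lam : {fset Zd d}) (A : set Om)
    (K : Zd d -> Zd d -> R) :
  measurable (A : set (grad_space R k [set` Lam])) ->
  (forall phi x y, A phi -> x \in Lam -> y \in Lam ->
    (`|height_val (height_sub (phi y) (phi x))| <= K x y)%R) ->
  grad_ref_measure R k Lam A < +oo.
Proof.
move=> mA AK.
have mAc := grad_space_coord mA.
(* One radius for all points: the sum dominates every [K b z]. *)
pose b := base_point Lam; pose r := (\sum_(z <- other_points Lam) `|K b z|)%R.
have c_fin : lambda (height_ball r) < +oo by exact: ref_measure_ball_fin.
set c := lambda _ in c_fin.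
pose P s := [set phi : Om | all (fun z => `|height_val (phi z)| <= r)%R s].
have mB : measurable (height_ball r : set E) by exact: measurable_height_ball.
have mBx x : measurable ([set phi : Om | (`|height_val (phi x)| <= r)%R] : set CT).
  have /(_ measurableT _ mB) := @measurable_coord R k d x.
  by rewrite setTI.
have PE x s : P (x :: s) = [set phi : Om | (`|height_val (phi x)| <= r)%R] `&` P s.
  by apply/seteqP; split => phi; rewrite /P /= => /andP.
have mP s : measurable (P s : set CT).
  elim: s => [|x s IH]; last by rewrite PE; exact: measurableI.
  by rewrite (_ : P [::] = setT)//; apply/seteqP; split.
have cP s phi : uniq s -> cint s (fun phi => (\1_(P s) phi)%:E) phi <= c ^+ size s.
  elim: s phi => [|x s IH] phi.
    by move=> _; rewrite /= lee_fin indicE; case: (_ \in _).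
  move=> /andP[xs us]; rewrite [cint _ _]/= [size _]/= expeS.
  apply: (@le_trans _ _ (\int[lambda]_a
      ((\1_(height_ball r : set E) a)%:E * c ^+ size s))).
    apply: ge0_le_integral => //.
    - by move=> a _; apply: cint_ge0 => psi; rewrite lee_fin.
    - apply: (@cmeas_update1 _ _ _ (cint s (fun psi => (\1_(P (x :: s)) psi)%:E))).
      apply: cmeas_cint => [psi|]; first by rewrite lee_fin.
      exact: cmeas_indic.
    - apply: emeasurable_funM => //.
      by apply/measurable_EFinP; exact: measurable_indic.
    - move=> a _.
      have -> : (fun phi => (\1_(P (x :: s)) phi)%:E) = (fun phi =>
        (\1_[set phi : Om | (`|height_val (phi x)| <= r)%R] phi)%:E * (\1_(P s) phi)%:E) :> (Om -> \bar R).
        by apply/funext => psi; rewrite PE indicI EFinM.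
      rewrite cint_pull//; [|exact: cmeas_indic|].
        apply: lee_pmul => //; first by apply: cint_ge0 => psi; rewrite lee_fin.
          rewrite le_eqVlt; apply/orP; left; apply/eqP; congr (_%:E).
          rewrite !indicE; congr (_%:R); congr (nat_of_bool _).
          by apply/idP/idP; rewrite !inE /height_ball /= /update eqxx.
        exact: IH.
      move=> f g e; have fgx : f x = g x by apply: e => /=; exact/negP.
      rewrite !indicE; congr (_%:R%:E); congr (nat_of_bool _).
      by apply/idP/idP; rewrite !inE /= fgx.
  rewrite ge0_integralZr//; last first.
  - by apply: expe_ge0; exact: measure_ge0.
  - by apply/measurable_EFinP; exact: measurable_indic.
  by rewrite integral_indic// setIT.
have uo : uniq (other_points Lam).
  have := fset_uniq Lam; rewrite /other_points.
  by case: (enum_fset _) => //= z s /andP[].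
apply: (@le_lt_trans _ _ (c ^+ size (other_points Lam))); last first.
  have [t ct] : exists t : R, c = t%:E.
    have c0 : 0 <= c by exact: measure_ge0.
    by exists (fine c); rewrite fineK// ge0_fin_numE.
  by rewrite ct -EFin_expe ltry.
have -> : grad_ref_measure R k Lam A =
    \int[grad_ref_measure R k Lam]_phi (\1_A phi)%:E.
  by rewrite integral_indic// setIT.
rewrite (integral_grad_ref_measure (F := fun phi => (\1_A phi)%:E))//; last by apply/measurable_EFinP; exact: measurable_indic.
apply: le_trans (cP _ zero uo).
rewrite (@eq_cint _ _ _ _ _ (fun phi => (\1_A phi)%:E * (\1_(P (other_points Lam)) phi)%:E)).
  apply: le_cint.
  - by move=> phi; rewrite mule_ge0 ?lee_fin.
  - by apply: emeasurable_funM; exact: cmeas_indic.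
  - exact: cmeas_indic.
  - move=> phi; rewrite -EFinM lee_fin !indicE.
    by case: (_ \in A); rewrite ?mul1r ?mul0r.
move=> psi psi0; rewrite -EFinM !indicE; congr EFin.
have [psiA|] := boolP (psi \in A); last by rewrite mul0r.
rewrite mul1r mem_set// /P /=; apply/allP => z zo.
have Lam0 : Lam != fset0.
  by apply/fset0Pn; exists z; exact: (mem_behead zo).
have Lc := enum_fset_consP Lam0.
have bL : b \in Lam.
  by rewrite -[_ \in _]/(b \in enum_fset Lam) Lc mem_head.
have zL : z \in Lam.
  by rewrite -[_ \in _]/(z \in enum_fset Lam) Lc inE zo orbT.
have psib : psi b = height0 R k by apply: psi0; exact: base_point_notin.
move: psiA; rewrite inE => /AK/(_ bL zL); rewrite psib height_sub0 => /le_trans; apply.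
apply: le_trans (ler_norm _) _; rewrite /r (big_rem z zo) /= lerDl.
by apply: sumr_ge0 => *.
Qed.

End reference_measure.

(** * Tests for mixtures and for events of small mass *)

Section more_tilted_tests.
Context d (T : measurableType d) (R : realType).
Variables (nu : {sigma_finite_measure set T -> \bar R}).
Variables (W : T -> \bar R) (S : set T).
Local Open Scope ereal_scope.
Hypotheses (mS : measurable S) (mW : measurable_fun setT W).

(** The exponential of a maximum is at most the sum of the exponentials, whose integral is at most
    2. One test can thus serve both components of a mixture. *)
Lemma tilted_test_max g1 g2 : tilted_test nu W S g1 -> tilted_test nu W S g2 ->
  tilted_test nu W S (fun x => Num.max (g1 x) (g2 x) - ln 2)%R.
Proof.
move=> [mg1 [M1 gM1] Z1] [mg2 [M2 gM2] Z2].
have mg : measurable_fun setT (fun x => Num.max (g1 x) (g2 x)).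
  exact: measurable_maxr.
split.
- by apply: measurable_funB.
- exists (M1 + M2 + `|ln 2|)%R => x; apply: le_trans (ler_normB _ _) _.
  rewrite lerD2r; have := gM1 x; have := gM2 x.
  have := normr_ge0 (g1 x); have := normr_ge0 (g2 x).
  by case: (leP (g1 x) (g2 x)); lra.
have mt (g : T -> R) : measurable_fun setT g -> measurable_fun S (fun x => expeR ((g x)%:E - W x)).
  by move=> mg'; apply: measurable_funTS; exact: measurable_tilt.
apply: (@le_trans _ _ (\int[nu]_(x in S) ((2^-1)%R%:E *
    (expeR ((g1 x)%:E - W x) + expeR ((g2 x)%:E - W x))))).
  apply: ge0_le_integral => //.
  - by move=> x _; exact: expeR_ge0.
  - by apply: mt; apply: measurable_funB.
  - by apply: emeasurable_funM => //; apply: emeasurable_funD; exact: mt.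
  - move=> x _; rewrite EFinB addeAC [leLHS]expeRD [leLHS]muleC.
    rewrite [expeR (- _)%E]/= expRN lnK ?posrE//.
    apply: lee_wpmul2l => //.
    by case: (leP (g1 x) (g2 x)) => _; [rewrite leeDr|rewrite leeDl]; rewrite // expeR_ge0.
rewrite ge0_integralZl//; last 2 first.
- by apply: emeasurable_funD; exact: mt.
- by move=> x _; rewrite adde_ge0 ?expeR_ge0.
rewrite ge0_integralD//; [|by move=> x _; exact: expeR_ge0|exact: mt|
  by move=> x _; exact: expeR_ge0|exact: mt].
apply: (@le_trans _ _ ((2^-1)%R%:E * (1 + 1))).
  by apply: lee_wpmul2l => //; exact: leeD.
by rewrite -EFinD -EFinM lee_fin; lra.
Qed.

(** By [exp (s * \1_A) <= 1 + exp s * \1_A], the exponential integral of [s * \1_A] is at most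
    [Z + 1]. Such tests bound [mu A] when the tilted mass of [A] is small. *)
Lemma tilted_test_indic (A : set T) (s Z : R) : measurable A -> (0 <= s)%R ->
  (0 <= Z)%R -> \int[nu]_(x in S) expeR (0%:E - W x) <= Z%:E ->
  (expR s)%:E * \int[nu]_(x in S `&` A) expeR (0%:E - W x) <= 1 ->
  tilted_test nu W S (fun x => s * \1_A x - ln (Z + 1))%R.
Proof.
move=> mA s0 Z0 ZS ZA.
have mg : measurable_fun setT (fun x => s * \1_A x)%R.
  by apply: measurable_funM.
have mt (g : T -> R) : measurable_fun setT g -> measurable_fun setT (fun x => expeR ((g x)%:E - W x)).
  by move=> mg'; exact: measurable_tilt.
have mt0 := mt (cst 0%R) (measurable_cst _).
split.
- by apply: measurable_funB.
- exists (s + `|ln (Z + 1)|)%R => x; apply: le_trans (ler_normB _ _) _.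
  rewrite lerD2r ger0_norm ?mulr_ge0//.
  by rewrite ler_piMr// indicE; case: (_ \in _).
have Z1 : (0 < Z + 1)%R by lra.
apply: (@le_trans _ _ (\int[nu]_(x in S) (((Z + 1)^-1)%R%:E *
    (expeR (0%:E - W x) + (expR s)%:E * ((expeR (0%:E - W x) * (\1_A x)%:E)))))).
  apply: ge0_le_integral => //.
  - by move=> x _; exact: expeR_ge0.
  - by apply: measurable_funTS; apply: mt; apply: measurable_funB.
  - apply: measurable_funTS; apply: emeasurable_funM => //.
    apply: emeasurable_funD => //; apply: emeasurable_funM => //.
    by apply: emeasurable_funM => //; apply/measurable_EFinP; exact: measurable_indic.
  - move=> x _; rewrite EFinB addeAC [leLHS]expeRD [leLHS]muleC.
    rewrite [expeR (- _)%E]/= expRN lnK ?posrE//.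
    apply: lee_wpmul2l; first by rewrite lee_fin invr_ge0 ltW.
    rewrite indicE; case: (x \in A).
      rewrite mulr1 mule1 -[(expR s)%:E]/(expeR s%:E) -expeRD addeA adde0.
      by rewrite leeDr// expeR_ge0.
    by rewrite mulr0 !mule0 adde0.
have t0 x : 0 <= expeR (0%:E - W x) by exact: expeR_ge0.
have t1 x : 0 <= expeR (0%:E - W x) * (\1_A x)%:E by rewrite mule_ge0// lee_fin.
have mt1 : measurable_fun S (fun x => expeR (0%:E - W x) * (\1_A x)%:E).
  apply: measurable_funTS.
  by apply: emeasurable_funM => //; apply/measurable_EFinP; exact: measurable_indic.
have mt0S : measurable_fun S (fun x => expeR (0%:E - W x)) by exact: measurable_funTS.
rewrite ge0_integralZl//; last 3 first.
- by apply: emeasurable_funD => //; exact: emeasurable_funM.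
- by move=> x _; rewrite adde_ge0// mule_ge0// lee_fin expR_ge0.
- by rewrite lee_fin invr_ge0 ltW.
rewrite ge0_integralD//; last 2 first.
- by move=> x _; rewrite mule_ge0// lee_fin expR_ge0.
- exact: emeasurable_funM.
rewrite ge0_integralZl//.
have -> : \int[nu]_(x in S) (expeR (0%:E - W x) * (\1_A x)%:E) =
    \int[nu]_(x in S `&` A) expeR (0%:E - W x).
  rewrite integral_mkcondr; apply: eq_integral => x _.
  by rewrite epatch_indic.
apply: (@le_trans _ _ (((Z + 1)^-1)%R%:E * (Z%:E + 1))).
  apply: lee_wpmul2l; first by rewrite lee_fin invr_ge0 ltW.
  exact: leeD.
by rewrite -EFinD -EFinM lee_fin mulVf ?gt_eqF.
Qed.

End more_tilted_tests.

Lemma subset_esum (R : realType) (T : choiceType) (I J : set T) (a : T -> \bar R) :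
  I `<=` J -> (\esum_(i in I) a i <= \esum_(i in J) a i)%E.
Proof.
move=> IJ; apply: ge_ereal_sup => _ [X [fX XI] <-].
by apply: ereal_sup_ubound; exists X => //; split => //; exact: subset_trans IJ.
Qed.

(** * Energies *)

Section hamiltonian.
Context (R : realType) (k : height_kind) (d : nat).
Local Notation E := (heights R k).
Local Notation Om := (Omega R k d).
Local Open Scope ereal_scope.
Implicit Types (Lam Del Gam : {fset Zd d}) (phi : Om).

(** Without the value [-oo] the sum of the negative parts is finite, so the difference in the
    definition of [hamiltonian] can be regrouped term by term. *)
Lemma sume_posneg (I : Type) (s : seq I) (f : I -> \bar R) :
  (forall i, f i != -oo) ->
  \sum_(i <- s) maxe (f i) 0 - \sum_(i <- s) maxe (- f i) 0 = \sum_(i <- s) f i.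
Proof.
move=> fN.
have nfin i : maxe (- f i) 0 \is a fin_num.
  by move: (fN i); case: (f i) => [r| |] // _; rewrite -?EFin_max// max_r// leNye.
have sfin (t : seq I) : \sum_(i <- t) maxe (- f i) 0 \is a fin_num.
  by elim: t => [|i t IH]; rewrite ?big_nil// big_cons fin_numD nfin.
elim: s => [|i s IH]; first by rewrite !big_nil subee.
rewrite !big_cons fin_num_oppeD// addeACA IH; congr (_ + _).
move: (fN i); case: (f i) => [r| |] // _.
  by rewrite -!EFin_max -EFinB; congr EFin; case: (leP r 0%R); case: (leP (- r)%R 0%R); lra.
by rewrite [X in _ - X]max_r ?leNye// max_l ?leey// sube0.
Qed.

Variable Phi : potential R k d.
Hypotheses (PhiN : forall Lam phi, Phi Lam phi != -oo)
  (Phi0 : forall Lam phi, (#|` Lam| <= 1)%N -> Phi Lam phi = 0).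

Lemma hamiltonianE Lam phi : hamiltonian Phi Lam [set` Lam] phi =
  \sum_(Gam <- fpowerset Lam) Phi Gam phi.
Proof.
rewrite -sume_posneg//; rewrite /hamiltonian.
set I := [set Gam | _].
(* The empty set is disjoint from [Lam] and so not in [I]; it may be restored afterwards because
   [Phi fset0] vanishes. *)
have IE : I = [set` (fpowerset Lam `\ fset0)%fset].
  apply/seteqP; split => Gam; rewrite /I /= !inE fpowersetE.
    move=> [GL GLn]; apply/andP; split.
      by apply: contraNneq GLn => ->; exact: fdisjoint0X.
    by apply/fsubsetP => x xG; exact: GL.
  move=> /andP[G0 /fsubsetP GL]; split; first by move=> x /= xG; exact: GL.
  move/fset0Pn: G0 => [x xG]; apply/negP => /fdisjointP/(_ x xG).
  by rewrite GL.
have big0 (f : {fset Zd d} -> \bar R) : f fset0 = 0 -> (forall Gam, 0 <= f Gam) ->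
    \esum_(Gam in I) f Gam = \sum_(Gam <- fpowerset Lam) f Gam.
  move=> f0 fge0; rewrite esum_fset ?IE//.
  rewrite fsbig_finite//= set_fsetK.
  by rewrite [RHS](big_fsetD1 fset0) ?fpowersetE ?fsub0set//= f0 add0e.
have e0 : Phi fset0 phi = 0 by apply: Phi0; rewrite cardfs0.
congr (_ - _); apply: big0; rewrite ?e0 ?oppe0 ?maxxx// => Gam;
  by rewrite le_max lexx orbT.
Qed.

End hamiltonian.

Section energy.
Context (R : realType) (k : height_kind) (d : nat).
Local Notation E := (heights R k).
Local Notation lambda := (ref_measure R k).
Local Notation Om := (Omega R k d).
Local Notation CT := (coord_space R k (@setT (Zd d))).
Local Open Scope ereal_scope.
Implicit Types (Lam Del Gam : {fset Zd d}) (phi : Om).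
Variables (L : set (Zd d)) (Psi Xi Phi : potential R k d).
Hypotheses (PsiP : periodic_gradient_potential L Psi)
  (Psi_ge0 : forall Lam phi, 0 <= Psi Lam phi)
  (XiP : periodic_gradient_potential L Xi)
  (Xi_norm : potential_norm Xi < +oo)
  (PhiE : forall Lam phi, Phi Lam phi = Psi Lam phi + Xi Lam phi).

Definition energy Lam phi := \sum_(Gam <- fpowerset Lam) Phi Gam phi.

Lemma PhiN Lam phi : Phi Lam phi != -oo.
Proof.
rewrite PhiE; have [_ XiN _ _] := XiP.
move: (Psi_ge0 Lam phi) (XiN Lam phi).
by case: (Psi Lam phi) => [r| |] //; case: (Xi Lam phi).
Qed.

Lemma Phi_small Lam phi : (#|` Lam| <= 1)%N -> Phi Lam phi = 0.
Proof.
by move=> L1; case: PsiP => _ _ Ps _; case: XiP => _ _ Xs _; rewrite PhiE Ps// Xs// adde0.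
Qed.

Lemma energyE Lam phi : hamiltonian Phi Lam [set` Lam] phi = energy Lam phi.
Proof. by apply: hamiltonianE; [exact: PhiN|exact: Phi_small]. Qed.

Lemma measurable_Phi Lam :
  measurable_fun setT (Phi Lam : grad_space R k [set` Lam] -> \bar R).
Proof.
rewrite (_ : Phi Lam = fun phi => Psi Lam phi + Xi Lam phi); last first.
  by apply/funext => phi; exact: PhiE.
by case: PsiP => mPsi _ _ _; case: XiP => mXi _ _ _; exact: emeasurable_funD.
Qed.

Lemma measurable_energy Lam :
  measurable_fun setT (energy Lam : grad_space R k [set` Lam] -> \bar R).
Proof.
suff H (s : seq {fset Zd d}) : {subset s <= fpowerset Lam} ->
    measurable_fun setT ((fun phi => \sum_(Gam <- s) Phi Gam phi)
      : grad_space R k [set` Lam] -> \bar R) by exact: H.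
elim: s => [|Gam s IH] sL.
  rewrite (_ : (fun _ => _) = cst 0); first exact: measurable_cst.
  by apply/funext => phi; rewrite big_nil.
rewrite (_ : (fun _ => _) = fun phi => Phi Gam phi + \sum_(Gam <- s) Phi Gam phi); last first.
  by apply/funext => phi; rewrite big_cons.
apply: emeasurable_funD; last first.
  by apply: IH => Gam' Gs; apply: sL; rewrite inE Gs orbT.
apply: measurable_fun_grad_mono (@measurable_Phi Gam) => x xG.
have := sL Gam (mem_head _ _); rewrite fpowersetE => /fsubsetP; exact.
Qed.

Lemma energy_shift t Lam phi : L t ->
  energy (shift_fset t Lam) phi = energy Lam (shift_height t phi).
Proof.
move=> Lt; rewrite /energy.
have shiftI : injective (shift_fset t).
  move=> A B AB; apply/fsetP => x.
  by have := mem_shift_fset t A (x + t)%R; rewrite AB mem_shift_fset !addrK.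
rewrite (perm_big [seq shift_fset t Gam | Gam <- fpowerset Lam])/=; last first.
  apply: uniq_perm; first exact: fset_uniq.
    by rewrite map_inj_uniq ?fset_uniq.
  move=> Gam; rewrite -[LHS]/(Gam \in fpowerset (shift_fset t Lam)) fpowersetE.
  apply/idP/mapP => [/fsubsetP GL|[Gam' GL ->]].
    exists (shift_fset (- t) Gam).
      rewrite -[_ \in _]/(shift_fset (- t) Gam \in fpowerset Lam) fpowersetE.
      apply/fsubsetP => x; rewrite mem_shift_fset opprK => /GL.
      by rewrite mem_shift_fset addrK.
    by apply/fsetP => x; rewrite !mem_shift_fset opprK subrK.
  move: GL; rewrite -[_ \in _]/(Gam' \in fpowerset Lam) fpowersetE => /fsubsetP GL.
  by apply/fsubsetP => x; rewrite !mem_shift_fset => /GL.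
rewrite big_map; apply: eq_bigr => Gam _; rewrite !PhiE.
by case: PsiP => _ _ _ ->//; case: XiP => _ _ _ ->.
Qed.

Definition xi_norm := fine (potential_norm Xi).

Lemma potential_norm_ge0 : 0 <= potential_norm Xi.
Proof.
apply: (@le_trans _ _ (\esum_(Gam in [set Gam : {fset Zd d} | (0%R : Zd d) \in Gam])
    `|Xi Gam (fun=> height0 R k)|)); first exact: esum_ge0.
by apply: ereal_sup_ubound; exists 0%R, (fun=> height0 R k).
Qed.

Lemma xi_norm_ge0 : (0 <= xi_norm)%R.
Proof. by rewrite fine_ge0// potential_norm_ge0. Qed.

Lemma xi_normE : potential_norm Xi = xi_norm%:E.
Proof. by rewrite fineK// ge0_fin_numE// potential_norm_ge0. Qed.

Lemma esum_Xi_le x phi :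
  \esum_(Gam in [set Gam : {fset Zd d} | x \in Gam]) `|Xi Gam phi| <= xi_norm%:E.
Proof. by rewrite -xi_normE; apply: ereal_sup_ubound; exists x, phi. Qed.

Lemma abs_Xi_le Gam phi : `|Xi Gam phi| <= xi_norm%:E.
Proof.
have [->|/fset0Pn[x xG]] := eqVneq Gam fset0.
  have -> : Xi fset0 phi = 0 by case: XiP => _ _ X0 _; apply: X0; rewrite cardfs0.
  by rewrite abse0 lee_fin xi_norm_ge0.
apply: le_trans (esum_Xi_le x phi).
rewrite -(@esum_set1 _ _ Gam (fun Gam => `|Xi Gam phi|))//.
by apply: subset_esum => _ ->.
Qed.

Lemma abs_Xi_fin Gam phi : `|Xi Gam phi| \is a fin_num.
Proof.
by rewrite ge0_fin_numE//; apply: le_lt_trans (abs_Xi_le _ _) _; rewrite ltry.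
Qed.

Lemma Phi_ge Gam phi : - `|Xi Gam phi| <= Phi Gam phi.
Proof.
rewrite PhiE; apply: (@le_trans _ _ (Xi Gam phi)).
  by rewrite leeNl -abseN lee_abs.
by rewrite leeDr.
Qed.

Lemma energy_ge Lam : exists b : R, forall phi, (- b)%:E <= energy Lam phi.
Proof.
exists (\sum_(Gam <- fpowerset Lam) xi_norm)%R => phi.
rewrite /energy -sumrN -sumEFin; apply: lee_sum => Gam _.
by apply: le_trans (Phi_ge Gam phi); rewrite EFinN leeN2 abs_Xi_le.
Qed.

Lemma lower_exterior_bound_ge0 Lam : 0 <= lower_exterior_bound Xi Lam.
Proof.
apply: (@le_trans _ _ (\esum_(Delta in [set Delta : {fset Zd d} |
                 ~~ [disjoint Delta & Lam]%fset /\
                 ~~ (Delta `<=` Lam)%fset])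
          `|Xi Delta (fun=> height0 R k)|)); first exact: esum_ge0.
by apply: ereal_sup_ubound; eexists; reflexivity.
Qed.

Lemma lower_exterior_bound1 x : lower_exterior_bound Xi [fset x]%fset <= xi_norm%:E.
Proof.
apply: ge_ereal_sup => _ [phi ->]; apply: le_trans (esum_Xi_le x phi).
apply: subset_esum => Gam [/= + _].
by apply: contraR => xG; apply/fdisjointP => y yG; rewrite inE; apply: contraNneq xG => <-.
Qed.

(** Subadditivity reduces the bound to single points, where it is at most the norm of [Xi]. *)
Lemma lower_exterior_bound_le Lam : amenable L (lower_exterior_bound Xi) ->
  lower_exterior_bound Xi Lam <= (#|` Lam|%:R * xi_norm)%:E.
Proof.
move=> [_ _ sub _]; elim/fset1U_rect: Lam => [|x Lam xL IH].
  rewrite cardfs0 mul0r; apply: ge_ereal_sup => _ [phi ->].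
  rewrite (_ : [set Delta | _] = set0) ?esum_set0//.
  by apply/seteqP; split => // Gam [/negP]; rewrite fdisjointX0.
apply: le_trans (sub _ _ _) _; first by rewrite fdisjoint1X.
rewrite cardfsU1 xL natrD mulrDl mul1r EFinD.
by apply: leeD IH; exact: lower_exterior_bound1.
Qed.

Lemma lower_exterior_bound_fin Lam : amenable L (lower_exterior_bound Xi) ->
  lower_exterior_bound Xi Lam \is a fin_num.
Proof.
move=> am; rewrite ge0_fin_numE ?lower_exterior_bound_ge0//.
by apply: le_lt_trans (lower_exterior_bound_le _ am) _; rewrite ltry.
Qed.

(** The subsets of the union in neither [Lam] nor [Del] meet [Del] and leave it, so their [Xi]-terms
    are controlled by the exterior bound of [Del] alone, while their [Psi]-terms are nonnegative.
    The set [Lam] being grown thus contributes no error. *)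
Lemma energy_glue Lam Del phi : [disjoint Lam & Del]%fset ->
  energy Lam phi + energy Del phi - lower_exterior_bound Xi Del <=
  energy (Lam `|` Del)%fset phi.
Proof.
move=> LD; rewrite /energy.
rewrite [leRHS](bigID (fun Gam => (Gam `<=` Lam)%fset))/=.
rewrite [X in _ <= _ + X](bigID (fun Gam => (Gam `<=` Del)%fset))/= addeA.
have e1 : \sum_(Gam <- fpowerset (Lam `|` Del)%fset | (Gam `<=` Lam)%fset) Phi Gam phi =
    \sum_(Gam <- fpowerset Lam) Phi Gam phi.
  rewrite -big_filter; apply: perm_big; apply: uniq_perm.
  - by rewrite filter_uniq// fset_uniq.
  - exact: fset_uniq.
  move=> Gam; rewrite mem_filter -![Gam \in _]/(Gam \in fpowerset _) !fpowersetE.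
  apply/andP/idP => [[]//|GL]; split => //.
  by apply: fsubset_trans GL _; exact: fsubsetUl.
have e2 : \sum_(Gam <- fpowerset (Lam `|` Del)%fset |
      ~~ (Gam `<=` Lam)%fset && (Gam `<=` Del)%fset) Phi Gam phi =
    \sum_(Gam <- fpowerset Del) Phi Gam phi.
  rewrite [RHS](bigID (fun Gam => ~~ (Gam `<=` Lam)%fset))/= [X in _ = _ + X]big1_seq.
    rewrite adde0 -big_filter -[RHS]big_filter; apply: perm_big; apply: uniq_perm.
    - by rewrite filter_uniq// fset_uniq.
    - by rewrite filter_uniq// fset_uniq.
    move=> Gam; rewrite !mem_filter -![Gam \in _]/(Gam \in fpowerset _) !fpowersetE.
    case: (Gam `<=` Lam)%fset => //=.
    apply/andP/idP => [[]//|GL]; split => //.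
    by apply: fsubset_trans GL _; exact: fsubsetUr.
  move=> Gam /andP[/negPn GL]; rewrite -[Gam \in _]/(Gam \in fpowerset _) fpowersetE => GD.
  apply: Phi_small; suff -> : Gam = fset0 by rewrite cardfs0.
  apply/eqP; rewrite -fsubset0; apply/fsubsetP => x xG.
  move/fdisjointP : LD => /(_ x (fsubsetP GL _ xG)).
  by rewrite (fsubsetP GD _ xG).
rewrite e1 e2; apply: leeD => //.
pose P Gam := ~~ (Gam `<=` Lam)%fset && ~~ (Gam `<=` Del)%fset.
change (- lower_exterior_bound Xi Del <=
  \sum_(Gam <- fpowerset (Lam `|` Del)%fset | P Gam) Phi Gam phi).
pose C := [fset Gam in fpowerset (Lam `|` Del) | P Gam]%fset.
apply: (@le_trans _ _ (- \sum_(Gam <- C) `|Xi Gam phi|)).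
  rewrite leeN2; apply: (@le_trans _ _ (\esum_(Delta in [set Delta : {fset Zd d} |
      ~~ [disjoint Delta & Del]%fset /\ ~~ (Delta `<=` Del)%fset]) `|Xi Delta phi|)).
    apply: esum_ge; exists [set` C]; last by rewrite fsbig_finite//= set_fsetK.
    split; first exact: finite_fset.
    move=> Gam /=; rewrite !inE fpowersetE => /andP[/fsubsetP GU /andP[GL GD]]; split => //.
    apply: contraNN GL => /fdisjointP GDd; apply/fsubsetP => x xG.
    by have := GU _ xG; rewrite in_fsetU (negbTE (GDd _ xG)) orbF.
  by apply: ereal_sup_ubound; exists phi.
rewrite (@perm_big _ _ _ _ (enum_fset C) [seq Gam <- fpowerset (Lam `|` Del)%fset | P Gam]); last first.
  apply: uniq_perm; [exact: fset_uniq|by rewrite filter_uniq ?fset_uniq|].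
  move=> Gam; rewrite mem_filter -[LHS]/(Gam \in C) !inE andbC.
  by [].
rewrite big_filter; elim: (enum_fset _) => [|Gam s IH]; first by rewrite !big_nil oppe0.
rewrite !big_cons; case: ifPn => // _.
rewrite fin_num_oppeD//; last first.
  by apply/sum_fin_numP => Gam' _ _; exact: abs_Xi_fin.
by apply: leeD => //; exact: Phi_ge.
Qed.

Variable K : R.
Hypothesis K1 : (1 <= K)%R.

(** All pairs are constrained, not only neighbours: on a disconnected [Lam] a bound between
    neighbours would leave the reference mass infinite. *)
Definition slope_set Lam : set Om := [set phi | forall x y, x \in Lam -> y \in Lam ->
  (`|height_val (height_sub (phi y) (phi x))| <= K * (d1 x y)%:R)%R].

Lemma measurable_slope_set Lam :
  measurable (slope_set Lam : set (grad_space R k [set` Lam])).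
Proof.
have -> : slope_set Lam = \bigcap_(p in [set` Lam] `*` [set` Lam])
    ((fun phi : Om => height_sub (phi p.2) (phi p.1)) @^-1`
      height_ball (K * (d1 p.1 p.2)%:R)%R).
  apply/seteqP; split => [phi H [x y] [xL yL]|phi H x y xL yL]; first exact: H.
  exact: (H (x, y)).
apply: fin_bigcap_measurable; first exact: finite_setX.
move=> [x y] [/= xL yL]; rewrite -[X in measurable X]setTI.
have mB := @measurable_height_ball R k (K * (d1 x y)%:R)%R.
exact: (@measurable_grad_space R k d [set` Lam] x y xL yL measurableT _ mB).
Qed.

Lemma grad_ref_measure_slope_set Lam : grad_ref_measure R k Lam (slope_set Lam) < +oo.
Proof.
apply: (grad_ref_measure_bounded_fin (K := fun x y => (K * (d1 x y)%:R)%R)).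
  exact: measurable_slope_set.
by move=> phi x y; apply.
Qed.

Lemma slope_set_sub Lam Del : (Lam `<=` Del)%fset -> slope_set Del `<=` slope_set Lam.
Proof. by move=> /fsubsetP LD phi H x y xL yL; apply: H; exact: LD. Qed.

Lemma slope_set_shift t Lam phi :
  slope_set (shift_fset t Lam) phi <-> slope_set Lam (shift_height t phi).
Proof.
have d1E x y : d1 (x + t)%R (y + t)%R = d1 x y.
  by apply: eq_bigr => i _; rewrite !mxE opprD addrACA subrr addr0.
split => H x y xL yL.
  by rewrite -(d1E x y); apply: H; rewrite mem_shift_fset addrK.
rewrite !mem_shift_fset in xL yL; have := H _ _ xL yL.
by rewrite -d1E /shift_height !subrK.
Qed.

Definition dv_test Lam (g : Om -> R) :=
  tilted_test (grad_ref_measure R k Lam) (energy Lam) (slope_set Lam)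
    (g : grad_space R k [set` Lam] -> R).

Definition dv Lam (mu : grad_prob R k d) :=
  ereal_sup [set \int[mu]_phi (g phi)%:E | g in dv_test Lam].

Lemma dv_test_measurable Lam g : dv_test Lam g ->
  measurable_fun setT (g : grad_space R k setT -> R).
Proof. by move=> [mg _ _]; exact: measurable_fun_grad_mono mg. Qed.

Lemma dv_test_integrable Lam g (mu : grad_prob R k d) : dv_test Lam g ->
  mu.-integrable setT (EFin \o (g : grad_space R k setT -> R)).
Proof.
move=> tg; have mg := dv_test_measurable tg; have [_ [M gM] _] := tg.
exact: (@bounded_integrable _ _ _ mu g M mg gM).
Qed.

(** Restricting to a smaller sigma-algebra is a pushforward under the identity. *)
Lemma ge0_integral_grad_restriction (S : set (Zd d)) (mu : grad_prob R k d)
    (f : Om -> \bar R) :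
  measurable_fun setT (f : grad_space R k S -> \bar R) ->
  (forall phi, 0 <= f phi) ->
  \int[@grad_restriction R k d S mu]_phi f phi = \int[mu]_phi f phi.
Proof.
move=> mf f0.
have mid : measurable_fun setT (id : grad_space R k setT -> grad_space R k S).
  by move=> _ B mB; rewrite setTI; exact: grad_space_mono mB.
by rewrite -[RHS](@ge0_integral_pushforward _ _ _ _ _ _ mid mu setT f).
Qed.

Lemma integral_grad_restriction (S : set (Zd d)) (mu : grad_prob R k d)
    (f : Om -> \bar R) :
  measurable_fun setT (f : grad_space R k S -> \bar R) ->
  \int[@grad_restriction R k d S mu]_phi f phi = \int[mu]_phi f phi.
Proof.
move=> mf; rewrite integralE [RHS]integralE; congr (_ - _).
  apply: ge0_integral_grad_restriction => //; exact: measurable_funepos.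
apply: ge0_integral_grad_restriction => //; exact: measurable_funeneg.
Qed.

Lemma dv_tilted_sup Lam (mu : grad_prob R k d) :
  dv Lam mu = tilted_sup (grad_ref_measure R k Lam) (energy Lam) (slope_set Lam)
    (@grad_restriction R k d [set` Lam] mu).
Proof.
have E g : dv_test Lam g -> \int[@grad_restriction R k d [set` Lam] mu]_phi (g phi)%:E =
    \int[mu]_phi (g phi)%:E.
  by move=> [mg _ _]; apply: (@integral_grad_restriction _ mu (EFin \o g)); exact/measurable_EFinP.
congr ereal_sup; apply/seteqP; split => _ [g tg <-]; exists g => //; first exact: E.
exact/esym/E.
Qed.

Lemma dv_test_ub Lam g (mu : grad_prob R k d) : dv_test Lam g ->
  \int[mu]_phi (g phi)%:E <= dv Lam mu.
Proof. by move=> tg; apply: ereal_sup_ubound; exists g. Qed.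

Lemma dv_gtNy Lam (mu : grad_prob R k d) : -oo < dv Lam mu.
Proof.
rewrite dv_tilted_sup; have [b Wb] := energy_ge Lam.
by apply: (@tilted_sup_gtNy _ _ _ _ _ _ b) => //;
  [exact: measurable_slope_set|exact: measurable_energy|exact: grad_ref_measure_slope_set].
Qed.

(** Read backwards, a bound on [dv] gives the slope bound almost surely, with no reference to the
    mean energy. *)
Lemma dv_infinite Lam (mu : grad_prob R k d) : 0 < mu (~` slope_set Lam) ->
  dv Lam mu = +oo.
Proof.
move=> mu0; rewrite dv_tilted_sup; have [b Wb] := energy_ge Lam.
have mS := @measurable_slope_set Lam.
have H := @tilted_sup_singular _ _ _ _ _ _ b (@grad_restriction R k d [set` Lam] mu)
  mS (@measurable_energy Lam) Wb (grad_ref_measure_slope_set Lam) (~` slope_set Lam).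
apply: H; [exact: measurableC|by rewrite setICl measure0|exact: mu0].
Qed.

(** The slope constraint is an indicator here, so that weights on two sets can be multiplied and
    integrated over the union. *)
Definition dv_weight Lam (g : Om -> R) phi :=
  expeR ((g phi)%:E - energy Lam phi) * (\1_(slope_set Lam) phi)%:E.

Lemma dv_weightE Lam g :
  \int[grad_ref_measure R k Lam]_(phi in slope_set Lam)
    expeR ((g phi)%:E - energy Lam phi) =
  \int[grad_ref_measure R k Lam]_phi dv_weight Lam g phi.
Proof.
rewrite integral_mkcond; apply: eq_integral => phi _.
by rewrite epatch_indic.
Qed.

Lemma dv_weight_grad_fun Lam g :
  measurable_fun setT (g : grad_space R k [set` Lam] -> R) ->
  grad_fun [set` Lam] (dv_weight Lam g).
Proof.
move=> mg; split=> [phi|].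
  by rewrite /dv_weight mule_ge0 ?expeR_ge0 ?lee_fin.
apply: emeasurable_funM; first by apply: measurable_tilt => //; exact: measurable_energy.
by apply/measurable_EFinP; apply: measurable_indic; exact: measurable_slope_set.
Qed.

Lemma shift_heightK t : cancel (@shift_height R k d t) (shift_height (- t)%R).
Proof. by move=> phi; apply/funext => y; rewrite /shift_height subrK. Qed.

Lemma shift_heightNK t : cancel (@shift_height R k d (- t)%R) (shift_height t).
Proof. by move=> phi; apply/funext => y; rewrite /shift_height addrK. Qed.

Lemma dv_test_shift t Lam g : L t -> Lam != fset0 ->
  dv_test (shift_fset t Lam) g <-> dv_test Lam (g \o shift_height (- t)%R).
Proof.
move=> Lt L0.
have weightE phi : dv_weight (shift_fset t Lam) g (shift_height (- t)%R phi) =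
    dv_weight Lam (g \o shift_height (- t)%R) phi.
  rewrite /dv_weight energy_shift// shift_heightNK; congr (_ * _%:E).
  rewrite !indicE; congr (_%:R)%R; congr nat_of_bool.
  apply/idP/idP; rewrite !inE => H.
    by have /slope_set_shift := H; rewrite shift_heightNK.
  by apply/slope_set_shift; rewrite shift_heightNK.
have intE : measurable_fun setT (g : grad_space R k [set` shift_fset t Lam] -> R) ->
    \int[grad_ref_measure R k (shift_fset t Lam)]_(phi in slope_set (shift_fset t Lam))
      expeR ((g phi)%:E - energy (shift_fset t Lam) phi) =
    \int[grad_ref_measure R k Lam]_(phi in slope_set Lam)
      expeR (((g \o shift_height (- t)%R) phi)%:E - energy Lam phi).
  move=> mg; rewrite !dv_weightE integral_grad_ref_measure_shift//; last first.
    exact: dv_weight_grad_fun.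
  by apply: eq_integral => phi _; exact: weightE.
split=> -[mg [M gM] Zg].
- split; last by rewrite -intE.
    apply: (@measurableT_comp _ _ _ _ (grad_space R k [set` shift_fset t Lam]) _ g) => //.
    by apply: measurable_shift_height => x /=; rewrite mem_shift_fset.
  by exists M => phi; exact: gM.
- have mg' : measurable_fun setT (g : grad_space R k [set` shift_fset t Lam] -> R).
    have -> : g = (g \o shift_height (- t)%R) \o shift_height t.
      by apply/funext => phi /=; rewrite shift_heightK.
    apply: (@measurableT_comp _ _ _ _ (grad_space R k [set` Lam]) _
      (g \o shift_height (- t)%R)) => //.
    by apply: measurable_shift_height => x /= xL; rewrite mem_shift_fset addrK.
  split => //; last by rewrite intE.
  by exists M => phi; rewrite -(shift_heightK t phi); exact: gM.
Qed.

Lemma integral_shift t (mu : grad_prob R k d) (f : Om -> \bar R) :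
  invariant_grad_prob L mu -> L t ->
  mu.-integrable setT (f : grad_space R k setT -> \bar R) ->
  mu.-integrable setT (f \o shift_height t : grad_space R k setT -> \bar R) ->
  \int[mu]_phi f (shift_height t phi) = \int[mu]_phi f phi.
Proof.
move=> [_ muL] Lt fi fti.
have msh : measurable_fun setT
    (shift_height t : grad_space R k setT -> grad_space R k setT).
  exact: measurable_shift_height.
have mf : measurable_fun setT (f : grad_space R k setT -> \bar R) by exact: measurable_int fi.
rewrite -[LHS](@integral_pushforward _ _ _ _ _ _ msh mu setT f)//.
by apply: eq_measure_integral => A mA _; exact: muL.
Qed.

Lemma dv_shift t Lam (mu : grad_prob R k d) : invariant_grad_prob L mu -> L t ->
  Lam != fset0 -> dv (shift_fset t Lam) mu = dv Lam mu.
Proof.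
move=> muL Lt L0.
have inv g : dv_test (shift_fset t Lam) g ->
    \int[mu]_phi (g phi)%:E = \int[mu]_phi ((g \o shift_height (- t)%R) phi)%:E.
  move=> tg; have tg1 := (dv_test_shift g Lt L0).1 tg.
  rewrite -(@integral_shift t mu (EFin \o (g \o shift_height (- t)%R)))//.
  - by apply: eq_integral => phi _ /=; rewrite shift_heightK.
  - exact: dv_test_integrable tg1.
  - rewrite (_ : _ \o _ = EFin \o g); first exact: dv_test_integrable tg.
    by apply/funext => phi /=; rewrite shift_heightK.
congr ereal_sup; apply/seteqP; split => _ [g tg <-].
  by exists (g \o shift_height (- t)%R); [exact: (dv_test_shift g Lt L0).1|exact/esym/inv].
exists (g \o shift_height t).
  apply/(dv_test_shift _ Lt L0).
  rewrite (_ : _ \o _ = g)//; apply/funext => phi /=; by rewrite shift_heightNK.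
rewrite inv; first by apply: eq_integral => phi _ /=; rewrite shift_heightNK.
apply/(dv_test_shift _ Lt L0).
rewrite (_ : _ \o _ = g)//; apply/funext => phi /=; by rewrite shift_heightNK.
Qed.

Lemma energy1 x phi : energy [fset x]%fset phi = 0.
Proof.
rewrite /energy big1_seq// => Gam /=; rewrite -[_ \in _]/(Gam \in fpowerset _) fpowersetE.
by move=> /fsubset_leq_card; rewrite cardfs1 => G1; exact: Phi_small.
Qed.

(** On one point the reference measure is a unit mass and the energy vanishes, so the zero function
    is a test. *)
Lemma dv_single x (mu : grad_prob R k d) : 0 <= dv [fset x]%fset mu.
Proof.
have t0 : dv_test [fset x]%fset (cst 0%R).
  split; [exact: measurable_cst|by exists 0%R => phi; rewrite normr0|].
  rewrite dv_weightE.
  rewrite (@integral_grad_ref_measure_perm _ _ _ [fset x]%fset x [::]); last 2 first.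
  - apply: uniq_perm; rewrite ?fset_uniq// => y.
    by rewrite inE -[RHS]/(y \in [fset x]%fset) inE.
  - by apply: dv_weight_grad_fun; exact: measurable_cst.
  rewrite /= /dv_weight energy1 sube0 expeR0 mul1e lee_fin indicE.
  by case: (_ \in _).
by apply: le_trans (dv_test_ub mu t0); rewrite integral0.
Qed.

(** As [x] and [y] are neighbours, the increment between them is at most [K] on the slope set of the
    union; integrating it out contributes the factor [lambda (height_ball K)], whose logarithm is
    subtracted. The other constant pays for [energy_glue]. *)
Lemma dv_test_glue Lam Del x y g1 g2 : amenable L (lower_exterior_bound Xi) ->
  [disjoint Lam & Del]%fset -> x \in Lam -> y \in Del -> d1 x y = 1%N ->
  dv_test Lam g1 -> dv_test Del g2 ->
  dv_test (Lam `|` Del)%fset (fun phi => g1 phi + g2 phi -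
    (ln (fine (lambda (height_ball K))) + fine (lower_exterior_bound Xi Del)))%R.
Proof.
move=> am LD xL yD xy1 [mg1 [M1 gM1] Z1] [mg2 [M2 gM2] Z2].
have efin := lower_exterior_bound_fin Del am.
set e := fine (lower_exterior_bound Xi Del).
have lK1 : 1 <= lambda (height_ball K) by exact: ref_measure_ball_ge1.
have lKfin : lambda (height_ball K) \is a fin_num.
  by rewrite ge0_fin_numE//; exact: ref_measure_ball_fin.
set lK := fine (lambda (height_ball K)).
have lK0 : (0 < lK)%R.
  by apply: (@lt_le_trans _ _ 1%R) => //; rewrite -lee_fin fineK.
have mg1' : measurable_fun setT (g1 : grad_space R k [set` (Lam `|` Del)%fset] -> R).
  by apply: measurable_fun_grad_mono mg1 => z /= zL; rewrite in_fsetU zL.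
have mg2' : measurable_fun setT (g2 : grad_space R k [set` (Lam `|` Del)%fset] -> R).
  by apply: measurable_fun_grad_mono mg2 => z /= zL; rewrite in_fsetU zL orbT.
have mg : measurable_fun setT ((fun phi => g1 phi + g2 phi - (ln lK + e))%R
    : grad_space R k [set` (Lam `|` Del)%fset] -> R).
  by apply: measurable_funB => //; exact: measurable_funD.
split => //.
  exists (M1 + M2 + `|ln lK + e|)%R => phi; apply: le_trans (ler_normB _ _) _.
  by rewrite lerD2r (le_trans (ler_normD _ _))// lerD.
rewrite dv_weightE.
have gW1 := dv_weight_grad_fun mg1; have gW2 := dv_weight_grad_fun mg2.
have [w1 mw1] := gW1; have [w2 mw2] := gW2.
pose D := [set phi : Om | (`|height_val (height_sub (phi y) (phi x))| <= K)%R].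
have mD : measurable (D : set (grad_space R k [set` (Lam `|` Del)%fset])).
  have xU : [set` (Lam `|` Del)%fset] x by rewrite /= in_fsetU xL.
  have yU : [set` (Lam `|` Del)%fset] y by rewrite /= in_fsetU yD orbT.
  have mB := @measurable_height_ball R k K.
  by have := measurable_grad_space xU yU measurableT mB; rewrite setTI.
have mH : measurable_fun setT ((fun phi => dv_weight Lam g1 phi *
    (dv_weight Del g2 phi * (\1_D phi)%:E)) : grad_space R k [set` (Lam `|` Del)%fset] -> \bar R).
  apply: emeasurable_funM.
    by apply: measurable_fun_grad_mono mw1 => z /= zL; rewrite in_fsetU zL.
  apply: emeasurable_funM; last by apply/measurable_EFinP; exact: measurable_indic.
  by apply: measurable_fun_grad_mono mw2 => z /= zL; rewrite in_fsetU zL orbT.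
apply: (@le_trans _ _ (\int[grad_ref_measure R k (Lam `|` Del)%fset]_phi
    ((lK^-1)%R%:E * (dv_weight Lam g1 phi * (dv_weight Del g2 phi * (\1_D phi)%:E))))).
  apply: ge0_le_integral => //.
  - by move=> phi _; case: (dv_weight_grad_fun mg).
  - by case: (dv_weight_grad_fun mg).
  - exact: emeasurable_funM.
  - move=> phi _; rewrite /dv_weight [in leLHS]indicE.
    have [|_] := boolP (phi \in slope_set _); last first.
      rewrite mule0; apply: mule_ge0; first by rewrite lee_fin invr_ge0 ltW.
      by rewrite !mule_ge0 ?expeR_ge0 ?lee_fin.
    rewrite inE => Sphi.
    have S1 := slope_set_sub (fsubsetUl Lam Del) Sphi.
    have S2 := slope_set_sub (fsubsetUr Lam Del) Sphi.
    have Dphi : D phi.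
      have := Sphi x y; rewrite !in_fsetU xL yD orbT xy1 mulr1; exact.
    rewrite !indicE !mem_set// !mule1 -expeRD.
    rewrite -[lK]lnK ?posrE// -expRN -[(expR _)%:E]/(expeR (- ln lK)%:E) -expeRD lee_expeR.
    have := energy_glue phi LD; rewrite -(fineK efin) -/e.
    have [b1 /(_ phi)] := energy_ge Lam; have [b2 /(_ phi)] := energy_ge Del.
    (* An infinite energy of the union makes the left weight zero; a finite one forces both partial
       energies to be finite, by [energy_glue]. *)
    case: (energy (Lam `|` Del)%fset phi) => [w| |].
    + case: (energy Lam phi) => [u| |//]; case: (energy Del phi) => [v| |//] //=.
      by rewrite -!EFinD !lee_fin expRK => _ _ h; lra.
    + by rewrite addeNy leNye.
    + case: (energy Lam phi) => [u| |//]; case: (energy Del phi) => [v| |//] //=.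
rewrite ge0_integralZl//; last 2 first.
- by move=> phi _; apply: mule_ge0; [exact: w1|apply: mule_ge0; [exact: w2|rewrite lee_fin]].
- by rewrite lee_fin invr_ge0 ltW.
rewrite (integral_grad_ref_measure_glue K LD xL yD gW1 gW2).
rewrite dv_weightE in Z1; rewrite dv_weightE in Z2.
apply: (@le_trans _ _ ((lK^-1)%R%:E * (1 * (lambda (height_ball K) * 1)))).
  apply: lee_wpmul2l; first by rewrite lee_fin invr_ge0 ltW.
  apply: lee_pmul => //; first exact: integral_ge0.
    by rewrite mule_ge0// integral_ge0.
  by apply: lee_wpmul2l.
by rewrite mul1e mule1 -(fineK lKfin) -EFinM mulVf ?gt_eqF.
Qed.

Lemma dv_glue Lam Del x y mu : amenable L (lower_exterior_bound Xi) ->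
  [disjoint Lam & Del]%fset -> x \in Lam -> y \in Del -> d1 x y = 1%N ->
  dv Lam mu + dv Del mu -
    (ln (fine (lambda (height_ball K))) + fine (lower_exterior_bound Xi Del))%:E <=
  dv (Lam `|` Del)%fset mu.
Proof.
move=> am LD xL yD xy1; set c := (ln _ + _)%R.
have [->|Uoo] := eqVneq (dv (Lam `|` Del)%fset mu) +oo; first by rewrite leey.
have Ufin : dv (Lam `|` Del)%fset mu \is a fin_num.
  by rewrite fin_numE Uoo andbT gt_eqF// dv_gtNy.
have H g1 g2 : dv_test Lam g1 -> dv_test Del g2 ->
    \int[mu]_phi (g1 phi)%:E + \int[mu]_phi (g2 phi)%:E <= dv (Lam `|` Del)%fset mu + c%:E.
  move=> t1 t2; rewrite -leeBlDr//.
  apply: le_trans (dv_test_ub mu (dv_test_glue am LD xL yD xy1 t1 t2)).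
  under [leRHS]eq_integral do rewrite EFinB EFinD.
  have i1 := dv_test_integrable mu t1; have i2 := dv_test_integrable mu t2.
  rewrite integralB//; [|exact: integrableD|exact: finite_measure_integrable_cst].
  rewrite integralD//; apply: leeB => //.
  rewrite (_ : \int[mu]_phi (cst c%:E) phi = c%:E)//.
  rewrite integral_cst//; rewrite -[RHS]mule1; congr (_ * _); exact: probability_setT.
rewrite leeBlDr//.
have H1 g1 : dv_test Lam g1 ->
    \int[mu]_phi (g1 phi)%:E + dv Del mu <= dv (Lam `|` Del)%fset mu + c%:E.
  move=> t1; have f1 := integrable_fin_num measurableT (dv_test_integrable mu t1).
  rewrite addeC -leeBrDr//; apply: ge_ereal_sup => _ [g2 t2 <-].
  by rewrite leeBrDr// [leLHS]addeC; exact: H.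
have [g0 t0] : exists g0, dv_test Lam g0.
  have [b Wb] := energy_ge Lam.
  have [c0 tc] := @tilted_test_cst _ _ _ (grad_ref_measure R k Lam) (energy Lam)
    (slope_set Lam) b (@measurable_slope_set Lam) (@measurable_energy Lam) Wb
    (grad_ref_measure_slope_set Lam).
  by exists (fun=> c0).
(* Finiteness allows [dv Del mu] to be moved to the other side before the supremum over [g1] is
   taken. *)
have Dfin : dv Del mu \is a fin_num.
  rewrite fin_numE gt_eqF ?dv_gtNy//=; apply/negP => /eqP Doo.
  have := H1 _ t0; rewrite Doo addey ?leye_eq.
    by rewrite -(fineK Ufin).
  by have := integrable_fin_num measurableT (dv_test_integrable mu t0); rewrite fin_numE => /andP[].
rewrite -leeBrDr//; apply: ge_ereal_sup => _ [g1 t1 <-].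
by rewrite leeBrDr//; exact: H1.
Qed.

Lemma integral_mixture (t : {i01 R}) (mu nu : grad_prob R k d) (g : Om -> R) (M : R) :
  measurable_fun setT (g : grad_space R k setT -> R) -> (forall phi, (`|g phi| <= M)%R) ->
  \int[mixture t mu nu]_phi (g phi)%:E =
  t%:num%:E * \int[mu]_phi (g phi)%:E + (1 - t%:num)%:E * \int[nu]_phi (g phi)%:E.
Proof.
move=> mg gM.
have ge0 (f : grad_space R k setT -> \bar R) : measurable_fun setT f ->
    (forall phi, 0 <= f phi) ->
    \int[mixture t mu nu]_phi f phi =
    t%:num%:E * \int[mu]_phi f phi + (1 - t%:num)%:E * \int[nu]_phi f phi.
  move=> mf f0.
  transitivity (\int[measure_add (mscale ((t%:num)%:nng)%R mu)
    (mscale ((1 - t%:num)%:nng)%R nu)]_phi f phi); first by [].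
  by rewrite ge0_integral_measure_add// !ge0_integral_mscale.
have mgE : measurable_fun setT (EFin \o g : grad_space R k setT -> \bar R).
  exact/measurable_EFinP.
have i1 := @bounded_integrable _ _ _ mu g M mg gM.
have i2 := @bounded_integrable _ _ _ nu g M mg gM.
rewrite integralE [in X in _ = X + _]integralE [in X in _ = _ + X]integralE.
rewrite !ge0//; [|exact: measurable_funeneg|exact: measurable_funepos].
rewrite -(fineK (integrable_pos_fin_num measurableT i1)).
rewrite -(fineK (integrable_neg_fin_num measurableT i1)).
rewrite -(fineK (integrable_pos_fin_num measurableT i2)).
rewrite -(fineK (integrable_neg_fin_num measurableT i2)).
rewrite -!(EFinM, EFinB, EFinD); congr EFin; ring.
Qed.

Lemma dv_mixture_le Lam (t : {i01 R}) (mu nu : grad_prob R k d) :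
  dv Lam (mixture t mu nu) <=
  t%:num%:E * dv Lam mu + (1 - t%:num)%:E * dv Lam nu.
Proof.
apply: ge_ereal_sup => _ [g tg <-].
have [_ [M gM] _] := tg.
rewrite (integral_mixture t mu nu (dv_test_measurable tg) gM).
by apply: leeD; apply: lee_wpmul2l; rewrite ?lee_fin ?subr_ge0//; exact: dv_test_ub.
Qed.

(** The maximum of a good test for [mu] and a good test for [nu], less [ln 2], is tested against the
    mixture. The two suprema are then taken in turn, which divides by [t] and by [1 - t]. *)
Lemma dv_mixture_ge Lam (t : {i01 R}) (mu nu : grad_prob R k d) :
  (0 < t%:num < 1)%R ->
  t%:num%:E * dv Lam mu + (1 - t%:num)%:E * dv Lam nu <=
  dv Lam (mixture t mu nu) + (ln 2)%:E.
Proof.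
move=> /andP[t0 t1]; set s := (1 - t%:num)%R.
have s0 : (0 < s)%R by rewrite subr_gt0.
have [->|Uoo] := eqVneq (dv Lam (mixture t mu nu)) +oo; first by rewrite addye// leey.
have Ufin : dv Lam (mixture t mu nu) \is a fin_num.
  by rewrite fin_numE Uoo andbT gt_eqF// dv_gtNy.
rewrite -(fineK Ufin) -EFinD; set z := (_ + ln 2)%R.
have H g1 g2 : dv_test Lam g1 -> dv_test Lam g2 ->
    (t%:num * fine (\int[mu]_phi (g1 phi)%:E) + s * fine (\int[nu]_phi (g2 phi)%:E) <= z)%R.
  move=> tg1 tg2.
  have tg := tilted_test_max (@measurable_slope_set Lam) (@measurable_energy Lam) tg1 tg2.
  have := dv_test_ub (mixture t mu nu) tg.
  have [mg [M gM] _] := tg.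
  rewrite (integral_mixture t mu nu (dv_test_measurable tg) gM).
  have j1 := dv_test_integrable mu tg; have j2 := dv_test_integrable nu tg.
  have int_le (m : grad_prob R k d) g : dv_test Lam g ->
      (forall phi, (g phi <= Num.max (g1 phi) (g2 phi))%R) ->
      (fine (\int[m]_phi (g phi)%:E) - ln 2 <=
      fine (\int[m]_phi (Num.max (g1 phi) (g2 phi) - ln 2)%:E))%R.
    move=> tg' gmax.
    have i1 := dv_test_integrable m tg'; have j := dv_test_integrable m tg.
    rewrite -lee_fin EFinB (fineK (integrable_fin_num measurableT i1)).
    rewrite (fineK (integrable_fin_num measurableT j)).
    have cst_int : \int[m]_phi (cst (ln 2)%:E) phi = (ln 2)%:E.
      rewrite integral_cst// -[RHS]mule1; congr (_ * _); exact: probability_setT.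
    rewrite -[X in _ - X]cst_int -integralB//; last exact: finite_measure_integrable_cst.
    apply: le_integral => //.
      by apply: integrableB => //; exact: finite_measure_integrable_cst.
    by move=> phi _; rewrite /= -EFinB lee_fin lerD2r.
  have le1 := int_le mu g1 tg1 (fun phi => ltac:(by rewrite le_max lexx)).
  have le2 := int_le nu g2 tg2 (fun phi => ltac:(by rewrite le_max lexx orbT)).
  rewrite -(fineK (integrable_fin_num measurableT j1)).
  rewrite -(fineK (integrable_fin_num measurableT j2)) -(fineK Ufin).
  rewrite -!EFinM -EFinD lee_fin -/s => h.
  have h1 : (t%:num * (fine (\int[mu]_phi (g1 phi)%:E) - ln 2) <= t%:num *
      fine (\int[mu]_phi (Num.max (g1 phi) (g2 phi) - ln 2)%:E))%R by rewrite ler_pM2l.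
  have h2 : (s * (fine (\int[nu]_phi (g2 phi)%:E) - ln 2) <= s *
      fine (\int[nu]_phi (Num.max (g1 phi) (g2 phi) - ln 2)%:E))%R by rewrite ler_pM2l.
  have h12 := le_trans (lerD h1 h2) h; rewrite /z -lerBlDr.
  apply: le_trans h12; rewrite le_eqVlt; apply/orP; left; apply/eqP.
  by rewrite /s; ring.
have [b Wb] := energy_ge Lam.
have [c0 t00] := @tilted_test_cst _ _ _ (grad_ref_measure R k Lam) (energy Lam)
    (slope_set Lam) b (@measurable_slope_set Lam) (@measurable_energy Lam) Wb
    (grad_ref_measure_slope_set Lam).
have H1 g2 : dv_test Lam g2 -> dv Lam mu <=
    ((z - s * fine (\int[nu]_phi (g2 phi)%:E)) / t%:num)%R%:E.
  move=> tg2; apply: ge_ereal_sup => _ [g1 tg1 <-].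
  rewrite -(fineK (integrable_fin_num measurableT (dv_test_integrable mu tg1))).
  by rewrite lee_fin ler_pdivlMr// mulrC lerBrDr; exact: H.
have mufin : dv Lam mu \is a fin_num.
  rewrite fin_numE gt_eqF ?dv_gtNy//= lt_eqF//.
  by apply: le_lt_trans (H1 _ t00) _; rewrite ltry.
have H2 : dv Lam nu <= ((z - t%:num * fine (dv Lam mu)) / s)%R%:E.
  apply: ge_ereal_sup => _ [g2 tg2 <-].
  rewrite -(fineK (integrable_fin_num measurableT (dv_test_integrable nu tg2))).
  have := H1 _ tg2; rewrite -(fineK mufin) !lee_fin ler_pdivlMr// ler_pdivlMr//.
  move=> h; set y := (fine (\int[nu]_phi (g2 phi)%:E)) in h.
  change (y * s <= z - t%:num * fine (dv Lam mu))%R.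
  by rewrite [(y * s)%R]mulrC lerBrDl -lerBrDr [(t%:num * _)%R]mulrC.
have nufin : dv Lam nu \is a fin_num.
  rewrite fin_numE gt_eqF ?dv_gtNy//= lt_eqF//.
  by apply: le_lt_trans H2 _; rewrite ltry.
move: H2; rewrite -(fineK nufin) -(fineK mufin) -!EFinM -EFinD !lee_fin.
by rewrite ler_pdivlMr// lerBrDr addrC [(fine _ * s)%R]mulrC.
Qed.

(** The test [s * \1_A - ln (Z + 1)] yields [s * mu A <= C + ln (Z + 1)]; it is admissible as soon
    as the tilted mass of [A] is at most [expR (- s)], so [delta] does not depend on [mu]. *)
Lemma dv_uniform_ac Lam (C e : R) : (0 < e)%R -> exists2 delta : R, (0 < delta)%R &
  forall (mu : grad_prob R k d) (A : set Om),
    measurable (A : set (grad_space R k [set` Lam])) -> dv Lam mu <= C%:E ->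
    \int[grad_ref_measure R k Lam]_(phi in slope_set Lam `&` A)
      expeR (0%:E - energy Lam phi) <= delta%:E ->
    mu A <= e%:E.
Proof.
move=> e0; have [b Wb] := energy_ge Lam.
have [Z Z0 ZS] := @tilt_mass_fin _ _ _ (grad_ref_measure R k Lam) (energy Lam)
    (slope_set Lam) b (@measurable_slope_set Lam) (@measurable_energy Lam) Wb
    (grad_ref_measure_slope_set Lam) 0%R.
have lZ : (0 <= ln (Z + 1))%R by rewrite ln_ge0//; lra.
(* Large enough for [(C + ln (Z + 1)) / s <= e]; the summand 1 makes [s] positive. *)
pose s := ((`|C| + ln (Z + 1) + 1) / e)%R.
have s0 : (0 < s)%R by rewrite divr_gt0// ltr_wpDl// addr_ge0.
exists (expR (- s)) => [|mu A mA dC ZA]; first exact: expR_gt0.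
have tg : dv_test Lam (fun phi => s * \1_A phi - ln (Z + 1))%R.
  apply: tilted_test_indic => //; [exact: measurable_slope_set|
    exact: measurable_energy|exact: ltW|].
  apply: le_trans (lee_wpmul2l _ ZA) _; first by rewrite lee_fin expR_ge0.
  by rewrite -EFinM -expRD subrr expR0.
have := le_trans (dv_test_ub mu tg) dC.
have mA' : measurable (A : set (grad_space R k setT)) by exact: grad_space_mono mA.
under eq_integral do rewrite EFinB EFinM.
have i1 : mu.-integrable setT (fun x => s%:E * (\1_A x)%:E).
  by apply: integrableZl => //; exact: integrable_indic.
rewrite integralB//; last exact: finite_measure_integrable_cst.
rewrite integralZl//; last exact: integrable_indic.
rewrite (_ : \int[mu]_phi (\1_A phi)%:E = (fine (mu A))%:E); last first.
  by rewrite integral_indic// setIT fineK//; exact: fin_num_measure.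
rewrite (_ : \int[mu]_phi (ln (Z + 1))%:E = (ln (Z + 1))%:E); last first.
  rewrite -/(cst (ln (Z + 1))%:E) integral_cst// -[RHS]mule1.
  congr (_ * _); exact: probability_setT.
rewrite -EFinM -EFinB lee_fin => h.
have {}h : (s * fine (mu A) <= s * e)%R.
  have -> : (s * e = `|C| + ln (Z + 1) + 1)%R by rewrite /s divfK ?gt_eqF.
  by have := ler_norm C; lra.
by rewrite -(fineK (fin_num_measure mu _ mA')) lee_fin -(ler_pM2l s0).
Qed.

End energy.

(** * Boxes and superadditivity *)

Section boxes.
Variable d : nat.
Implicit Types (x v : Zd d) (D : {fset Zd d}).

Lemma mem_box n x : (x \in box d n) = [forall i, (0 <= x ord0 i < n%:Z)].
Proof.
apply/imfsetP/forallP => [[v /= _ ->] i|H].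
  by rewrite mxE lez_nat ltz_nat ltn_ord.
have H' i : (`|x ord0 i| < n)%N by have := H i; lia.
exists (\row_i Ordinal (H' i)) => //.
by apply/rowP => i; rewrite !mxE /=; have := H i; rewrite (ord1 0); lia.
Qed.

Lemma card_box n : #|` box d n| = (n ^ d)%N.
Proof.
rewrite /box card_imfset /=; last first.
  move=> u v /rowP uv; apply/rowP => i; have := uv i; rewrite !mxE => -[] ?.
  exact: val_inj.
by rewrite -cardE card_mx card_ord mul1n.
Qed.

Lemma box_sub m n : (m <= n)%N -> (box d m `<=` box d n)%fset.
Proof.
move=> mn; apply/fsubsetP => x; rewrite !mem_box => /forallP H.
by apply/forallP => i; have := H i; lia.
Qed.

Lemma zero_box n : (0 < n)%N -> (0 : Zd d) \in box d n.
Proof. by move=> n0; rewrite mem_box; apply/forallP => i; rewrite mxE; lia. Qed.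

Definition unit_step (i : 'I_d) : Zd d := delta_mx ord0 i.

Lemma unit_stepE i (j : 'I_d) : unit_step i ord0 j = (j == i)%:R.
Proof. by rewrite mxE eqxx. Qed.

Lemma box_pred n v : v \in box d n -> v != 0 ->
  exists i, v - unit_step i \in box d n.
Proof.
rewrite mem_box => /forallP H v0.
have [i vi] : exists i, v ord0 i != 0.
  apply/existsP; apply: contraNT v0; rewrite negb_exists => /forallP Hv.
  by apply/eqP/rowP => i; rewrite mxE; have := Hv i; rewrite negbK => /eqP.
exists i; rewrite mem_box; apply/forallP => j; rewrite !mxE eqxx /=.
by have := H j; case: (eqVneq j i) => [->|_]; have := H i; lia.
Qed.

Lemma d1_unit_step v i : d1 (v - unit_step i) v = 1%N.
Proof.
rewrite /d1 (bigD1 i)//= big1 ?addn0 => [|j ji]; rewrite !mxE eqxx/= ?eqxx.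
  by lia.
by rewrite (negbTE ji); lia.
Qed.

Definition l1 v : nat := (\sum_i `|v ord0 i|)%N.

Lemma l1_unit_step v i : 0 < v ord0 i -> (l1 (v - unit_step i) < l1 v)%N.
Proof.
move=> vi; rewrite /l1 (bigD1 i)//= [X in (_ < X)%N](bigD1 i)//=.
rewrite (eq_bigr (fun j => `|v ord0 j|%N)) => [|j ji].
  rewrite ltn_add2r.
  have -> : (v - unit_step i) ord0 i = v ord0 i - 1.
    by rewrite mxE [X in _ + X]mxE unit_stepE eqxx.
  by move: (v ord0 i) vi => z; lia.
by rewrite mxE [X in _ + X]mxE unit_stepE (negbTE ji) /= subr0.
Qed.

(* Growing [D0] to [D] one index at a time, in the order of the l1-norm. *)
Lemma growth (R : realType) (g : {fset Zd d} -> \bar R) (a : R) D0 D :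
  (D0 `<=` D)%fset -> (forall v i, v \in D -> 0 <= v ord0 i) ->
  (forall v, v \in D -> v \notin D0 -> exists2 i, 0 < v ord0 i & v - unit_step i \in D) ->
  (forall D' v i, v \in D -> v \notin D' -> v - unit_step i \in D' ->
    (D0 `<=` D')%fset -> (D' `<=` D)%fset -> (g D' + a%:E <= g (v |` D')%fset)%E) ->
  (g D0 + (a *+ #|` (D `\` D0)%fset|)%:E <= g D)%E.
Proof.
move nE : #|` (D `\` D0)%fset| => n.
elim: n D nE => [|n IH] D nE D0D pos pred step.
  have -> : D = D0.
    apply/eqP; rewrite eqEfsubset D0D andbT -fsetD_eq0.
    by rewrite -cardfs_eq0 nE.
  by rewrite mulr0n adde0.
(* The index to be added last has the largest norm: it cannot be the predecessor of another new
   index, so its removal preserves the hypotheses on [D]. *)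
have [v vD vmax] : exists2 v, v \in (D `\` D0)%fset &
    forall w, w \in (D `\` D0)%fset -> (l1 w <= l1 v)%N.
  have /fset0Pn[v0 v0D] : (D `\` D0)%fset != fset0.
    by rewrite -cardfs_eq0 nE.
  pose v1 : (D `\` D0)%fset := [arg max_(w > [` v0D]%fset) l1 (val w)].
  exists (val v1); first exact: valP.
  move=> w wD; rewrite /v1; case: arg_maxnP => //= u _ H.
  exact: (H [` wD]%fset).
have := vD; rewrite inE => /andP[vD0 vD1].
have [i vi viD] := pred v vD1 vD0.
have vnD x : x \in (D `\ v)%fset = (x != v) && (x \in D) by rewrite !inE.
have D0D' : (D0 `<=` D `\ v)%fset.
  apply/fsubsetP => x xD0; rewrite vnD (fsubsetP D0D)// andbT.
  by apply: contraNneq vD0 => <-.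
have l1lt := l1_unit_step vi.
have := IH (D `\ v)%fset; rewrite D0D'.
have -> : #|` ((D `\ v) `\` D0)%fset| = n.
  move: nE; rewrite (cardfsD1 v (D `\` D0)%fset) vD add1n => -[<-].
  by rewrite !fsetDDl fsetUC.
have pos' w j : w \in (D `\ v)%fset -> 0 <= w ord0 j.
  by rewrite vnD => /andP[_ wD]; exact: pos.
have pred' w : w \in (D `\ v)%fset -> w \notin D0 ->
    exists2 j, 0 < w ord0 j & w - unit_step j \in (D `\ v)%fset.
  rewrite vnD => /andP[wv wD] wD0; have [j wj wjD] := pred w wD wD0.
  exists j => //; rewrite vnD wjD andbT; apply: contraTneq (l1_unit_step wj) => ->.
  by rewrite -leqNgt vmax// inE wD0.
move=> /(_ erefl isT pos' pred')/(_ _)/wrap[].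
  move=> D' w j; rewrite vnD => /andP[_ wD] wD' wjD' D0D1 D1D.
  apply: step wjD' D0D1 _ => //; apply: fsubset_trans D1D _; exact: fsubD1set.
move=> {}IH; rewrite mulrS addrC EFinD addeA.
apply: (@le_trans _ _ (g (D `\ v)%fset + a%:E)%E); first by rewrite leeD2r.
rewrite -[X in (_ <= g X)%E](fsetD1K vD1).
apply: (step _ v i) D0D' (fsubD1set _ _) => //; first by rewrite vnD eqxx.
rewrite vnD viD andbT; apply: contraTneq l1lt => ->; by rewrite ltnn.
Qed.

Lemma box_pos n v i : v \in box d n -> 0 <= v ord0 i.
Proof. by rewrite mem_box => /forallP/(_ i)/andP[]. Qed.

Lemma box_pred_pos n v : v \in box d n -> v != 0 ->
  exists2 i, 0 < v ord0 i & v - unit_step i \in box d n.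
Proof.
move=> vB v0; have [i vi] := box_pred vB v0; exists i => //.
have := box_pos i vi; rewrite mxE [X in _ + X]mxE unit_stepE eqxx.
by move: (v ord0 i) => z; lia.
Qed.

Lemma cardfsD_sub D0 D : (D0 `<=` D)%fset ->
  #|` (D `\` D0)%fset| = (#|` D| - #|` D0|)%N.
Proof. by move=> D0D; rewrite cardfsD (fsetIidPr D0D). Qed.

Variable m : nat.
Hypothesis m0 : (0 < m)%N.

(** For [D] inside [box d n], the union of the boxes of side [m] with corners [v *+ m], [v] in [D].
    Floor division turns membership into integer arithmetic. *)
Definition tiles n D : {fset Zd d} :=
  [fset x in box d (m * n) | (\row_i (x ord0 i %/ m%:Z)%Z) \in D]%fset.

Lemma mem_tiles n D x : x \in tiles n D =
  (x \in box d (m * n)) && ((\row_i (x ord0 i %/ m%:Z)%Z) \in D).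
Proof. by rewrite !inE. Qed.

Lemma tiles_box n : tiles n (box d n) = box d (m * n).
Proof.
apply/fsetP => x; rewrite mem_tiles !mem_box.
case: forallP => //= H; apply/forallP => i; rewrite mxE.
have := H i; move: (x ord0 i) => z; nia.
Qed.

Lemma tiles0 n : (0 < n)%N -> tiles n [fset 0]%fset = box d m.
Proof.
move=> n0; apply/fsetP => x; rewrite mem_tiles !inE !mem_box.
apply/andP/forallP => [[/forallP H /eqP/rowP x0] i|H].
  have := H i; have := x0 i; rewrite !mxE; move: (x ord0 i) => z; nia.
split; first by apply/forallP => i; have := H i; move: (x ord0 i) => z; nia.
apply/eqP/rowP => i; rewrite !mxE; have := H i; move: (x ord0 i) => z; nia.
Qed.

Lemma tilesU1 n D v : v \in box d n ->
  tiles n (v |` D)%fset = (tiles n D `|` shift_fset (v *+ m) (box d m))%fset.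
Proof.
move=> vB; apply/fsetP => x; rewrite mem_tiles in_fset1U in_fsetU mem_tiles.
rewrite andb_orr orbC; congr orb.
rewrite mem_shift_fset; move: vB; rewrite !mem_box => /forallP vB.
apply/andP/forallP => [[/forallP H /eqP/rowP xv] i|H].
  have := H i; have := xv i; have := vB i; rewrite !mxE mulmxnE.
  by move: (x ord0 i) (v ord0 i) => z y; nia.
split.
  apply/forallP => i; have := H i; have := vB i; rewrite !mxE mulmxnE.
  by move: (x ord0 i) (v ord0 i) => z y; nia.
apply/eqP/rowP => i; have := H i; have := vB i; rewrite !mxE mulmxnE.
by move: (x ord0 i) (v ord0 i) => z y; nia.
Qed.

End boxes.

Lemma cvg_ratio1 (R : realType) (m d : nat) (x : nat -> nat) :
  (forall n, n <= x n + m /\ x n <= n + m)%N ->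
  ((x n)%:R ^+ d / n%:R ^+ d : R) @[n --> \oo] --> (1 : R).
Proof.
move=> xn.
suff H : ((x n)%:R / n%:R : R) @[n --> \oo] --> (1 : R).
  suff : ((x n)%:R / n%:R : R) ^+ d @[n --> \oo] --> (1 : R) ^+ d.
    by rewrite expr1n; under eq_fun do rewrite expr_div_n.
  exact: (continuous_cvg _ (@exprn_continuous R d 1) H).

apply/cvgrPdist_le => eps eps0; near=> n.
have n0 : (0 : R) < n%:R by near: n; exists 1%N => //= n; rewrite ltr0n.
have nm : m%:R / eps <= n%:R :> R by near: n; exact: nbhs_infty_ger.
have -> : 1 - (x n)%:R / n%:R = (n%:R - (x n)%:R) / n%:R :> R.
  by rewrite mulrBl divff// gt_eqF.
rewrite normrM normfV (gtr0_norm n0).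
rewrite ler_pdivrMr// (@le_trans _ _ m%:R)//; last by rewrite mulrC -ler_pdivrMr.
have [/= H1 H2] := xn n; rewrite ler_norml.
have {}H1 : n%:R <= (x n)%:R + m%:R :> R by rewrite -natrD ler_nat.
have {}H2 : (x n)%:R <= n%:R + m%:R :> R by rewrite -natrD ler_nat.
by apply/andP; split; lra.
Unshelve. all: by end_near. Qed.

(** One coordinate of the fact that [v *+ m - unit_step i], a neighbour of the corner of the tile of
    [v], lies in the tile of [v - unit_step i]; [b] tells whether the coordinate is [i]. The next
    lemma computes the tile index. *)
Lemma scaled_step_bound (z : int) (m n : nat) (b : bool) : (0 < m)%N ->
  0 <= z < n -> 0 <= z - b%:R -> 0 <= z *+ m - b%:R < (m * n)%N.
Proof.
move=> m0 /andP[z0 zn] zb; rewrite -mulr_natr natz.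
have A : 0 <= (z - b%:R) * m by apply: mulr_ge0.
have B : 0 <= (n%:Z - 1 - z) * m by apply: mulr_ge0 => //; lia.
by case: b zb A => /=; rewrite PoszM; lia.
Qed.

Lemma scaled_step_div (z : int) (m : nat) (b : bool) : (0 < m)%N ->
  ((z *+ m - b%:R) %/ m)%Z = z - b%:R.
Proof.
move=> m0; have -> : z *+ m - b%:R = (z - b%:R) * m%:Z + b%:R * (m%:Z - 1).
  by rewrite -mulr_natr natz mulrBl mulrBr mulr1; ring.
rewrite divzMDl ?divz_small ?addr0//; last by rewrite -lt0n.
by case: b => /=; lia.
Qed.

Lemma card_outer_boundary_box d n :
  (#|` outer_boundary (box d n)| <= (n + 2) ^ d - n ^ d)%N.
Proof.
(* The box enlarged by one layer on every side, which contains the outer boundary. *)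
pose B := shift_fset (\row__ (-1)) (box d (n + 2)).
have memB x : (x \in B) = [forall i, -1 <= x ord0 i < n%:Z + 1].
  rewrite mem_shift_fset mem_box; apply/forallP/forallP => H i; have := H i;
  by rewrite !mxE; move: (x ord0 i) => z; lia.
have cB : #|` B| = ((n + 2) ^ d)%N.
  by rewrite -(card_box d) card_imfset// => x y /addIr.
rewrite -cB -(card_box d n) -cardfsD_sub; last first.
  apply/fsubsetP => x; rewrite mem_box memB => /forallP H; apply/forallP => i.
  by have := H i; move: (x ord0 i) => z; lia.
apply: fsubset_leq_card; rewrite -(set_fsetK (B `\` box d n)%fset).
have sub : [set y | y \notin box d n /\ exists2 x, x \in box d n & d1 x y = 1%N] `<=`
    [set` (B `\` box d n)%fset].
  move=> y [yn [x xB xy]] /=; rewrite inE yn memB /=; apply/forallP => i.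
  move: xB; rewrite mem_box => /forallP/(_ i).
  have : (`|(x ord0 i - y ord0 i)%R| <= d1 x y)%N by rewrite /d1 (bigD1 i)//= leq_addr.
  rewrite xy.
  by move: (x ord0 i) (y ord0 i) => z t; lia.
have fin : finite_set [set` (B `\` box d n)%fset] by exact: finite_fset.
rewrite /outer_boundary -fset_set_sub//; exact: sub_finite_set sub fin.
Qed.

Lemma van_hove_box (R : realType) (d m : nat) : (0 < d)%N -> (0 < m)%N ->
  van_hove (fun j => box d (j.+1 * m)) R.
Proof.
move=> d0 m0.
have inf : (fun j => (j.+1 * m)%N) @ \oo --> \oo.
  apply/cvgnyPge => A; near=> j; apply: (@leq_trans j).
    by near: j; exact: nbhs_infty_ge.
  by rewrite (leq_trans (leqnSn j))// leq_pmulr.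
split.
  apply/cvgnyPge => A; near=> j; rewrite card_box.
  apply: (@leq_trans (j.+1 * m)); first by near: j; move/cvgnyPge : inf; apply.
  by rewrite -{1}(expn1 (j.+1 * m)) leq_pexp2l// muln_gt0.
pose f n := ((n + 2)%N%:R ^+ d / n%:R ^+ d - 1 : R).
have fj : f (j.+1 * m)%N @[j --> \oo] --> (0 : R).
  apply: (@cvg_comp _ _ _ (fun j => (j.+1 * m)%N) f _ \oo) => //.
  change (f @ \oo --> (0 : R)); rewrite -(subrr (1 : R)).
  apply: cvgB; last exact: cvg_cst.
  by apply: (@cvg_ratio1 _ 2 d (fun n => n + 2)%N) => n; split; lia.
apply: (@squeeze_cvgr _ _ _ _ (fun=> 0) (fun j => f (j.+1 * m)%N)) => //; last exact: cvg_cst.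
near=> j; rewrite mulr_ge0 ?invr_ge0//= card_box natrX /f.
set n := (j.+1 * m)%N; have n0 : (0 < n)%N by rewrite muln_gt0.
have nd : (0 : R) < n%:R ^+ d by rewrite exprn_gt0// ltr0n.
rewrite ler_pdivrMr// mulrBl divfK ?gt_eqF// mul1r -!natrX -natrB; last first.
  by rewrite leq_exp2r// leq_addr.
by rewrite ler_nat card_outer_boundary_box.
Unshelve. all: by end_near. Qed.

Lemma exprn_inv_cvg0 (R : realType) d : (0 < d)%N ->
  (n%:R ^- d : R) @[n --> \oo] --> (0 : R).
Proof.
move=> d0; apply/cvgrPdist_le => eps eps0; near=> n.
have n1 : (0 < n)%N by near: n; exact: nbhs_infty_gt.
have nd : (0 : R) < n%:R ^+ d by rewrite exprn_gt0// ltr0n.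
have ne : eps^-1 <= n%:R by near: n; exact: nbhs_infty_ger.
rewrite sub0r normrN gtr0_norm ?invr_gt0// -[leRHS]invrK lef_pV2 ?posrE ?invr_gt0//.
by rewrite (le_trans ne)// -natrX ler_nat -{1}(expn1 n) leq_pexp2l.
Unshelve. all: by end_near. Qed.

(** * Limits of almost superadditive set functions along boxes *)

Section fekete.
Variables (R : realType) (d N : nat) (L : set (Zd d)).
Hypotheses (d0 : (0 < d)%N) (N0 : (0 < N)%N).
Hypothesis LN : forall v : Zd d, L (v *+ N).
Variables (h : {fset Zd d} -> \bar R) (e : {fset Zd d} -> R) (c w : R).
Hypotheses (c0 : 0 <= c) (e0 : forall D, 0 <= e D).
Hypothesis hNy : forall D, (-oo < h D)%E.
Hypothesis h_shift : forall t D, L t -> D != fset0 -> h (shift_fset t D) = h D.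
Hypothesis h1 : forall x, (0 <= h [fset x]%fset)%E.
Hypothesis h_glue : forall D1 D2 x y, [disjoint D1 & D2]%fset -> x \in D1 ->
  y \in D2 -> d1 x y = 1%N ->
  (h D1 + h D2 - (c + e D2)%:E <= h (D1 `|` D2)%fset)%E.
Hypothesis e_shift : forall t D, L t -> e (shift_fset t D) = e D.
Hypothesis e1 : forall x, e [fset x]%fset <= w.

(** Sites are added singly: [h] is nonnegative on each, and each joining costs at most [c + w]. *)
Lemma grow_box n n' : (0 < n)%N -> (n <= n')%N ->
  (h (box d n) + (- (c + w) *+ (n' ^ d - n ^ d))%:E <= h (box d n'))%E.
Proof.
move=> n0 nn'; rewrite -!(card_box d) -cardfsD_sub; last exact: box_sub.
apply: growth => [|v i|v vn' vn|D' v i vB vD' viD' _ _].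
- exact: box_sub.
- exact: box_pos.
- by apply: box_pred_pos => //; apply: contraNneq vn => ->; exact: zero_box.
- have dis : [disjoint D' & [fset v]]%fset by rewrite fdisjointX1.
  rewrite fsetUC; apply: le_trans (h_glue dis viD' (fset11 v) (d1_unit_step v i)).
  apply: leeD; first by rewrite leeDl.
  by rewrite -EFinN lee_fin lerN2 lerD2l.
Qed.

(** Indices in [box d n] stand for tiles of side [m]. By invariance under [L] each new tile
    contributes [h (box d m)], and joining it costs [c + e (box d m)]. *)
Lemma grow_tiles j n (a : R) : (0 < n)%N ->
  (a%:E <= h (box d (j.+1 * N)) - (c + e (box d (j.+1 * N)))%:E)%E ->
  ((a *+ n ^ d)%:E <= h (box d (j.+1 * N * n)))%E.
Proof.
set m := (j.+1 * N)%N => n0 am; have m0 : (0 < m)%N by rewrite muln_gt0.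
have Lm v : L (v *+ m) by rewrite /m mulrnA; exact: LN.
rewrite -(tiles_box d m0).
have zB : ([fset 0] `<=` box d n)%fset by rewrite fsub1set zero_box.
apply: (@le_trans _ _ (h (tiles m n [fset 0%R]%fset) +
    (a *+ #|` (box d n `\` [fset 0%R])%fset|)%:E)%E).
  have -> : a *+ n ^ d = a + a *+ #|` (box d n `\` [fset 0])%fset|.
    rewrite -mulrS cardfsD_sub// card_box cardfs1 -addn1 subnK//.
    by rewrite expn_gt0 n0.
  (* The first tile pays no joining cost; it is still worth at least [a] because [c + e] is
     nonnegative. *)
  rewrite EFinD leeD2r// tiles0//; apply: le_trans am _.
  by rewrite leeBlDr// leeDl// lee_fin addr_ge0.
apply: (@growth d R (fun D => h (tiles m n D))) => // [v i|v vn|D' v i vB vD' viD' _ D'B].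
- exact: box_pos.
- by rewrite inE; exact: box_pred_pos.
- rewrite tilesU1//.
  have B0 : box d m != fset0 by apply/fset0Pn; exists 0; exact: zero_box.
  have vp l : 0 <= v ord0 l by exact: (box_pos l vB).
  have dis : [disjoint tiles m n D' & shift_fset (v *+ m) (box d m)]%fset.
    apply/fdisjointP => x; rewrite mem_tiles => /andP[_ xD'].
    apply: contra vD'; rewrite mem_shift_fset mem_box => /forallP H.
    rewrite (_ : v = \row_l (x ord0 l %/ m%:Z)%Z)//; apply/rowP => l; have := H l.
    rewrite !mxE mulmxnE !(ord1 0) ; have := vp l.
    by move: (x ord0 l) (v ord0 l) => z y; nia.
  have yS : v *+ m \in shift_fset (v *+ m) (box d m).
    by rewrite mem_shift_fset subrr zero_box.
  have viB := (fsubsetP D'B) _ viD'.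
  (* This point of an earlier tile and the corner [v *+ m] of the new one are the two neighbours
     through which the sets are joined. *)
  have xT : v *+ m - unit_step i \in tiles m n D'.
    rewrite mem_tiles; apply/andP; split.
      rewrite mem_box; apply/forallP => l; rewrite mxE mulmxnE [X in _ + X]mxE unit_stepE.
      have := box_pos l viB; move: vB; rewrite mem_box => /forallP/(_ l).
      by rewrite mxE [X in _ + X]mxE unit_stepE; exact: scaled_step_bound.
    rewrite (_ : \row__ _ = v - unit_step i)//; apply/rowP => l.
    rewrite mxE mxE mulmxnE [X in _ + X]mxE [RHS]mxE [X in _ = _ + X]mxE !unit_stepE.
    exact: scaled_step_div.
  have := h_glue dis xT yS (d1_unit_step _ _).
  rewrite h_shift// e_shift//; apply: le_trans.
  by rewrite -addeA leeD2l.
Qed.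

Hypothesis ecvg : (e (box d (j.+1 * N)) / (j.+1 * N)%:R ^+ d : R) @[j --> \oo] --> (0 : R).

Lemma box_lower n : (0 < n)%N -> ((- (c + w))%:E <= (n%:R ^- d)%:E * h (box d n))%E.
Proof.
move=> n0; have nd : (0 : R) < n%:R ^+ d by rewrite exprn_gt0// ltr0n.
rewrite lee_pdivlMl//.
have w0 : 0 <= w := le_trans (e0 _) (e1 0).
apply: le_trans (grow_box (ltn0Sn 0) n0).
have -> : box d 1 = [fset 0]%fset.
  apply/fsetP => x; rewrite mem_box inE; apply/forallP/eqP => [H|-> i].
    by apply/rowP => i; have := H i; rewrite mxE; move: (x ord0 i) => z; lia.
  by rewrite mxE.
rewrite -[X in (X <= _)%E]add0e; apply: leeD => //.
rewrite -EFinM lee_fin -[X in _ <= X]mulr_natr mulrN [X in _ <= X]mulNr lerN2 mulrC.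
rewrite ler_wpM2r ?addr_ge0//.
by rewrite exp1n -natrX ler_nat leq_subr.
Qed.

(** Only sides divisible by [N] occur, so that the corners of the tiles are vectors of [L]. *)
Definition fekete_lim := ereal_sup (range (fun j =>
  (((j.+1 * N)%:R ^- d)%:E *
   (h (box d (j.+1 * N)) - (c + e (box d (j.+1 * N)))%:E)))%E).

Lemma fekete_ge (b : R) : (b%:E < fekete_lim)%E ->
  \forall n \near \oo, (b%:E <= (n%:R ^- d)%:E * h (box d n))%E.
Proof.
move=> /ereal_sup_gt[_ [j _ <-]]; set m := (j.+1 * N)%N.
have m0 : (0 < m)%N by rewrite muln_gt0.
have md : (0 : R) < m%:R ^+ d by rewrite exprn_gt0// ltr0n.
rewrite lte_pdivlMl// => bm.
(* Since [h (box d m)] may be infinite, a real number [a] stands in for it in the tiling. *)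
have [a ba am] : exists2 a, b * m%:R ^+ d < a &
    (a%:E <= h (box d m) - (c + e (box d m))%:E)%E.
  move: bm; rewrite -EFinM mulrC.
  case: (h (box d m)) (hNy (box d m)) => [r _| _ _|//].
    rewrite -EFinN -EFinD lte_fin => ?; by exists (r - (c + e (box d m))).
  by exists (b * m%:R ^+ d + 1); rewrite ?ltrDl// leey.
(* Tiles fill the box whose side is the last multiple of [m] up to [n]; the sites left over form a
   vanishing fraction of the volume. *)
pose x n := (n %/ m * m)%N.
have xr : (x n)%:R ^+ d / n%:R ^+ d @[n --> \oo] --> (1 : R).
  apply: (@cvg_ratio1 _ m) => n; rewrite /x; split.
    by rewrite {1}(divn_eq n m) leq_add2l ltnW// ltn_mod.
  by rewrite (leq_trans (leq_trunc_div n m)) ?leq_addr.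
have lim : ((x n)%:R ^+ d / n%:R ^+ d * (a / m%:R ^+ d) -
    (c + w) * (1 - (x n)%:R ^+ d / n%:R ^+ d) : R) @[n --> \oo] --> a / m%:R ^+ d.
  rewrite -[X in _ --> X](_ : 1 * (a / m%:R ^+ d) - (c + w) * (1 - 1) = _); last first.
    by rewrite subrr mulr0 subr0 mul1r.
  apply: cvgB; first by apply: cvgM => //; exact: cvg_cst.
  by apply: cvgM; [exact: cvg_cst|apply: cvgB => //; exact: cvg_cst].
have ba' : b < a / m%:R ^+ d by rewrite ltr_pdivlMr.
near=> n.
have nm : (m <= n)%N by near: n; exact: nbhs_infty_ge.
have n0 : (0 < n)%N := leq_trans m0 nm.
have nd : (0 : R) < n%:R ^+ d by rewrite exprn_gt0// ltr0n.
have : b <= (x n)%:R ^+ d / n%:R ^+ d * (a / m%:R ^+ d) -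
    (c + w) * (1 - (x n)%:R ^+ d / n%:R ^+ d).
  by near: n; exact: (cvgr_ge _ lim).
rewrite lee_pdivlMl// -EFinM -lee_fin => H.
have xn0 : (0 < x n)%N by rewrite muln_gt0 m0 divn_gt0// nm.
have xn : (x n <= n)%N := leq_trunc_div n m.
apply: le_trans (grow_box xn0 xn).
apply: le_trans (leeD2r _ _); last first.
  have := @grow_tiles j (n %/ m) a; rewrite -/m mulnC; apply => //.
  by rewrite divn_gt0.
rewrite -EFinD lee_fin; move: H; rewrite lee_fin -(ler_pM2l nd).
move=> /le_trans; apply; rewrite le_eqVlt; apply/orP; left; apply/eqP.
rewrite -[a *+ _]mulr_natr -[- (c + w) *+ _]mulr_natr natrB; last first.
  by rewrite leq_exp2r.
rewrite !natrX /x natrM exprMn; field.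
by rewrite !gt_eqF.
Unshelve. all: by end_near. Qed.

(** Here [box d n] is enlarged, by single sites, to a box whose side is a multiple of [N]. There the
    supremum bounds [h] from above up to [c + e], and this error vanishes after division by the
    volume. *)
Lemma fekete_le (b : R) : (fekete_lim < b%:E)%E ->
  \forall n \near \oo, ((n%:R ^- d)%:E * h (box d n) <= b%:E)%E.
Proof.
have Hj j : (h (box d (j.+1 * N)) <= ((j.+1 * N)%:R ^+ d)%:E * fekete_lim +
    (c + e (box d (j.+1 * N)))%:E)%E.
  rewrite -leeBlDr// -lee_pdivrMl; last by rewrite exprn_gt0// ltr0n muln_gt0.
  by apply: ereal_sup_ubound; exists j.
have sNy : (-oo < fekete_lim)%E.
  apply: (@lt_le_trans _ _ (((1 * N)%:R ^- d)%:E * (h (box d (1 * N)) - (c + e (box d (1 * N)))%:E))%E).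
    case: (h _) (hNy (box d (1 * N))) => [r _|_|//]; first by rewrite -EFinM ltNyr.
    by rewrite addye// gt0_muley// lte_fin invr_gt0 exprn_gt0// ltr0n muln_gt0.
  by apply: ereal_sup_ubound; exists 0%N.
case sE : fekete_lim sNy Hj => [s| |]// _ Hj; rewrite lte_fin => sb.
pose x n := ((n %/ N).+1 * N)%N.
have xr : (x n)%:R ^+ d / n%:R ^+ d @[n --> \oo] --> (1 : R).
  apply: (@cvg_ratio1 _ N) => n; rewrite /x; split.
    by rewrite {1}(divn_eq n N) mulSn; have := ltn_pmod n N0; lia.
  by rewrite mulSn addnC leq_add2r leq_trunc_div.
have xe : e (box d (x n)) / (x n)%:R ^+ d @[n --> \oo] --> (0 : R).
  apply: (@cvg_comp _ _ _ (fun n => (n %/ N)%N)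
    (fun j => e (box d (j.+1 * N)) / (j.+1 * N)%:R ^+ d) _ \oo) => //.
  apply/cvgnyPge => A; near=> n; rewrite leq_divRL//.
  by near: n; exact: nbhs_infty_ge.
have ninv : (n%:R ^- d : R) @[n --> \oo] --> (0 : R) by exact: exprn_inv_cvg0.
have lim : ((x n)%:R ^+ d / n%:R ^+ d * s + c * n%:R ^- d +
    (e (box d (x n)) / (x n)%:R ^+ d) * ((x n)%:R ^+ d / n%:R ^+ d) +
    (c + w) * ((x n)%:R ^+ d / n%:R ^+ d - 1) : R) @[n --> \oo] --> s.
  rewrite -[X in _ --> X](_ : 1 * s + c * 0 + 0 * 1 + (c + w) * (1 - 1) = _); last first.
    by rewrite subrr !mulr0 mul0r !addr0 mul1r.
  apply: cvgD; last by apply: cvgM; [exact: cvg_cst|apply: cvgB => //; exact: cvg_cst].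
  apply: cvgD; last exact: cvgM.
  by apply: cvgD; apply: cvgM => //; exact: cvg_cst.
near=> n.
have n0 : (0 < n)%N by near: n; exact: nbhs_infty_gt.
have nd : (0 : R) < n%:R ^+ d by rewrite exprn_gt0// ltr0n.
have : (x n)%:R ^+ d / n%:R ^+ d * s + c * n%:R ^- d +
    (e (box d (x n)) / (x n)%:R ^+ d) * ((x n)%:R ^+ d / n%:R ^+ d) +
    (c + w) * ((x n)%:R ^+ d / n%:R ^+ d - 1) <= b.
  by near: n; exact: (cvgr_le _ lim).
rewrite lee_pdivrMl// -EFinM -lee_fin => H.
have xn : (n <= x n)%N.
  by rewrite /x {1}(divn_eq n N) mulSn; have := ltn_pmod n N0; lia.
have xd : (0 : R) < (x n)%:R ^+ d by rewrite exprn_gt0// ltr0n (leq_trans n0).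
have := le_trans (grow_box n0 xn) (Hj (n %/ N)%N); rewrite -/(x n).
rewrite -leeBrDr// => /le_trans; apply.
rewrite -EFinM -!EFinD lee_fin; move: H; rewrite lee_fin -(ler_pM2l nd).
apply: le_trans; rewrite le_eqVlt; apply/orP; left; apply/eqP.
rewrite -[- (c + w) *+ _]mulr_natr natrB; last by rewrite leq_exp2r.
by rewrite !natrX; field; rewrite !gt_eqF.
Unshelve. all: by end_near. Qed.

Lemma fekete_cvg : (fun n => (n%:R ^- d)%:E * h (box d n))%E @ \oo --> fekete_lim.
Proof.
have sNy : (-oo < fekete_lim)%E.
  apply: (@lt_le_trans _ _ (- (c + w) - 1)%:E); first exact: ltNyr.
  rewrite leNgt; apply/negP => /fekete_le H.
  have [n [H1 n0]] : exists n, ((n%:R ^- d)%:E * h (box d n) <= (- (c + w) - 1)%:E)%E /\ (0 < n)%N.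
    near \oo => n; exists n; split; first by near: n.
    by near: n; exact: nbhs_infty_gt.
  by have := le_trans (box_lower n0) H1; rewrite lee_fin; lra.
case sE : fekete_lim sNy => [s| |]// _; last first.
  by apply/cvgeyPge => b; apply: fekete_ge; rewrite sE ltry.
have ge eps : 0 < eps -> \forall n \near \oo, ((s - eps)%:E <= (n%:R ^- d)%:E * h (box d n))%E.
  by move=> eps0; apply: fekete_ge; rewrite sE lte_fin gtrBl.
have le eps : 0 < eps -> \forall n \near \oo, ((n%:R ^- d)%:E * h (box d n) <= (s + eps)%:E)%E.
  by move=> eps0; apply: fekete_le; rewrite sE lte_fin ltrDl.
apply/fine_cvgP; split.
  near=> n; rewrite fin_numElt; apply/andP; split.
    by apply: lt_le_trans (ltNyr (s - 1)) _; near: n; exact: ge.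
  by apply: le_lt_trans (ltry (s + 1)); near: n; exact: le.
apply/cvgrPdist_le => eps eps0; near=> n.
have : ((s - eps)%:E <= (n%:R ^- d)%:E * h (box d n))%E by near: n; exact: ge.
have : ((n%:R ^- d)%:E * h (box d n) <= (s + eps)%:E)%E by near: n; exact: le.
move=> /=; case: (_ * _)%E => [r| |]//; rewrite !lee_fin /= ler_norml => H1 H2.
by apply/andP; split; lra.
Unshelve. all: by end_near. Qed.

End fekete.

(** By the adjugate matrix, [|det M|] times any integer vector is an integer combination of the rows
    of [M]. *)
Lemma lattice_multiple d (L : set (Zd d)) : full_rank_sublattice L ->
  exists2 N : nat, (0 < N)%N & forall v : Zd d, L (v *+ N).
Proof.
move=> [M M0 ->]; exists `|\det M|%N; first by rewrite absz_gt0.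
move=> v; exists (Num.sg (\det M) *: (v *m \adj M)) => //.
rewrite -scalemxAl -mulmxA mul_adj_mx mul_mx_scalar scalerA -normrEsg.
by rewrite -abszE -scaler_nat natz.
Qed.

(** * Slopes forced by the Lipschitz constraint *)

Section slopes.
Variables (R : realType) (d : nat).
Implicit Types (psi : Zd d -> R).

Lemma path_increment psi (q : Zd d -> Zd d -> R) x p :
  (forall u v, (u, v) \in zip (x :: p) p -> psi v - psi u <= q u v) ->
  psi (last x p) - psi x <= \sum_(e <- zip (x :: p) p) q e.1 e.2.
Proof.
elim: p x => [|y p IH] x H; first by rewrite /= subrr big_nil.
rewrite [zip _ _]/= big_cons -[psi (last _ _)](subrK (psi y)) -addrA addrC.
apply: lerD; first by apply: H; rewrite in_cons eqxx.
by apply: IH => u v uv; apply: H; rewrite in_cons uv orbT.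
Qed.

Lemma path_increment_rev psi (q : Zd d -> Zd d -> R) x p :
  (forall u v, (u, v) \in zip (x :: p) p -> psi u - psi v <= q v u) ->
  psi x - psi (last x p) <= \sum_(e <- zip (x :: p) p) q e.2 e.1.
Proof.
move=> H; have := @path_increment (fun x => - psi x) (fun u v => q v u) x p.
rewrite opprK addrC; apply => u v uv.
by rewrite opprK addrC; exact: H.
Qed.

Lemma path_zip (A : rel (Zd d)) x p u v : path A x p -> (u, v) \in zip (x :: p) p -> A u v.
Proof.
elim: p x => [|y p IH] x //= /andP[xy yp]; rewrite in_cons => /orP[/eqP[-> ->]//|].
exact: IH.
Qed.

Lemma unit_steps_lipschitz psi (K : R) :
  (forall x i, `|psi (x + unit_step i) - psi x| <= K) ->
  forall x y, `|psi y - psi x| <= K * (d1 x y)%:R.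
Proof.
move=> H x y; move nE : (d1 x y) => n; elim: n y nE => [|n IH] y xy.
  suff -> : y = x by rewrite subrr normr0 mulr0.
  apply/rowP => i; move: xy; rewrite /d1 => /eqP; rewrite sum_nat_eq0 => /forallP/(_ i).
  by rewrite !(ord1 0); move: (x ord0 i) (y ord0 i) => a b; lia.
have [i xyi] : exists i, x ord0 i != y ord0 i.
  apply/existsP; apply: contra_eqT xy; rewrite negb_exists => /forallP E.
  rewrite /d1 big1// => j _; have := E j; rewrite negbK => /eqP ->.
  by rewrite subrr.
have step (z : Zd d) : z ord0 i + 1 = y ord0 i \/ z ord0 i = y ord0 i + 1 ->
    (forall j, j != i -> z ord0 j = y ord0 j) -> `|psi y - psi z| <= K.
  move=> zi zj; case: zi => zi.
    have -> : y = z + unit_step i; last exact: H.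
    apply/rowP => j; rewrite mxE unit_stepE; case: eqVneq => [->|ji].
      by rewrite -zi.
    by rewrite addr0 zj.
  rewrite distrC; have -> : z = y + unit_step i; last exact: H.
  apply/rowP => j; rewrite mxE unit_stepE; case: eqVneq => [->|ji].
    by rewrite zi.
  by rewrite addr0 zj.
have fin (z : Zd d) : `|psi y - psi z| <= K -> d1 x z = n -> `|psi y - psi x| <= K * n.+1%:R.
  move=> yz /IH zx; rewrite -(subrK (psi z) (psi y)) -addrA.
  by rewrite (le_trans (ler_normD _ _))// mulrS mulrDr mulr1 lerD.
have d1z (z : Zd d) : (`|x ord0 i - z ord0 i| + 1 = `|x ord0 i - y ord0 i|)%N ->
    (forall j, j != i -> z ord0 j = y ord0 j) -> d1 x z = n.
  move=> zi zj; apply: succn_inj; rewrite -xy /d1 (bigD1 i)//= [RHS](bigD1 i)//= -zi.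
  by rewrite addn1 addSn; congr (_ + _).+1; apply: eq_bigr => j ji; rewrite zj.
case: (ltP (x ord0 i) (y ord0 i)) => lt.
  have sE j : (y - unit_step i) ord0 j = y ord0 j - (j == i)%:R.
    by rewrite mxE [X in _ + X]mxE unit_stepE.
  apply: (fin (y - unit_step i)).
    apply: step => [|j ji]; rewrite sE ?eqxx.
      by left; rewrite subrK.
    by rewrite (negbTE ji) subr0.
  apply: d1z => [|j ji]; rewrite sE ?eqxx.
    by move: (x ord0 i) (y ord0 i) lt => a b; lia.
  by rewrite (negbTE ji) subr0.
apply: (fin (y + unit_step i)).
  apply: step => [|j ji]; rewrite mxE unit_stepE ?eqxx; first by right.
  by rewrite (negbTE ji) addr0.
apply: d1z => [|j ji]; rewrite mxE unit_stepE ?eqxx.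
  by move: (x ord0 i) (y ord0 i) lt xyi => a b; lia.
by rewrite (negbTE ji) addr0.
Qed.

(** For each residue modulo [N] and each direction, fix a path of [A] along the corresponding unit
    step. Every unit step is a translate of one of these finitely many, so the total cost of the
    paths bounds all slopes, and one finite box, with its translates, sees all edges involved. *)
Lemma slope_bound_exists (L : set (Zd d)) (A : rel (Zd d)) (q : Zd d -> Zd d -> R)
    (N : nat) : (0 < N)%N -> (forall v : Zd d, L (v *+ N)) ->
  admissible_graph L A -> (forall t x y, L t -> q (x + t) (y + t) = q x y) ->
  exists2 K : R, 1 <= K & exists n0 : nat, forall psi,
    (forall u v t, A u v -> u \in box d n0 -> v \in box d n0 ->
      psi (v + t *+ N) - psi (u + t *+ N) <= q u v) ->
    forall x y, `|psi y - psi x| <= K * (d1 x y)%:R.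
Proof.
move=> N0 LN [symA _ AL conn _] qL.
have /choice[p pP] (z : Zd d * 'I_d) : exists p : seq (Zd d),
    path A z.1 p /\ last z.1 p = z.1 + unit_step z.2.
  by have [p ? ?] := conn z.1 (z.1 + unit_step z.2); exists p.
pose es z := zip (z.1 :: p z) (p z).
pose cost z : R := \sum_(e <- es z) (`|q e.1 e.2| + `|q e.2 e.1|).
pose zs := [seq (r, i) | r <- enum_fset (box d N), i <- enum 'I_d].
pose T := (\max_(z <- zs) \max_(e <- es z) (l1 e.1 + l1 e.2))%N.
have cost0 z : 0 <= cost z by apply: sumr_ge0 => e _; rewrite addr_ge0.
exists (1 + \sum_(z <- zs) cost z); first by rewrite lerDl sumr_ge0.
(* Path vertices have coordinates of modulus at most [T]; translated by [T * N] in every coordinate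
   they lie between 0 and [T + T * N]. *)
pose n0 := (T + T * N).+1%N; exists n0 => psi H.
have mem_es z e : z \in zs -> e \in es z ->
    (e.1 + const_mx T%:Z *+ N \in box d n0) && (e.2 + const_mx T%:Z *+ N \in box d n0).
  move=> zz ee; have eT : (l1 e.1 + l1 e.2 <= T)%N.
    apply: leq_trans (leq_bigmax_seq _ zz isT).
    exact: (@leq_bigmax_seq _ _ xpredT (fun e => l1 e.1 + l1 e.2)%N e ee isT).
  have cT (v : Zd d) : (l1 v <= T)%N -> v + const_mx T%:Z *+ N \in box d n0.
    move=> vT; rewrite mem_box; apply/forallP => i; rewrite mxE mulmxnE mxE.
    have : (`|v ord0 i| <= T)%N.
      by rewrite (leq_trans _ vT)// /l1 (bigD1 i)//= leq_addr.
    have : (T <= T * N)%N by rewrite leq_pmulr.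
    rewrite /n0 -mulr_natr natz -PoszM.
    by move: (v ord0 i) => a; lia.
  by rewrite !cT//; rewrite (leq_trans _ eT) ?leq_addr ?leq_addl.
have tE (u t : Zd d) : u + const_mx T%:Z *+ N + (t - const_mx T%:Z) *+ N = u + t *+ N.
  by rewrite -addrA -mulrnDl addrCA subrr addr0.
have edge z t u v : z \in zs -> (u, v) \in es z -> A u v ->
    psi (v + t *+ N) - psi (u + t *+ N) <= q u v.
  move=> zz ee uv; have /andP[/= uB vB] := mem_es _ _ zz ee.
  have := H (u + const_mx T%:Z *+ N) (v + const_mx T%:Z *+ N) (t - const_mx T%:Z).
  by rewrite AL// qL// !tE; apply.
have edge' z t u v : z \in zs -> (u, v) \in es z -> A u v ->
    psi (u + t *+ N) - psi (v + t *+ N) <= q v u.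
  move=> zz ee uv; have /andP[/= uB vB] := mem_es _ _ zz ee.
  have := H (v + const_mx T%:Z *+ N) (u + const_mx T%:Z *+ N) (t - const_mx T%:Z).
  rewrite AL// qL// !tE; apply => //.
  by rewrite symA.
apply: unit_steps_lipschitz => x i.
(* Division with remainder moves the step at [x] to the step at the representative [r]. *)
pose t : Zd d := \row_j (x ord0 j %/ N%:Z)%Z; pose r : Zd d := \row_j (x ord0 j %% N%:Z)%Z.
have xE : x = r + t *+ N.
  apply/rowP => j; rewrite mxE mulmxnE !mxE addrC -mulr_natr natz !(ord1 0).
  exact: divz_eq.
have zz : (r, i) \in zs.
  apply/allpairsP; exists (r, i); split => //=; last by rewrite mem_enum.
  rewrite -[_ \in _]/(r \in box d N) mem_box; apply/forallP => j; rewrite mxE.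
  by rewrite modz_ge0 ?ltz_pmod// -lt0n.
have [/= pA pl] := pP (r, i).
have costle : cost (r, i) <= \sum_(z <- zs) cost z.
  by rewrite (big_rem _ zz)/= lerDl sumr_ge0.
have xiE : last r (p (r, i)) + t *+ N = x + unit_step i by rewrite pl xE addrAC.
have sumle (f : Zd d * Zd d -> R) : (forall e, f e <= `|q e.1 e.2| + `|q e.2 e.1|) ->
    \sum_(e <- es (r, i)) f e <= 1 + \sum_(z <- zs) cost z.
  move=> fq; rewrite -[leLHS]add0r lerD//; apply: le_trans costle.
  by apply: ler_sum.
rewrite ler_norml; apply/andP; split.
  rewrite lerNl opprB -xiE {1}xE.
  apply: le_trans (@path_increment_rev (fun y => psi (y + t *+ N)) q _ _ _) (sumle _ _).
    by move=> u v uv; apply: edge' zz uv (path_zip pA uv).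
  by move=> e; rewrite (le_trans (ler_norm _))// lerDr.
rewrite -xiE {1}xE.
apply: le_trans (@path_increment (fun y => psi (y + t *+ N)) q _ _ _) (sumle _ _).
  by move=> u v uv; apply: edge zz uv (path_zip pA uv).
by move=> e; rewrite (le_trans (ler_norm _))// lerDl.
Qed.
End slopes.

(** * Free energies of large boxes as suprema over tests *)

Section link.
Variables (R : realType) (k : height_kind) (d : nat).
Variables (L : set (Zd d)) (Psi Xi Phi : potential R k d).
Variables (A : rel (Zd d)) (q : Zd d -> Zd d -> R) (K : R) (N n0 : nat).
Hypotheses (LN : forall v : Zd d, L (v *+ N)).
Hypothesis PsiP : periodic_gradient_potential L Psi.
Hypothesis Psi_ge0 : forall Lam phi, (0 <= Psi Lam phi)%E.
Hypothesis XiP : periodic_gradient_potential L Xi.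
Hypothesis Xi_norm : (potential_norm Xi < +oo)%E.
Hypothesis PhiE : forall Lam phi, Phi Lam phi = (Psi Lam phi + Xi Lam phi)%E.
Hypothesis lipP : lipschitz_potential A q Psi.
Hypothesis slopeP : forall psi : Zd d -> R,
    (forall u v t, A u v -> u \in box d n0 -> v \in box d n0 ->
      psi (v + t *+ N) - psi (u + t *+ N) <= q u v) ->
    forall x y, `|psi y - psi x| <= K * (d1 x y)%:R.

Lemma energy_infinite Lam phi u v : A u v -> u \in Lam -> v \in Lam ->
  q u v < height_val (height_sub (phi v) (phi u)) -> energy Phi Lam phi = +oo%E.
Proof.
move=> uv uL vL quv.
have uvP : [fset u; v]%fset \in fpowerset Lam.
  by rewrite fpowersetE; apply/fsubsetP => w; rewrite !inE => /orP[]/eqP->.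
rewrite /energy (big_rem _ uvP)/=.
have -> : Phi [fset u; v]%fset phi = +oo%E.
  rewrite PhiE (_ : Psi _ _ = +oo%E); last by apply/lipP; exists u, v.
  by rewrite addye// gt_eqF// ltNye; case: XiP => _ + _ _; apply.
rewrite addye//; elim/big_ind: _ => // [a b|G _].
  by rewrite adde_eq_ninfty negb_or => -> ->.
exact: (PhiN Psi_ge0 XiP PhiE).
Qed.

Lemma measurable_energy_setT Lam :
  measurable_fun setT (energy Phi Lam : grad_space R k setT -> \bar R).
Proof.
apply: measurable_fun_grad_mono (@measurable_energy R k d L Psi Xi Phi PsiP XiP PhiE Lam).
by [].
Qed.

Lemma measurable_energy_infinite Lam :
  measurable ([set phi | energy Phi Lam phi = +oo%E] : set (grad_space R k setT)).
Proof.
have := @measurable_energy_setT Lam measurableT [set +oo%E] (emeasurable_set1 _).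
by rewrite setTI.
Qed.

Lemma energy_infinite_null Lam (mu : grad_prob R k d) :
  (\int[mu]_phi energy Phi Lam phi < +oo)%E ->
  mu [set phi | energy Phi Lam phi = +oo%E] = 0%E.
Proof.
move=> fin; have [b Wb] := energy_ge Psi_ge0 XiP Xi_norm PhiE Lam.
have mE := @measurable_energy_setT Lam.
have aeWb : {ae mu, forall phi, (cst (- b)%:E phi <= energy Phi Lam phi)%E}.
  by apply: aeW => phi; exact: Wb.
have [neg _] := @integral_ge_integrable _ _ _ mu (cst (- b)%:E) _
  (finite_measure_integrable_cst mu (- b) measurableT) mE aeWb.
have pos : (\int[mu]_phi (energy Phi Lam)^\+ phi < +oo)%E.
  move: fin; rewrite integralE.
  case: (\int[mu]_x (energy Phi Lam)^\+ x)%E => [r _| |]; rewrite ?ltry ?ltNyr//.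
  rewrite addye//; apply/eqP => H.
  by move: neg; rewrite -[X in (X < _)%E]oppeK H.
have := integrable_ae measurableT (integrable_of_parts mE pos neg).
move=> [B [mB B0 sB]]; apply: (subset_measure0 _ mB _ B0).
  exact: measurable_energy_infinite.
by move=> phi /= Einf; apply: sB => /= /(_ I); rewrite Einf.
Qed.

(** A finite mean makes the energy of the box finite almost surely. By invariance the same holds at
    once for its countably many translates by multiples of [N], and together these contain all edges
    that [slopeP] asks for. *)
Lemma slope_set_full n mu : invariant_grad_prob L mu -> (n0 <= n)%N ->
  (\int[mu]_phi energy Phi (box d n) phi < +oo)%E ->
  mu (~` slope_set K (box d n)) = 0%E.
Proof.
move=> muP nn fin; pose B := [set phi : Omega R k d | energy Phi (box d n) phi = +oo%E].
have mB : measurable (B : set (grad_space R k setT)).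
  exact: measurable_energy_infinite.
have B0 : mu B = 0%E by exact: energy_infinite_null.
pose F i : set (Omega R k d) := if (@choice.unpickle (Zd d) i : option (Zd d)) is Some t then
  shift_height (R := R) (k := k) ((t : Zd d) *+ N) @^-1` B else set0.
have F0 : mu.-negligible (\bigcup_i (F i : set (grad_space R k setT))).
  apply: negligible_bigcup => i; rewrite /F; case: choice.unpickle => [t|]; last exact: negligible_set0.
  have mt : measurable_fun setT (shift_height (t *+ N) :
      grad_space R k setT -> grad_space R k setT) by exact: measurable_shift_height.
  apply/negligibleP; first by rewrite -[X in measurable X]setTI; exact: mt.
  have [_ inv] := muP.
  exact: etrans (inv (t *+ N) (LN t) B mB) B0.
apply/negligibleP.
  apply: measurableC; apply: grad_space_sub; exact: (@measurable_slope_set R k d K (box d n)).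
apply: negligibleS F0 => phi; rewrite /= => nS; apply: contrapT => nF; apply: nS.
move=> x y _ _; rewrite height_valB.
apply: (slopeP (psi := fun x => height_val (phi x))) => u v t uv uB vB.
rewrite leNgt; apply/negP => lt; apply: nF.
exists (choice.pickle t) => //; rewrite /F choice.pickleK /B /=.
have nnB w : w \in box d n0 -> w \in box d n by move/(fsubsetP (box_sub d nn)).
apply: (energy_infinite uv (nnB _ uB) (nnB _ vB)).
by rewrite height_valB.
Qed.

(** The size condition enters through [slope_set_full], which supplies the last hypothesis of
    [relative_entropy_tilted]. *)
Lemma free_energy_dv n mu : invariant_grad_prob L mu -> (n0 <= n)%N ->
  free_energy Phi (box d n) mu = dv Phi K (box d n) mu.
Proof.
move=> muP nn; rewrite /free_energy dv_tilted_sup.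
have [b Wb] := energy_ge Psi_ge0 XiP Xi_norm PhiE (box d n).
have mE := @measurable_energy R k d L Psi Xi Phi PsiP XiP PhiE (box d n).
rewrite -(relative_entropy_tilted (b := b)) //.
- congr (dual_adde _ _); rewrite integral_grad_restriction//.
  by apply: eq_integral => phi _; exact: energyE PsiP Psi_ge0 XiP PhiE _ _.
- exact: (@measurable_slope_set R k d K (box d n)).
- exact: grad_ref_measure_slope_set.
- by rewrite integral_grad_restriction// => fin; exact: slope_set_full.
Qed.

End link.

Lemma adde_def_scaled (R : realType) (a b : R) (x y : \bar R) : 0 <= a -> 0 <= b ->
  (-oo < x)%E -> (-oo < y)%E -> (a%:E * x +? b%:E * y)%E.
Proof.
have H (r : R) (z : \bar R) : 0 <= r -> (-oo < z)%E -> (r%:E * z)%E != -oo%E.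
  move=> r0; case: z => [s _|_|//]; first by rewrite -EFinM.
  by rewrite -ltNye; apply: lt_le_trans (mule_ge0 _ (leey 0)); rewrite ?ltNyr ?lee_fin.
move=> a0 b0 x0 y0.
by rewrite /adde_def !(negbTE (H _ _ _ _)) ?andbF.
Qed.

(** * The specific free energy *)

Section thermodynamic_limit.
Variables (R : realType) (k : height_kind) (d : nat).
Variables (L : set (Zd d)) (Psi Xi Phi : potential R k d).
Variables (A : rel (Zd d)) (q : Zd d -> Zd d -> R) (K : R) (N n0 : nat).
Hypotheses (d0 : (0 < d)%N) (N0 : (0 < N)%N).
Hypotheses (LN : forall v : Zd d, L (v *+ N)) (K1 : 1 <= K).
Hypothesis PsiP : periodic_gradient_potential L Psi.
Hypothesis Psi_ge0 : forall Lam phi, (0 <= Psi Lam phi)%E.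
Hypothesis XiP : periodic_gradient_potential L Xi.
Hypothesis Xi_norm : (potential_norm Xi < +oo)%E.
Hypothesis Xi_amenable : amenable L (lower_exterior_bound Xi).
Hypothesis PhiE : forall Lam phi, Phi Lam phi = (Psi Lam phi + Xi Lam phi)%E.
Hypothesis lipP : lipschitz_potential A q Psi.
Hypothesis slopeP : forall psi : Zd d -> R,
    (forall u v t, A u v -> u \in box d n0 -> v \in box d n0 ->
      psi (v + t *+ N) - psi (u + t *+ N) <= q u v) ->
    forall x y, `|psi y - psi x| <= K * (d1 x y)%:R.
Implicit Types mu nu : grad_prob R k d.

Let e Lam := fine (lower_exterior_bound Xi Lam).
Let c := ln (fine (ref_measure R k (height_ball K))).

Let c0 : 0 <= c.
Proof.
rewrite ln_ge0// -lee_fin fineK ?ref_measure_ball_ge1//.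
by rewrite ge0_fin_numE ?measure_ge0// ref_measure_ball_fin.
Qed.

Let e0 Lam : 0 <= e Lam.
Proof. exact/fine_ge0/lower_exterior_bound_ge0. Qed.

Let e1 x : e [fset x]%fset <= xi_norm Xi.
Proof.
rewrite -lee_fin fineK; first exact: lower_exterior_bound1.
exact: (lower_exterior_bound_fin Xi_norm _ Xi_amenable).
Qed.

Let e_shift t Lam : L t -> e (shift_fset t Lam) = e Lam.
Proof. by move=> Lt; case: Xi_amenable => _ inv _ _; rewrite /e inv. Qed.

Let e_cvg : e (box d (j.+1 * N)) / (j.+1 * N)%:R ^+ d @[j --> \oo] --> (0 : R).
Proof.
case: Xi_amenable => _ _ _ /(_ _ (van_hove_box R d0 N0)) /fine_cvgP[_].
apply: cvg_trans; apply: near_eq_cvg; apply: nearW => j /=.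
rewrite fineM//; first by rewrite card_box natrX.
exact: (lower_exterior_bound_fin Xi_norm _ Xi_amenable).
Qed.

Let h_shift mu : invariant_grad_prob L mu -> forall t Lam, L t -> Lam != fset0 ->
  dv Phi K (shift_fset t Lam) mu = dv Phi K Lam mu.
Proof. by move=> muP t Lam Lt Lam0; exact: (dv_shift PsiP XiP PhiE K muP Lt Lam0). Qed.

Let h_glue mu Lam Del x y : [disjoint Lam & Del]%fset -> x \in Lam -> y \in Del ->
  d1 x y = 1%N -> (dv Phi K Lam mu + dv Phi K Del mu - (c + e Del)%:E <=
    dv Phi K (Lam `|` Del)%fset mu)%E.
Proof.
exact: (dv_glue PsiP Psi_ge0 XiP Xi_norm PhiE K1 mu Xi_amenable).
Qed.

Definition dv_lim mu := fekete_lim N (fun Lam => dv Phi K Lam mu) e c.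

Lemma dv_box_cvg mu : invariant_grad_prob L mu ->
  ((n%:R ^- d)%:E * dv Phi K (box d n) mu)%E @[n --> \oo] --> dv_lim mu.
Proof.
move=> muP; apply: (@fekete_cvg R d N L d0 N0 LN _ e c (xi_norm Xi)) => //.
- by move=> D; exact: (dv_gtNy PsiP Psi_ge0 XiP Xi_norm PhiE).
- exact: h_shift.
- by move=> x; exact: (dv_single PsiP XiP PhiE).
- by move=> *; apply: h_glue; eassumption.
Qed.

Lemma box_free_energy_cvg mu : invariant_grad_prob L mu ->
  box_free_energy Phi mu @ \oo --> dv_lim mu.
Proof.
move=> muP; apply: cvg_trans (dv_box_cvg muP).
apply: near_eq_cvg; near=> n; rewrite /box_free_energy.
congr (_ * _)%E; apply/esym.
apply: (free_energy_dv LN PsiP Psi_ge0 XiP Xi_norm PhiE lipP slopeP muP).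
by near: n; exact: nbhs_infty_ge.
Unshelve. all: by end_near. Qed.

Lemma specific_free_energyE mu : invariant_grad_prob L mu ->
  specific_free_energy Phi mu = dv_lim mu.
Proof. by move=> muP; apply/cvg_lim => //; exact: box_free_energy_cvg. Qed.

Lemma dv_lim_ge mu : invariant_grad_prob L mu -> ((- (c + xi_norm Xi))%:E <= dv_lim mu)%E.
Proof.
move=> muP; rewrite -specific_free_energyE// /specific_free_energy.
have cvg := dv_box_cvg muP.
rewrite [limn _](specific_free_energyE muP) -(cvg_lim (@ereal_hausdorff R) cvg).
apply: lime_ge; first by apply/cvg_ex; exists (dv_lim mu).
near=> n; apply: (@box_lower R d N d0 N0 (fun Lam => dv Phi K Lam mu) e) => //.
- by move=> x; exact: (dv_single PsiP XiP PhiE).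
- by move=> *; apply: h_glue; eassumption.
- by near: n; exact: nbhs_infty_gt.
Unshelve. all: by end_near. Qed.

Lemma mixture_invariant (t : {i01 R}) mu nu : invariant_grad_prob L mu ->
  invariant_grad_prob L nu -> invariant_grad_prob L (mixture t mu nu).
Proof.
move=> [mu0 muL] [nu0 nuL]; split => [B nB|x Lx B mB].
  by apply: etrans (mixtureE t mu nu B) _; rewrite mu0// nu0// !mule0 adde0.
apply: etrans (mixtureE t mu nu _) _; rewrite muL// nuL//.
exact/esym/mixtureE.
Qed.

(** For [t] equal to 0 or 1, where division is impossible, every test has the same mean under the
    mixture as under one component, and the other term is zero even if its [dv] is infinite. *)
Lemma dv_mixture_ge' Lam (t : {i01 R}) mu nu :
  ((t%:num)%:E * dv Phi K Lam mu + (1 - t%:num)%:E * dv Phi K Lam nu <=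
   dv Phi K Lam (mixture t mu nu) + (ln 2)%:E)%E.
Proof.
have l2 : (0 <= (ln 2 : R)%:E)%E by rewrite lee_fin ln_ge0// ler1n.
have [t0|t1|tb] : [\/ t%:num = 0 :> R, t%:num = 1 :> R | 0 < (t%:num : R) < 1].
  have : 0 <= (t%:num : R) by []; have : (t%:num : R) <= 1 by [].
  rewrite le_eqVlt => /orP[/eqP ?|?]; first by constructor 2.
  rewrite le_eqVlt => /orP[/eqP ?|?]; [by constructor 1|].
  by constructor 3; exact/andP.
- rewrite t0 mul0e add0e subr0 mul1e; apply: le_trans (leeDl _ l2).
  apply: ge_ereal_sup => _ [g tg <-].
  have [_ [M gM] _] := tg.
  apply: le_trans (dv_test_ub (mixture t mu nu) tg).
  by rewrite (integral_mixture t mu nu (dv_test_measurable tg) gM) t0 mul0e add0e subr0 mul1e.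
- rewrite t1 subrr mul0e adde0 mul1e; apply: le_trans (leeDl _ l2).
  apply: ge_ereal_sup => _ [g tg <-].
  have [_ [M gM] _] := tg.
  apply: le_trans (dv_test_ub (mixture t mu nu) tg).
  by rewrite (integral_mixture t mu nu (dv_test_measurable tg) gM) t1 subrr mul0e adde0 mul1e.
- exact: (dv_mixture_ge PsiP Psi_ge0 XiP Xi_norm PhiE).
Qed.

Lemma dv_lim_mixture (t : {i01 R}) mu nu : invariant_grad_prob L mu ->
  invariant_grad_prob L nu -> dv_lim (mixture t mu nu) =
  ((t%:num)%:E * dv_lim mu + (1 - t%:num)%:E * dv_lim nu)%E.
Proof.
move=> muP nuP; have mixP := mixture_invariant t muP nuP.
set s := (_ + _)%E.
have ninv : ((ln 2 * n%:R ^- d)%:E : \bar R) @[n --> \oo] --> 0%E.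
  apply: cvg_EFin; first exact: nearW.
  rewrite -(mulr0 (ln 2)); apply: cvgM; [exact: cvg_cst|exact: exprn_inv_cvg0].
have lim : ((t%:num)%:E * ((n%:R ^- d)%:E * dv Phi K (box d n) mu) +
    (1 - t%:num)%:E * ((n%:R ^- d)%:E * dv Phi K (box d n) nu))%E @[n --> \oo] --> s.
  apply: cvgeD; last 2 first.
  - by apply: cvgeZl => //; exact: dv_box_cvg.
  - by apply: cvgeZl => //; exact: dv_box_cvg.
  - by apply: adde_def_scaled; rewrite ?subr_ge0//;
      apply: lt_le_trans (dv_lim_ge _); rewrite ?ltNyr.
have lim' : ((t%:num)%:E * ((n%:R ^- d)%:E * dv Phi K (box d n) mu) +
    (1 - t%:num)%:E * ((n%:R ^- d)%:E * dv Phi K (box d n) nu) -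
    (ln 2 * n%:R ^- d)%:E)%E @[n --> \oo] --> s.
  rewrite -[X in _ --> X]sube0; apply: cvgeB => //; exact: fin_num_adde_defl.
have cvg := dv_box_cvg mixP.
apply: (cvg_unique (@ereal_hausdorff R) cvg).
apply: squeeze_cvge lim' lim; near=> n.
have ninv0 : 0 <= n%:R ^- d :> R by rewrite invr_ge0 exprn_ge0.
have defd : ((t%:num)%:E * dv Phi K (box d n) mu +?
    (1 - t%:num)%:E * dv Phi K (box d n) nu)%E.
  by apply: adde_def_scaled; rewrite ?subr_ge0//;
    exact: (dv_gtNy PsiP Psi_ge0 XiP Xi_norm PhiE).
rewrite !(muleCA _ (n%:R ^- d)%:E) -muleDr//; apply/andP; split; last first.
  by apply: lee_wpmul2l; rewrite ?lee_fin//; exact: dv_mixture_le.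
rewrite leeBlDr// mulrC EFinM -muleDr ?fin_num_adde_defl//.
by apply: lee_wpmul2l; rewrite ?lee_fin//; exact: dv_mixture_ge'.
Unshelve. all: by end_near. Qed.

(** Because the limit is a supremum, a sublevel set is an intersection of conditions on single
    boxes. Each of them bounds means of bounded cylinder functions, hence survives limits. *)
Lemma dv_lim_leP mu (C : R) : (dv_lim mu <= C%:E)%E <->
  forall j, (dv Phi K (box d (j.+1 * N)) mu <=
    ((j.+1 * N)%:R ^+ d * C + (c + e (box d (j.+1 * N))))%:E)%E.
Proof.
have md j : (0 : R) < (j.+1 * N)%:R ^+ d by rewrite exprn_gt0// ltr0n muln_gt0.
split=> [H j|H].
  rewrite EFinD -leeBlDr// EFinM -lee_pdivrMl//; apply: le_trans H.
  by apply: ereal_sup_ubound; exists j.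
apply: ge_ereal_sup => _ [j _ <-].
by rewrite lee_pdivrMl// leeBlDr// -EFinM -EFinD.
Qed.

End thermodynamic_limit.

Lemma ultra_cvg_bounded (R : realType) (T : Type) (U : set_system T) (f : T -> R) (a b : R) :
  UltraFilter U -> U [set x | a <= f x <= b] -> exists2 l, a <= l <= b & f @ U --> l.
Proof.
move=> UU Uab; have PU : ProperFilter U by exact: ultra_proper.
have Uab' : U (f @^-1` `[a, b]%classic).
  by apply: filterS Uab => x /= xab; rewrite in_itv.
have [l [/= lab cl]] := @segment_compact R a b (f @ U) _ Uab'.
exists l; first by move: lab; rewrite in_itv.
move=> V Vl; have [//|UC] := in_ultra_setVsetC (f @^-1` V) UU.
by have [x []] := cl (~` V) V UC Vl.
Qed.

Lemma ultra_setU (T : Type) (U : set_system T) (A B : set T) :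
  UltraFilter U -> U (A `|` B) -> U A \/ U B.
Proof.
move=> UU UAB; have PU : ProperFilter U by exact: ultra_proper.
have [|UC] := in_ultra_setVsetC A UU; first by left.
by right; apply: filterS (filterI UAB UC) => x [[]].
Qed.

Lemma ecvg0_small (R : realType) (u : (\bar R)^nat) (e : R) : 0 < e ->
  u @ \oo --> 0%E -> exists n, (u n <= e%:E)%E.
Proof.
move=> e0 /fine_cvgP[fin lim]; near \oo => n; exists n.
rewrite -(fineK (x := u n)); last by near: n; exact: fin.
by rewrite lee_fin; apply: ltW; near: n; exact: (cvgr_lt 0).
Unshelve. all: by end_near. Qed.

(** * Measures from ultralimits of cylinder probabilities *)

Section measure_of_continuous.
Context d (T : measurableType d) (R : realType).
Variable m : set T -> \bar R.
Hypotheses (m0 : m set0 = 0%E) (m_ge0 : forall A, (0 <= m A)%E).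
Hypothesis m_add : forall A B, measurable A -> measurable B -> A `&` B = set0 ->
  m (A `|` B) = (m A + m B)%E.
Hypothesis m_cont : forall F : (set T)^nat, (forall n, measurable (F n)) ->
  nonincreasing_seq F -> \bigcap_n F n = set0 ->
  forall e : R, 0 < e -> exists n, (m (F n) <= e%:E)%E.

(** The properties are arguments of the name, so that the measure structure can be attached to
    it. *)
Definition continuous_content of m set0 = 0%E & (forall A, (0 <= m A)%E) &
  (forall A B, measurable A -> measurable B -> A `&` B = set0 ->
    m (A `|` B) = (m A + m B)%E) &
  (forall F : (set T)^nat, (forall n, measurable (F n)) ->
    nonincreasing_seq F -> \bigcap_n F n = set0 ->
    forall e : R, 0 < e -> exists n, (m (F n) <= e%:E)%E) := m.

Local Notation mm := (continuous_content m0 m_ge0 m_add m_cont).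

Let mm0 : mm set0 = 0%E. Proof. exact: m0. Qed.
Let mm_ge0 A : (0 <= mm A)%E. Proof. exact: m_ge0. Qed.
Let mm_sigma_additive : semi_sigma_additive mm.
Proof.
move=> F mF tF mUF; pose D n := \bigcup_(i >= n) F i.
have mD n : measurable (D n) by exact: bigcup_measurable.
have E n : mm (\bigcup_i F i) = (\sum_(0 <= i < n) mm (F i) + mm (D n))%E.
  elim: n => [|n IH].
    by rewrite big_nil add0e; congr mm; apply: eq_bigcupl.
  rewrite IH big_nat_recr//= -addeA; congr (_ + _)%E.
  have -> : D n = F n `|` D n.+1.
    apply/seteqP; split => [x [i /= ni Fi]|x [Fx|[i /= ni Fi]]].
    - move: ni; rewrite leq_eqVlt => /orP[/eqP ->|ni]; first by left.
      by right; exists i.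
    - by exists n => /=.
    - by exists i => //=; exact: ltnW.
  rewrite /mm m_add//; apply/seteqP; split => // x [Fx [i /= ni Fi]].
  by have := tF n i I I; move=> /(_ (ex_intro _ x (conj Fx Fi))) ni'; move: ni; rewrite ni' ltnn.
have ndD : nonincreasing_seq D.
  by move=> i j ij; apply/subsetPset => x [l /= jl Fl]; exists l => //=; exact: leq_trans jl.
have D0 : \bigcap_n D n = set0.
  apply/seteqP; split => // x Dx; have [i _ Fi] := Dx 0%N I.
  have [j /= ij Fj] := Dx i.+1 I.
  have := tF i j I I => /(_ (ex_intro _ x (conj Fi Fj))) H.
  by move: ij; rewrite H ltnn.
have mFn n : (\sum_(0 <= i < n) mm (F i) <= mm (\bigcup_i F i))%E.
  by rewrite (E n) leeDl.
have ndS : nondecreasing_seq (fun n => \sum_(0 <= i < n) mm (F i))%E.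
  by apply/nondecreasing_seqP => n; rewrite big_nat_recr//= leeDl.
suff -> : mm (\bigcup_i F i) = ereal_sup (range (fun n => \sum_(0 <= i < n) mm (F i))%E).
  exact: ereal_nondecreasing_cvgn.
apply/eqP; rewrite eq_le; apply/andP; split; last first.
  by apply: ge_ereal_sup => _ [n _ <-].
apply/lee_addgt0Pr => e e0; have [n mDn] := m_cont mD ndD D0 e0.
rewrite (E n); apply: leeD => //.
by apply: ereal_sup_ubound; exists n.
Qed.

HB.instance Definition _ := isMeasure.Build _ _ _ mm mm0 mm_ge0 mm_sigma_additive.

Lemma measure_of_continuous : exists mu : {measure set T -> \bar R}, forall A, mu A = m A.
Proof. by exists mm. Qed.

End measure_of_continuous.

(** * Extension from an algebra of sets to a probability *)

Section algebra_extension.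
Context (T : pointedType) (R : realType).
Variables (G : set (set T)) (m : set T -> \bar R).
Hypotheses (G0 : G set0) (GU : setU_closed G) (GC : setC_closed G).
Hypotheses (m0 : m set0 = 0%E) (m_ge0 : forall A, (0 <= m A)%E).
Hypothesis m_add : forall A B, G A -> G B -> A `&` B = set0 ->
  m (A `|` B) = (m A + m B)%E.
Hypothesis m_sub : forall A (F : (set T)^nat), G A -> (forall n, G (F n)) ->
  A `<=` \bigcup_n F n -> (m A <= \sum_(n <oo) m (F n))%E.

Definition algebra_type of G set0 & setU_closed G & setC_closed G : Type := T.
Local Notation AT := (algebra_type G0 GU GC).
HB.instance Definition _ := Pointed.copy AT T.
Fact algebra_display : measure_display. Proof. exact: default_measure_display. Qed.
HB.instance Definition _ := @isAlgebraOfSets.Build algebra_display AT G G0 GU GC.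

Definition algebra_content of m set0 = 0%E & (forall A, (0 <= m A)%E) &
  (forall A B, G A -> G B -> A `&` B = set0 -> m (A `|` B) = (m A + m B)%E) &
  (forall A (F : (set T)^nat), G A -> (forall n, G (F n)) ->
    A `<=` \bigcup_n F n -> (m A <= \sum_(n <oo) m (F n))%E) : set AT -> \bar R := m.
Local Notation am := (algebra_content m0 m_ge0 m_add m_sub).

Let am_ge0 A : (0 <= am A)%E. Proof. exact: m_ge0. Qed.
Let am_semi_additive : measure_function.semi_additive am.
Proof. by apply/measure_function.additive2P => // A B mA mB AB; exact: m_add. Qed.
HB.instance Definition _ := isContent.Build _ AT R am am_ge0 am_semi_additive.

Let am_sub : measurable_subset_sigma_subadditive am.
Proof. by move=> A F mF mA AF; exact: m_sub. Qed.
HB.instance Definition _ := Content_SigmaSubAdditive_isMeasure.Build _ R AT am am_sub.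

Lemma algebra_extension_measure :
  exists mu : {measure set (g_sigma_algebraType (@measurable _ AT)) -> \bar R},
  forall A, G A -> mu A = m A.
Proof.
exists (measure_extension (am : {measure set AT -> \bar R})) => A GA.
exact: (@measurable_mu_extE _ R AT am A GA).
Qed.

End algebra_extension.

Section zero_extension.
Context (T : pointedType) (R : realType) (H : set (set T)).
Variable mu : set (g_sigma_algebraType H) -> \bar R.
Hypotheses (mu0 : mu set0 = 0%E) (mu_ge0 : forall A, (0 <= mu A)%E).
Hypotheses (mu_add : semi_sigma_additive mu) (mu1 : mu setT = 1%E).

(** An extension obtained from an outer measure has values on all sets; this selects the
    representative demanded by [zero_off_measurable]. *)
Definition zero_extension of mu set0 = 0%E & (forall A, (0 <= mu A)%E) &
    semi_sigma_additive mu & mu setT = 1%E : set (g_sigma_algebraType H) -> \bar R :=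
  fun A => if `[< measurable A >] then mu A else 0%E.

Local Notation ze := (zero_extension mu0 mu_ge0 mu_add mu1).

Let zeE A : measurable A -> ze A = mu A.
Proof. by move=> HA; rewrite /zero_extension asboolT. Qed.
Let ze0 : ze set0 = 0%E.
Proof. by rewrite zeE. Qed.
Let ze_ge0 A : (0 <= ze A)%E.
Proof. by rewrite /zero_extension; case: ifP. Qed.
Let ze_sigma_additive : semi_sigma_additive ze.
Proof.
move=> F mF tF mUF; rewrite zeE//.
rewrite (_ : (fun n => _) = (fun n => \sum_(0 <= i < n) mu (F i))%E); last first.
  by apply/funext => n; apply: eq_bigr => i _; rewrite zeE.
exact: mu_add.
Qed.
HB.instance Definition _ := isMeasure.Build _ _ _ ze ze0 ze_ge0 ze_sigma_additive.
Let zeT : ze setT = 1%E.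
Proof. by rewrite zeE. Qed.
HB.instance Definition _ := Measure_isProbability.Build _ _ _ ze zeT.

Lemma zero_extension_probability : exists P : probability (g_sigma_algebraType H) R,
  (forall A, measurable A -> P A = mu A) /\ forall A, ~ measurable A -> P A = 0%E.
Proof.
exists ze; split => [A|A nA]; first exact: zeE.
by rewrite /= /zero_extension asboolF.
Qed.
End zero_extension.

Lemma probability_of_content (T : pointedType) (R : realType)
    (G H : set (set T)) (m : set T -> \bar R) :
  <<s G >> = <<s H >> -> G set0 -> setU_closed G -> setC_closed G ->
  (forall A, (0 <= m A)%E) -> m setT = 1%E ->
  (forall A B, G A -> G B -> A `&` B = set0 -> m (A `|` B) = (m A + m B)%E) ->
  (forall A (F : (set T)^nat), G A -> (forall n, G (F n)) ->
    A `<=` \bigcup_n F n -> (m A <= \sum_(n <oo) m (F n))%E) ->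
  exists P : probability (g_sigma_algebraType H) R,
  (forall A, G A -> P A = m A) /\
  forall A, ~ measurable (A : set (g_sigma_algebraType H)) -> P A = 0%E.
Proof.
move=> GH G0 GU GC m_ge0 m1 m_add m_sub.
have GT : G setT by rewrite -setC0; exact: GC.
have m0 : m set0 = 0%E.
  have := m_add _ _ GT G0 (setI0 _); rewrite setU0 m1.
  by case: (m set0) (m_ge0 set0) => [r _| |]//= [/eqP]; rewrite addrC -subr_eq subrr => /eqP <-.
have [mu muE] := @algebra_extension_measure T R G m G0 GU GC m0 m_ge0 m_add m_sub.
have mu0 : mu set0 = 0%E by exact: measure0.
have mu_ge0 A : (0 <= mu A)%E by exact: measure_ge0.
have mu1 : mu setT = 1%E by rewrite muE.
have mu_add : semi_sigma_additive (mu : set (g_sigma_algebraType H) -> \bar R).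
  move=> F mF tF mUF; apply: (@measure_semi_sigma_additive _ _ _ mu) => //.
  - by move=> n; have := mF n; rewrite /measurable/= -GH.
  - by have := mUF; rewrite /measurable/= -GH.
have [P [PE P0]] := @zero_extension_probability T R H mu mu0 mu_ge0 mu_add mu1.
exists P; split => // A GA; rewrite PE ?muE//.
by rewrite /measurable/= -GH; exact: sub_sigma_algebra.
Qed.

(** * Regularity relative to an abstract class of closed sets *)

Section regularity.
Context d (T : measurableType d) (R : realType) (mu : {measure set T -> \bar R}).
Hypothesis mu_fin : (mu setT < +oo)%E.
Variable cl : set (set T).
Hypothesis cl0 : cl set0.
Hypothesis clT : cl setT.
Hypothesis clU : forall A B, cl A -> cl B -> cl (A `|` B).
Hypothesis clI : forall F : (set T)^nat, (forall n, cl (F n)) -> cl (\bigcap_n F n).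

(** Inner approximation of [A] and of its complement at the same time, which makes stability under
    complements immediate. *)
Definition regular A := forall e : R, 0 < e -> exists C D,
  [/\ measurable C /\ measurable D, cl C /\ cl D, C `<=` A, D `<=` ~` A &
      (mu (~` (C `|` D)) <= e%:E)%E].

Lemma regularC A : regular A -> regular (~` A).
Proof.
move=> rA e e0; have [C [D [[mC mD] [cC cD] CA DA CD]]] := rA e e0.
by exists D, C; split => //; rewrite ?setCK// setUC.
Qed.

(** The class [cl] is stable under countable intersections but only finite unions. The outer
    approximation is therefore the full intersection, while the inner one is a finite union that
    misses a tail of measure at most [e / 2]. *)
Lemma regular_bigcup (F : (set T)^nat) : (forall n, regular (F n)) ->
  regular (\bigcup_n F n).
Proof.
move=> rF e e0.
have /choice[p pP] (n : nat) : exists p : set T * set T,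
    [/\ measurable p.1 /\ measurable p.2, cl p.1 /\ cl p.2, p.1 `<=` F n,
        p.2 `<=` ~` F n & (mu (~` (p.1 `|` p.2)) <= (e / 2 / (2 ^ n.+1)%:R)%:E)%E].
  have en : 0 < e / 2 / (2 ^ n.+1)%:R by rewrite !divr_gt0// ltr0n expn_gt0.
  by have [C [D H]] := rF n _ en; exists (C, D).
pose C n := \big[setU/set0]_(i < n) (p i).1; pose D := \bigcap_n (p n).2.
have CE n : C n = \bigcup_(i in `I_n) (p i).1 by rewrite bigcup_mkord.
have mC n : measurable (C n) by apply: bigsetU_measurable => i _; have [[]] := pP i.
have mD : measurable D by apply: bigcapT_measurable => i; have [[]] := pP i.
have mUC : measurable (\bigcup_n (p n).1) by apply: bigcupT_measurable => i; have [[]] := pP i.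
have [n Cn] : exists n, (mu ((\bigcup_n (p n).1) `\` C n) <= (e / 2)%:E)%E.
  have mX n : measurable ((\bigcup_n (p n).1) `\` C n) by exact: measurableD.
  have X0 : \bigcap_n ((\bigcup_n (p n).1) `\` C n) = set0.
    apply/seteqP; split => // x Xx; have [[i _ xi] _] := Xx 0%N I.
    have [_ nC] := Xx i.+1 I; by apply: nC; rewrite CE; exists i => /=.
  have := @nonincreasing_cvg_mu _ _ _ mu (fun n => (\bigcup_n (p n).1) `\` C n).
  rewrite X0 measure0 => /(_ _ mX measurable0)/wrap[].
    by apply: le_lt_trans mu_fin; apply: le_measure; rewrite ?inE.
  move=> /(_ _)/wrap[].
    move=> i j ij; apply/subsetPset; apply: setDS => x.
    by rewrite !CE => -[l /= li pl]; exists l => //=; exact: leq_trans ij.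
  by apply: ecvg0_small; rewrite divr_gt0.
exists (C n), D; split.
- by [].
- split; last by apply: clI => i; have [_ []] := pP i.
  by rewrite /C; elim/big_ind: _ => // i _; have [_ []] := pP i.
- move=> x; rewrite CE => -[i _ pi]; exists i => //.
  by have [_ _ + _ _] := pP i; apply.
- by move=> x Dx [i _ Fx]; have [_ _ _ /(_ x) H _] := pP i; apply: H => //; exact: Dx.
have sub : ~` (C n `|` D) `<=` ((\bigcup_n (p n).1) `\` C n) `|`
    \bigcup_n ~` ((p n).1 `|` (p n).2).
  move=> x /not_orP[nC /existsNP[i /not_implyP[_ nD]]].
  have [xC|nxC] := pselect ((\bigcup_n (p n).1) x); first by left.
  by right; exists i => // -[xi|//]; apply: nxC; exists i.
have mUp : measurable (\bigcup_n ~` ((p n).1 `|` (p n).2)).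
  apply: bigcupT_measurable => i; have [[? ?] _ _ _ _] := pP i.
  by apply: measurableC; exact: measurableU.
apply: (le_trans (le_measure mu _ _ sub)); rewrite ?inE.
- by apply: measurableC; exact: measurableU.
- by apply: measurableU => //; exact: measurableD.
apply: le_trans (measureU2 _ _ _) _ => //; first exact: measurableD.
rewrite [e](splitr) EFinD; apply: leeD => //.
apply: le_trans (measure_sigma_subadditive _ _ mUp (@subset_refl _ _)) _.
  move=> i; have [[? ?] _ _ _ _] := pP i.
  by apply: measurableC; exact: measurableU.
apply: (@le_trans _ _ (\sum_(n <oo) (e / 2 / (2 ^ n.+1)%:R)%:E)%E).
  by apply: lee_nneseries => // i _; have [] := pP i.
by apply: epsilon_trick0; rewrite divr_ge0// ltW.
Qed.

Lemma regular_sigma_algebra : sigma_algebra setT regular.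
Proof.
split.
- move=> e e0; exists set0, setT; split => //; first by rewrite setC0.
  by rewrite set0U setCT measure0 lee_fin ltW.
- by move=> A rA; rewrite setTD; exact: regularC.
- exact: regular_bigcup.
Qed.

End regularity.

Section heights.
Variables (R : realType) (k : height_kind).
Local Notation E := (heights R k).

(** Preimages of closed rays are closed, so regularity need only be checked on them. For integer
    heights a singleton is the difference of two rays. *)
Lemma heights_measurable_rays : @measurable _ E =
  <<s [set [set z : E | a <= height_val z] | a in [set: R]] >>.
Proof.
case: k => /=.
  apply/seteqP; split => // B _.
  have -> : B = \bigcup_(z in [set: int]) [set w | w = z /\ B z].
    by apply/seteqP; split => [z Bz|z [w _ [-> ]]]; first by exists z.
  have sig := @smallest_sigma_algebra _ [set: int]
    [set [set z : heights R IntegerHeights | a <= height_val z] | a in [set: R]].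
  pose ray := g_sigma_algebraType [set [set z : heights R IntegerHeights | a <= height_val z] | a in [set: R]].
  apply: (@countable_bigcupT_measurable _ ray) => [|z]; first exact: countableP.
  have [Bz|nBz] := pselect (B z); last first.
    rewrite (_ : [set w | _] = set0); first exact: (@measurable0 _ ray).
    by apply/seteqP; split => // w [].
  rewrite (_ : [set w | _] = [set z]); last first.
    by apply/seteqP; split => w /= => [[]|].
  have -> : [set z] = [set w : int | z%:~R <= (w%:~R : R)] `\`
      [set w : int | (z + 1)%:~R <= (w%:~R : R)].
    apply/seteqP; split => [w /= ->|w /= []]; rewrite !ler_int.
      by split => //; rewrite gerDl.
    by move=> zw /negP; rewrite -ltNge ltzD1 => wz; apply/eqP; rewrite eq_le wz zw.
  by apply: (@measurableD _ ray); apply: sub_sigma_algebra; eexists.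
transitivity (<<s @RGenCInfty.G R >>); first exact: RGenCInfty.measurableE.
congr (<<s _ >>); apply/seteqP; split => B.
  by move=> [a ->]; exists a => //; apply/seteqP; split => x /=; rewrite in_itv/= andbT.
by move=> [a _ <-]; exists a; apply/seteqP; split => x /=; rewrite in_itv/= andbT.
Qed.

(** The real limit must itself be a height, which needs an argument only for integers. *)
Lemma ultra_cvg_heights (F : set_system nat) (a : nat -> E) (r : R) :
  UltraFilter F -> F [set n | `|height_val (a n)| <= r] ->
  exists b : E, height_val (a n) @[n --> F] --> (height_val b : R).
Proof.
move=> UF Fr; have PF : ProperFilter F by exact: ultra_proper.
have [l _ al] : exists2 l, - r <= l <= r & (height_val (a n) : R) @[n --> F] --> l.
  by apply: ultra_cvg_bounded; apply: filterS Fr => n; rewrite /= ler_norml.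
case: k a al {Fr} => a al; last by exists l.
(* Two integers within 1/2 of [l] differ by less than 1, so the sequence is constant on a set of
   [F]. *)
have half0 : (0 : R) < 1 / 2 by rewrite divr_gt0.
have /cvgrPdist_lt/(_ (1 / 2) half0) H := al.
have [n0 Hn0] := filter_ex H.
exists (a n0); apply: cvg_near_cst; apply: filterS H => n /= Hn.
congr (_%:~R); apply/eqP; rewrite -subr_eq0 -absz_eq0; move: Hn0 Hn => /=.
have : `|(a n - a n0)%:~R| < 1 :> R -> (`|a n - a n0| == 0)%N.
  by rewrite -intr_norm -[1]/(1%:~R) ltr_int; lia.
move=> H' H1 H2; apply: H'; rewrite intrB.
move: H1 H2; rewrite !ltr_norml => /andP[? ?] /andP[? ?].
by apply/andP; split; lra.
Qed.

End heights.

(** * Limits of configurations modulo constants *)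

Section gradient_limits.
Variables (R : realType) (k : height_kind) (d : nat).
Local Notation Om := (Omega R k d).
Variable F : set_system nat.
Hypotheses (UF : UltraFilter F) (F_oo : \oo `<=` F).

Definition grad_cvg (f : nat -> Om) (phi : Om) := forall x y,
  height_val (height_sub (f n y) (f n x)) @[n --> F] -->
    (height_val (height_sub (phi y) (phi x)) : R).

(** Along an ultrafilter, bounded increments converge without extraction of subsequences, and the
    union of two closed sets is closed because [F] chooses one of them. *)
Definition grad_closed (B : set Om) := forall f phi, grad_cvg f phi ->
  F [set n | B (f n)] -> B phi.

Let PF : ProperFilter F. Proof. exact: ultra_proper. Qed.

Lemma grad_closed0 : grad_closed set0.
Proof. by move=> f phi _ F0; have [n] := filter_ex F0. Qed.

Lemma grad_closedT : grad_closed setT. Proof. by []. Qed.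

Lemma grad_closedU A B : grad_closed A -> grad_closed B -> grad_closed (A `|` B).
Proof.
move=> cA cB f phi fphi FAB.
have [FA|FB] := ultra_setU (A := [set n | A (f n)]) (B := [set n | B (f n)]) UF FAB.
  by left; exact: cA fphi FA.
by right; exact: cB fphi FB.
Qed.

Lemma grad_closed_bigcap (B : (set Om)^nat) : (forall n, grad_closed (B n)) ->
  grad_closed (\bigcap_n B n).
Proof.
move=> cB f phi fphi FB n _; apply: cB fphi _.
by apply: filterS FB => i; apply.
Qed.

Lemma grad_closed_ge x y (a : R) :
  grad_closed [set phi | a <= height_val (height_sub (phi y) (phi x))].
Proof. by move=> f phi /(_ x y) lim FB; exact: (cvgr_to_ge lim). Qed.

Lemma grad_closed_le x y (a : R) :
  grad_closed [set phi | height_val (height_sub (phi y) (phi x)) <= a].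
Proof. by move=> f phi /(_ x y) lim FB; exact: (cvgr_to_le lim). Qed.

(** A diagonal compactness argument: if the [n]-th configuration violates the claim at [n], the
    limit of these configurations lies in [C], hence in some [O i], which all but finitely many of
    them avoid. A slope bound on the window [B_ n] alone suffices, since each pair of points lies in
    all late windows. *)
Lemma grad_closed_compact (K : R) (B_ : nat -> {fset Zd d}) (C : set Om) (O : (set Om)^nat) :
  (forall m n, (m <= n)%N -> (B_ m `<=` B_ n)%fset) ->
  (forall x, exists n, x \in B_ n) ->
  grad_closed C -> (forall n, grad_closed (~` O n)) -> C `<=` \bigcup_n O n ->
  exists n, C `&` slope_set K (B_ n) `<=` \bigcup_(i in `I_n) O i.
Proof.
move=> Bmono Bex cC cO CO; apply: contrapT => /forallNP H.
have /choice[f fP] (n : nat) : exists phi, [/\ C phi, slope_set K (B_ n) phi &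
    forall i, (i < n)%N -> ~ O i phi].
  have /nonsubset[phi [[Cp Sp] nO]] := H n.
  by exists phi; split => // i ni Oi; apply: nO; exists i.
(* Heights are measured from the origin; the slope bound then confines [a x n] for large [n]. *)
pose a x n := height_sub (f n x) (f n 0).
have /choice[phi phiP] (x : Zd d) : exists b : heights R k,
    height_val (a x n) @[n --> F] --> (height_val b : R).
  have [i xi] := Bex x; have [j j0] := Bex 0.
  apply: (@ultra_cvg_heights _ _ _ _ (K * (d1 0 x)%:R) UF).
  apply: F_oo; exists (maxn i j) => //= n; rewrite /= geq_max => /andP[ni nj].
  have [_ + _] := fP n; apply; [exact: (fsubsetP (Bmono _ _ nj))|exact: (fsubsetP (Bmono _ _ ni))].
have fphi : grad_cvg f phi.
  move=> x y; rewrite height_valB.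
  rewrite (_ : (fun n => _) = fun n => height_val (a y n) - height_val (a x n)).
    by apply: cvgB.
  by apply/funext => n; rewrite !height_valB; ring.
have Cphi : C phi.
  by apply: cC fphi _; apply: filterS (@filterT _ F _) => n _; have [] := fP n.
have [i _ Oi] := CO _ Cphi.
apply: (cO i f phi fphi _ Oi); apply: F_oo; exists i.+1 => //= n ni.
by have [_ _] := fP n; apply.
Qed.

End gradient_limits.

(** * Limits of probabilities of events along an ultrafilter *)

Section ultralimit.
Variables (R : realType) (k : height_kind) (d : nat).
Local Notation Om := (Omega R k d).
Variables (U : set_system (grad_prob R k d)) (B_ : nat -> {fset Zd d}) (K : R).
Hypothesis UU : UltraFilter U.
Hypothesis B_mono : forall m n, (m <= n)%N -> (B_ m `<=` B_ n)%fset.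
Hypothesis B_ex : forall x, exists n, x \in B_ n.
Hypothesis U_ac : forall j (F : (set Om)^nat),
  (forall n, measurable (F n : set (grad_space R k [set` B_ j]))) ->
  nonincreasing_seq F -> \bigcap_n F n = set0 ->
  forall e : R, 0 < e -> exists n, U [set mu | (mu (F n) <= e%:E)%E].
Hypothesis U_slope : forall j, U [set mu : grad_prob R k d | mu (~` slope_set K (B_ j)) = 0%E].

Let PU : ProperFilter U. Proof. exact: ultra_proper. Qed.

Local Notation ev A := (fun mu : grad_prob R k d => fine (mu A)).

(** The limit exists event by event and is finitely additive for any ultrafilter; only countable
    additivity is in question. *)
Definition ultralimit (A : set Om) : \bar R :=
  if `[< measurable (A : set (grad_space R k setT)) >]
  then (lim (ev A @ U))%:E else 0%E.
Local Notation m := ultralimit.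

Let prob01 (mu : grad_prob R k d) A : measurable (A : set (grad_space R k setT)) ->
  0 <= fine (mu A) <= 1.
Proof.
move=> mA; rewrite fine_ge0//= -lee_fin fineK ?probability_le1//.
exact: fin_num_measure.
Qed.

Lemma ultralimit_cvg A : measurable (A : set (grad_space R k setT)) ->
  (ev A @ U --> fine (m A)) /\ 0 <= fine (m A) <= 1.
Proof.
move=> mA; rewrite /m asboolT//=.
have [l l01 Ul] : exists2 l, 0 <= l <= 1 & ev A @ U --> (l : R).
  by apply: ultra_cvg_bounded; apply: filterS (@filterT _ U _) => mu _; exact: prob01.
by rewrite (cvg_lim (@Rhausdorff R) Ul).
Qed.

Lemma ultralimit_ge0 A : (0 <= m A)%E.
Proof.
have [mA|nA] := pselect (measurable (A : set (grad_space R k setT))).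
  have [_ /andP[H _]] := ultralimit_cvg mA.
  by move: H; rewrite /m asboolT// lee_fin.
by rewrite /m asboolF.
Qed.

Lemma ultralimit_fin A : m A \is a fin_num.
Proof. by rewrite /m; case: ifP. Qed.

Lemma ultralimit_add A B : measurable (A : set (grad_space R k setT)) ->
  measurable (B : set (grad_space R k setT)) -> A `&` B = set0 ->
  m (A `|` B) = (m A + m B)%E.
Proof.
move=> mA mB AB; have mAB : measurable (A `|` B : set (grad_space R k setT)).
  exact: measurableU.
rewrite -(fineK (ultralimit_fin (A `|` B))) -(fineK (ultralimit_fin A)).
rewrite -(fineK (ultralimit_fin B)) -EFinD; congr EFin.
have [cA _] := ultralimit_cvg mA; have [cB _] := ultralimit_cvg mB.
have [cAB _] := ultralimit_cvg mAB.
apply: (cvg_unique (@Rhausdorff R) cAB).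
have H : (fun mu : grad_prob R k d => fine (mu (A `|` B))) =
    (fun mu => fine (mu A) + fine (mu B)).
  by apply/funext => mu; rewrite measureU// fineD//; exact: fin_num_measure.
by rewrite H; exact: cvgD.
Qed.

Lemma ultralimit_le A (e : R) : measurable (A : set (grad_space R k setT)) ->
  U [set mu | (mu A <= e%:E)%E] -> (m A <= e%:E)%E.
Proof.
move=> mA UA; have [cA _] := ultralimit_cvg mA.
rewrite -(fineK (ultralimit_fin A)) lee_fin; apply: (cvgr_to_le cA).
apply: filterS UA => mu /=; rewrite -lee_fin fineK//; exact: fin_num_measure.
Qed.

Let mono A B : measurable (A : set (grad_space R k setT)) ->
  measurable (B : set (grad_space R k setT)) -> A `<=` B -> (m A <= m B)%E.
Proof.
move=> mA mB AB; have -> : B = A `|` (B `\` A) by rewrite setDUK.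
rewrite ultralimit_add//; first by rewrite leeDl// ultralimit_ge0.
- by apply: measurableD.
- by rewrite setDIK.
Qed.

Lemma ultralimit_setU A B : measurable (A : set (grad_space R k setT)) ->
  measurable (B : set (grad_space R k setT)) -> (m (A `|` B) <= m A + m B)%E.
Proof.
move=> mA mB; have mBA : measurable (B `\` A : set (grad_space R k setT)) by exact: measurableD.
have -> : A `|` B = A `|` (B `\` A) by rewrite setUDr setDv setD0.
rewrite ultralimit_add//; last by rewrite setDIK.
by rewrite leeD2l//; apply: mono => //; exact: subDsetl.
Qed.

Lemma ultralimitT : m setT = 1%E.
Proof.
have [cT _] := ultralimit_cvg measurableT.
rewrite -(fineK (ultralimit_fin setT)); congr EFin.
apply: (cvg_unique (@Rhausdorff R) cT).
rewrite (_ : (fun mu : grad_prob R k d => fine (mu setT)) = fun=> 1); first exact: cvg_cst.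
by apply/funext => mu; rewrite probability_setT.
Qed.

Let m0 : m set0 = 0%E.
Proof.
have [cT _] := ultralimit_cvg measurable0.
rewrite -(fineK (ultralimit_fin set0)); congr EFin.
apply: (cvg_unique (@Rhausdorff R) cT).
rewrite (_ : (fun mu : grad_prob R k d => fine (mu set0)) = fun=> 0); first exact: cvg_cst.
by apply/funext => mu; rewrite measure0.
Qed.

Let subT (S : set (Zd d)) (A : set Om) : measurable (A : set (grad_space R k S)) ->
  measurable (A : set (grad_space R k setT)).
Proof. exact: grad_space_sub. Qed.

(** On a single window [U_ac] is continuity at the empty set. Sequences of cylinders from growing
    windows are left to [ultralimit_sub]. *)
Lemma ultralimit_measure j : exists mu : {measure set (grad_space R k [set` B_ j]) -> \bar R},
  forall A, mu A = m A.
Proof.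
apply: measure_of_continuous.
- exact: m0.
- exact: ultralimit_ge0.
- by move=> A B mA mB; apply: ultralimit_add; exact: (@subT [set` B_ j]).
- move=> F mF ndF F0 e e0; have [n Fn] := U_ac mF ndF F0 e0.
  by exists n; apply: ultralimit_le => //; exact: (@subT [set` B_ j]).
Qed.

Definition cylinders : set (set Om) :=
  [set A : set Om | exists j, measurable (A : set (grad_space R k [set` B_ j]))].

Lemma cylinders_sub A B : cylinders A -> cylinders B -> exists j,
  measurable (A : set (grad_space R k [set` B_ j])) /\
  measurable (B : set (grad_space R k [set` B_ j])).
Proof.
move=> [i mA] [j mB]; exists (maxn i j).
have sub l : (l <= maxn i j)%N -> [set` B_ l] `<=` [set` B_ (maxn i j)].
  by move=> /B_mono /fsubsetP H x /=; exact: H.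
by split; [apply: grad_space_mono mA|apply: grad_space_mono mB]; apply: sub;
  rewrite ?leq_maxl ?leq_maxr.
Qed.

Lemma cylinders_sigma : <<s cylinders >> = <<s grad_generator (R := R) (k := k) (d := d) setT >>.
Proof.
apply/seteqP; split.
  apply: smallest_sub; first exact: smallest_sigma_algebra.
  by move=> A [j /subT].
apply: smallest_sub; first exact: smallest_sigma_algebra.
move=> A [[x y] _ AE]; apply: sub_sigma_algebra.
have [i xi] := B_ex x; have [j yj] := B_ex y; exists (maxn i j).
apply: sub_sigma_algebra; exists (x, y) => //; split => /=.
  exact: (fsubsetP (B_mono (leq_maxl i j))).
exact: (fsubsetP (B_mono (leq_maxr i j))).
Qed.

Section inner_regular.
Variable F : set_system nat.
Hypotheses (UF : UltraFilter F) (F_oo : \oo `<=` F).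
Local Notation cl := (@grad_closed R k d F).

(** Regular sets form a sigma-algebra, so it suffices to treat increments in a closed ray. *)
Lemma cylinder_regular j (mu : {measure set (grad_space R k [set` B_ j]) -> \bar R}) A :
  (mu setT < +oo)%E ->
  measurable (A : set (grad_space R k [set` B_ j])) -> regular mu cl A.
Proof.
move=> mufin; have sig := @regular_sigma_algebra _ _ _ mu mufin cl
  (grad_closed0 UF) (@grad_closedT R k d F) (@grad_closedU R k d F UF)
  (@grad_closed_bigcap R k d F UF).
apply: smallest_sub => // {}A [[x y] /= [xB yB] [B mB <-]]; rewrite setTI.
pose f (phi : Om) := height_sub (phi y) (phi x).
have sigB : sigma_algebra setT [set B | regular mu cl (f @^-1` B)].
  have [s0 sC sU] := sig; split => /=.
  - by rewrite preimage_set0.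
  - by move=> D rD; rewrite setTD preimage_setC -setTD; exact: sC.
  - by move=> D rD; rewrite preimage_bigcup; exact: sU.
have : @measurable _ (heights R k) B by [].
rewrite heights_measurable_rays; apply: (smallest_sub sigB) => _ [a _ <-] /=.
have mf : measurable_fun setT
    (fun phi : grad_space R k [set` B_ j] => height_val (f phi)).
  apply: (measurableT_comp (@measurable_height_val R k)).
  exact: (@measurable_grad_space R k d [set` B_ j] x y xB yB).
have mge b : measurable ([set phi : Om | b <= height_val (f phi)] : set (grad_space R k [set` B_ j])).
  rewrite (_ : [set _ | _] = setT `&` (fun phi => height_val (f phi)) @^-1` `[b, +oo[%classic).
    exact: mf.
  by apply/seteqP; split => phi /=; rewrite in_itv/= andbT; [move=> ?|case].
have mle b : measurable ([set phi : Om | height_val (f phi) <= b] : set (grad_space R k [set` B_ j])).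
  rewrite (_ : [set _ | _] = setT `&` (fun phi => height_val (f phi)) @^-1` `]-oo, b]%classic).
    exact: mf.
  by apply/seteqP; split => phi /=; rewrite in_itv/=; [move=> ?|case].
move=> e e0.
(* The open complement of a ray is exhausted by closed rays at distance [1 / (n + 1)]; the gaps
   [X n] decrease to the empty set. *)
pose X n := ~` ([set phi : Om | a <= height_val (f phi)] `|`
  [set phi : Om | height_val (f phi) <= a - n.+1%:R^-1]).
have mX n : measurable (X n : set (grad_space R k [set` B_ j])).
  by apply: measurableC; exact: measurableU.
have X0 : \bigcap_n X n = set0.
  apply/seteqP; split => // phi Xphi.
  have /not_orP[/= /negP + _] := Xphi 0%N I; rewrite -ltNge => /ltr_add_invr[n lt].
  have /not_orP[_ /= /negP] := Xphi n I; rewrite -ltNge => lt'.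
  by move: lt; rewrite -ltrBrDr => /(lt_trans lt'); rewrite ltxx.
have [n Xn] : exists n, (mu (X n) <= e%:E)%E.
  apply: ecvg0_small => //.
  have := @nonincreasing_cvg_mu _ _ _ mu X; rewrite X0 measure0; apply => //.
    by apply: le_lt_trans mufin; apply: le_measure; rewrite ?inE.
  move=> i l il; apply/subsetPset; apply: subsetC; apply: setUS => phi /= le.
  apply: le_trans le _; rewrite lerD2l lerN2 lef_pV2 ?posrE ?ltr0n// ler_nat ltnS.
  exact: il.
exists [set phi : Om | a <= height_val (f phi)],
  [set phi : Om | height_val (f phi) <= a - n.+1%:R^-1]; split => //.
- by split; [exact: grad_closed_ge|exact: grad_closed_le].
- move=> phi /= le ge; move: (le_trans ge le); apply/negP; rewrite -ltNge.
  by rewrite ltrBlDr ltrDl.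
Qed.

(** Replace [A] by a closed cylinder inside it and each [D n] by an open one around it, at total
    cost [e]. Compactness reduces the cover to a finite one on slope-bounded configurations, and
    finite subadditivity concludes. *)
Lemma ultralimit_sub A (D : (set Om)^nat) : cylinders A -> (forall n, cylinders (D n)) ->
  A `<=` \bigcup_n D n -> (m A <= \sum_(n <oo) m (D n))%E.
Proof.
move=> cA cD AD; apply/lee_addgt0Pr => e e0.
have inner (B : set Om) (eps : R) : 0 < eps -> cylinders B -> exists C O : set Om,
    [/\ measurable (C : set (grad_space R k setT)) /\ measurable (O : set (grad_space R k setT)),
        C `<=` B /\ B `<=` O, cl C /\ cl (~` O), (m B <= m C + eps%:E)%E &
        (m O <= m B + eps%:E)%E].
  move=> eps0 [j mB]; have [mu muE] := ultralimit_measure j.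
  have mufin : (mu setT < +oo)%E by rewrite muE ultralimitT ltry.
  have [C [ O [[mC mO] [clC clO] CB OB err]]] := cylinder_regular mufin mB eps0.
  have mN : measurable (~` (C `|` O) : set (grad_space R k [set` B_ j])).
    by apply: measurableC; exact: measurableU.
  exists C, (~` O); rewrite setCK -!muE; split => //.
  - by split; [exact: (@subT [set` B_ j])|apply: (@subT [set` B_ j]); exact: measurableC].
  - by split => // phi Bphi Ophi; exact: OB Bphi.
  - apply: (@le_trans _ _ (mu (C `|` ~` (C `|` O)))).
      apply: le_measure; rewrite ?inE//; first exact: measurableU.
      move=> phi Bphi; have [Cphi|nC] := pselect (C phi); first by left.
      by right=> -[//|Ophi]; exact: OB Bphi.
    by apply: le_trans (measureU2 _ _ _) _ => //; exact: leeD.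
  - apply: (@le_trans _ _ (mu (B `|` ~` (C `|` O)))).
      apply: le_measure; rewrite ?inE//; [exact: measurableC|exact: measurableU|].
      move=> phi nO; have [Cphi|nC] := pselect (C phi); first by left; exact: CB.
      by right=> -[].
    by apply: le_trans (measureU2 _ _ _) _ => //; exact: leeD.
have e2 : 0 < e / 2 by rewrite divr_gt0.
have [C [_ [[mC _] [CA _] [clC _] mAC _]]] := inner A (e / 2) e2 cA.
have /choice[ O OP] (n : nat) : exists O : set Om,
    [/\ measurable (O : set (grad_space R k setT)), D n `<=` O, cl (~` O) &
        (m O <= m (D n) + (e / 2 / (2 ^ n.+1)%:R)%:E)%E].
  have en : 0 < e / 2 / (2 ^ n.+1)%:R by rewrite !divr_gt0// ltr0n expn_gt0.
  by have [_ [ O [[_ mO] [_ DO] [_ clO] _ mDO]]] := inner _ _ en (cD n); exists O.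
have CO : C `<=` \bigcup_n O n.
  move=> phi /CA/AD[n _ Dn]; exists n => //.
  by have [_ + _ _] := OP n; apply.
have clO n : cl (~` O n) by have [] := OP n.
have [n Cn] := grad_closed_compact UF F_oo K B_mono B_ex clC clO CO.
have mO i : measurable (O i : set (grad_space R k setT)) by have [] := OP i.
have mS : measurable (slope_set K (B_ n) : set (grad_space R k setT)).
  by apply: grad_space_sub; exact: (@measurable_slope_set R k d K (B_ n)).
(* The part of [C] that compactness does not reach has limit probability zero. *)
have S0 : m (~` slope_set K (B_ n)) = 0%E.
  apply/eqP; rewrite eq_le ultralimit_ge0 andbT; apply: ultralimit_le.
    exact: measurableC.
  by apply: filterS (U_slope n) => mu /= ->.
have finU (p : nat) : measurable (\bigcup_(i in `I_p) O i : set (grad_space R k setT)) /\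
    (m (\bigcup_(i in `I_p) O i) <= \sum_(0 <= i < p) m (O i))%E.
  elim: p => [|p [IHm IH]]; first by rewrite bigcup_mkord big_ord0 big_nil m0.
  rewrite bigcup_mkord big_ord_recr/= -bigcup_mkord; split; first exact: measurableU.
  rewrite big_nat_recr//=; apply: le_trans (ultralimit_setU IHm (mO p)) _.
  exact: leeD2r.
have mCn : (m C <= \sum_(0 <= i < n) m (O i))%E.
  have [mU le] := finU n.
  apply: (@le_trans _ _ (m (\bigcup_(i in `I_n) O i `|` ~` slope_set K (B_ n)))).
    apply: mono => //; first by apply: measurableU => //; exact: measurableC.
    move=> phi Cphi; have [Sphi|nS] := pselect (slope_set K (B_ n) phi); last by right.
    by left; exact: Cn.
  apply: le_trans (ultralimit_setU mU (measurableC mS)) _.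
  by rewrite [X in (_ + X)%E]S0 adde0.
apply: le_trans mAC _; rewrite [e in X in (_ <= X)%E]splitr EFinD addeA leeD2r//.
apply: le_trans mCn _.
apply: (@le_trans _ _ (\sum_(i <oo) (m (D i) + (e / 2 / (2 ^ i.+1)%:R)%:E))%E).
  apply: (@le_trans _ _ (\sum_(i <oo) m (O i))%E).
    by apply: nneseries_lim_ge => i *; exact: ultralimit_ge0.
  by apply: lee_nneseries => i *; [exact: ultralimit_ge0|have [] := OP i].
by apply: epsilon_trick; [move=> i; exact: ultralimit_ge0|exact: ltW].
Qed.

End inner_regular.

Theorem ultralimit_probability : exists P : grad_prob R k d,
  zero_off_measurable P /\ forall A, cylinders A ->
    ev A @ U --> fine (P A).
Proof.
(* [F] serves for sequences of configurations and is unrelated to [U], which lives on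
   probabilities. *)
have [F [UF Foo]] := ultraFilterLemma (@eventually_filter).
have cyl0 : cylinders set0 by exists 0%N.
have cylU : setU_closed cylinders.
  move=> A B cA cB; have [j [mA mB]] := cylinders_sub cA cB.
  by exists j; exact: measurableU.
have cylC : setC_closed cylinders by move=> A [j mA]; exists j; exact: measurableC.
have cyl_add A B : cylinders A -> cylinders B -> A `&` B = set0 ->
    m (A `|` B) = (m A + m B)%E.
  by move=> [i /subT mA] [j /subT mB]; exact: ultralimit_add.
have [P [PE P0]] := @probability_of_content Om R cylinders _ m cylinders_sigma
  cyl0 cylU cylC ultralimit_ge0 ultralimitT cyl_add (ultralimit_sub UF Foo).
exists P; split => // A cA; rewrite PE//.
by have [j /subT mA] := cA; have [] := ultralimit_cvg mA.
Qed.

End ultralimit.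

Lemma ultra_fmap (S T : Type) (U : set_system S) (f : S -> T) :
  UltraFilter U -> UltraFilter (f @ U).
Proof.
move=> UU; have PU : ProperFilter U by exact: ultra_proper.
apply: Build_UltraFilter => V PV fV; apply/seteqP; split => [B VB|B]; last exact: fV.
have [//|UB] := in_ultra_setVsetC (f @^-1` B) UU.
have VC : V (~` B) by exact: fV.
by have [x []] := filter_ex (filterI VB VC).
Qed.

Lemma cvg_initial (S : choiceType) (T : topologicalType) (f : S -> T)
    (F : set_system S) (s : S) : Filter F ->
  F --> (s : initial_topology f) <-> f @ F --> f s.
Proof.
move=> FF; split => [Fs|Ffs A /= [_ [[B Bop <-] Bfs sBfA]]].
  move=> A /(@initial_continuous S T f s) fA; exact: Fs.
apply: filterS sBfA _; apply: Ffs; exact: open_nbhs_nbhs.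
Qed.

Lemma sum_ord_ltn t n : (\sum_(i < n) (i < t) = minn t n)%N.
Proof.
by elim: n => [|n IH]; rewrite ?big_ord0 ?minn0// big_ord_recr/= IH; lia.
Qed.

(** * From probabilities of events to expectations of test functions *)

Section test_convergence.
Variables (R : realType) (k : height_kind) (d : nat).
Local Notation Om := (Omega R k d).
Local Notation P := (grad_prob R k d).

Definition expectation_of (f : Om -> R) (mu : P) : R := (\int[mu]_phi f phi)%R.

Lemma cvg_test (F : set (Om -> R)) (A : set (test_topology F))
    (U : set_system (set_type A)) (x : set_type A) : Filter U ->
  U --> (x : set_type A) <->
  forall f, F f -> (expectation_of f \o (set_val : set_type A -> P)) @ U -->
    expectation_of f (set_val x).
Proof.
move=> FU; rewrite [U --> _](propext (@cvg_initial _ _ _ _ _ _)).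
rewrite [_ --> _](propext (@cvg_sup _ _ _ _ _ _)).
split => [H f Ff|H [f Ff]].
  have := H (exist _ f (mem_set Ff)).
  by rewrite (propext (@cvg_initial _ _ _ _ _ _)).
rewrite (propext (@cvg_initial _ _ _ _ _ _)).
by apply: H; exact: set_mem.
Qed.

Lemma expectation_step (mu : P) (c e : R) (A : nat -> set Om) n :
  (forall i, measurable (A i : set (grad_space R k setT))) ->
  expectation_of (fun phi => c + \sum_(i < n) e * \1_(A i) phi) mu =
  c + \sum_(i < n) e * fine (mu (A i)).
Proof.
move=> mA.
have int (p : nat) : mu.-integrable setT (EFin \o
    (fun phi : grad_space R k setT => c + \sum_(i < p) e * \1_(A i) phi)).
  apply: (@bounded_integrable _ _ _ _ _ (`|c| + \sum_(i < p) `|e|)).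
    apply: measurable_funD => //; apply: measurable_sum => i.
    by apply: measurable_funM => //; exact: measurable_indic.
  move=> phi; apply: le_trans (ler_normD _ _) _; rewrite lerD2l.
  apply: le_trans (ler_norm_sum _ _ _) _; apply: ler_sum => i _.
  by rewrite normrM ler_piMr// indicE; case: (_ \in _); rewrite ?normr1 ?normr0.
have int1 (i : nat) : mu.-integrable setT
    (EFin \o (fun phi : grad_space R k setT => \1_(A i) phi)).
  apply: (@bounded_integrable _ _ _ _ _ 1); first exact: measurable_indic.
  by move=> phi; rewrite indicE; case: (_ \in _); rewrite ?normr1 ?normr0.
elim: n => [|n IH].
  rewrite big_ord0 addr0 /expectation_of.
  under eq_Rintegral do rewrite big_ord0 addr0.
  by rewrite Rintegral_cst//= probability_setT mulr1.
rewrite big_ord_recr/= addrA -IH /expectation_of.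
transitivity (\int[mu]_phi (c + \sum_(i < n) e * \1_(A i) phi + e * \1_(A n) phi)).
  by apply: eq_Rintegral => phi _; rewrite big_ord_recr/= addrA.
have int2 : mu.-integrable setT
    (EFin \o (fun phi : grad_space R k setT => e * \1_(A n) phi)).
  apply: (@bounded_integrable _ _ _ _ _ `|e|).
    by apply: measurable_funM => //; exact: measurable_indic.
  by move=> phi; rewrite normrM ler_piMr// indicE; case: (_ \in _); rewrite ?normr1 ?normr0.
rewrite (RintegralD measurableT (int n) int2).
congr (_ + _); rewrite RintegralZl//; congr (_ * _).
by rewrite /Rintegral integral_indic// setIT.
Qed.

(** A layer-cake sum over the events [f >= a] recovers [f] up to [e], uniformly in [mu], so
    convergence on such events gives convergence of means. *)
Lemma expectation_step_le (mu : P) (f : Om -> R) (M e : R) (n : nat) : 0 < e ->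
  measurable_fun setT (f : grad_space R k setT -> R) -> (forall phi, `|f phi| <= M) ->
  M + M <= n%:R * e ->
  `|expectation_of f mu -
    (- M + \sum_(i < n) e * fine (mu [set phi | - M + i.+1%:R * e <= f phi]))| <= e.
Proof.
move=> e0 mf fM Mn.
pose A i := [set phi : Om | - M + i.+1%:R * e <= f phi].
have mA i : measurable (A i : set (grad_space R k setT)).
  rewrite (_ : A i = setT `&` f @^-1` `[- M + i.+1%:R * e, +oo[%classic); first exact: mf.
  by apply/seteqP; split => phi; rewrite /A /= in_itv/= andbT; [move=> ?|case].
pose g (phi : Om) := - M + \sum_(i < n) e * \1_(A i) phi.
have gf phi : g phi <= f phi <= g phi + e.
  have v0 : 0 <= (f phi + M) / e.
    by rewrite divr_ge0 ?(ltW e0)//; have := fM phi; rewrite ler_norml => /andP[? _]; lra.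
  (* The number of levels not above [f phi] is the integer part of [(f phi + M) / e], so [g] rounds
     [f] down to the grid of mesh [e] that starts at [- M]. *)
  have Ai i : \1_(A i) phi = ((i < Num.truncn ((f phi + M) / e))%N)%:R :> R.
    rewrite indicE; congr ((nat_of_bool _)%:R); rewrite truncn_ge_nat// ler_pdivlMr//.
    apply/idP/idP => [/set_mem|H]; first by rewrite /A /= => ?; lra.
    by apply: mem_set; rewrite /A /=; lra.
  have sumE : \sum_(i < n) e * \1_(A i) phi = (Num.truncn ((f phi + M) / e))%:R * e.
    rewrite -mulr_sumr mulrC; congr (_ * _).
    have tn : (Num.truncn ((f phi + M) / e) <= n)%N.
      rewrite -(ler_nat R); apply: le_trans (_ : (f phi + M) / e <= _).
        by rewrite truncn_le.
      by rewrite ler_pdivrMr//; have := fM phi; rewrite ler_norml => /andP[_ ?]; lra.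
    rewrite (eq_bigr (fun i : 'I_n => ((i < Num.truncn ((f phi + M) / e))%N)%:R)); last first.
      by move=> i _; exact: Ai.
    rewrite -natr_sum; congr (_%:R).
    by rewrite sum_ord_ltn; exact/minn_idPl.
  have /andP[] := truncn_itv v0; rewrite ler_pdivlMr// ltr_pdivrMr// /g sumE.
  set t := Num.truncn _; have -> : t.+1%:R * e = t%:R * e + e.
    by rewrite -addn1 natrD mulrDl mul1r.
  by move=> H1 H2; apply/andP; split; lra.
have mg : measurable_fun setT (g : grad_space R k setT -> R).
  apply: measurable_funD => //; apply: measurable_sum => i.
  by apply: measurable_funM => //; exact: measurable_indic.
have ig : mu.-integrable setT (EFin \o (g : grad_space R k setT -> R)).
  apply: (@bounded_integrable _ _ _ _ _ (M + e)) => // phi.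
  have /andP[g1 g2] := gf phi; have := fM phi; rewrite !ler_norml => /andP[f1 f2].
  by apply/andP; split; lra.
have if_ : mu.-integrable setT (EFin \o (f : grad_space R k setT -> R)).
  exact: (@bounded_integrable _ _ _ _ _ M).
have ige : mu.-integrable setT (EFin \o (fun phi : grad_space R k setT => g phi + e)).
  apply: (@bounded_integrable _ _ _ _ _ (M + e)).
    by apply: measurable_funD.
  move=> phi; have /andP[g1 g2] := gf phi; have := fM phi; rewrite !ler_norml => /andP[f1 f2].
  by apply/andP; split; lra.
rewrite (_ : - M + _ = expectation_of g mu); last exact/esym/expectation_step.
have H1 : expectation_of g mu <= expectation_of f mu.
  by apply: le_Rintegral => // phi _; have /andP[] := gf phi.
have H2 : expectation_of f mu <= expectation_of g mu + e.
  have -> : expectation_of g mu + e = \int[mu]_phi (g phi + e).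
    rewrite RintegralD//; last exact: finite_measure_integrable_cst.
    by rewrite Rintegral_cst//= probability_setT mulr1.
  by apply: le_Rintegral => // phi _; have /andP[] := gf phi.
by rewrite ler_norml; apply/andP; split; rewrite -/(g); lra.
Qed.

Lemma expectation_cvg (U : set_system P) (nu : P) (f : Om -> R) (M : R) :
  ProperFilter U ->
  measurable_fun setT (f : grad_space R k setT -> R) -> (forall phi, `|f phi| <= M) ->
  (forall a, (fun mu : P => fine (mu [set phi | a <= f phi])) @ U -->
    fine (nu [set phi | a <= f phi])) ->
  expectation_of f @ U --> expectation_of f nu.
Proof.
move=> PU mf fM H; apply/cvgrPdist_le => e e0.
pose e3 := e / 3; have e30 : 0 < e3 by rewrite divr_gt0.
pose n := (Num.truncn ((M + M) / e3)).+1.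
have Mn : M + M <= n%:R * e3.
  by rewrite -ler_pdivrMr// ltW// truncnS_gt.
pose s (mu : P) := - M + \sum_(i < n) e3 * fine (mu [set phi | - M + i.+1%:R * e3 <= f phi]).
have sU : s @ U --> s nu.
  apply: cvgD; first exact: cvg_cst.
  elim: n {Mn s} => [|n IH].
    under eq_fun do rewrite big_ord0.
    by rewrite big_ord0; exact: cvg_cst.
  under eq_fun do rewrite big_ord_recr/=.
  rewrite big_ord_recr/=; apply: cvgD => //.
  by apply: cvgM; [exact: cvg_cst|exact: H].
near=> mu.
have sm : `|s nu - s mu| <= e3.
  by near: mu; move/cvgrPdist_le : sU; apply.
have := expectation_step_le mu e30 mf fM Mn.
have := expectation_step_le nu e30 mf fM Mn.
rewrite -/(s mu) -/(s nu); move: sm; rewrite !ler_norml.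
move=> /andP[? ?] /andP[? ?] /andP[? ?]; have : e = e3 + e3 + e3 by rewrite /e3; lra.
by move=> ->; apply/andP; split; lra.
Unshelve. all: by end_near. Qed.

(** A gradient function is unchanged by recentring the heights at [b], and the recentred heights on
    [Lam] are increments inside [Del]. *)
Lemma cylinder_grad_measurable (f : Om -> R) (Lam Del : {fset Zd d}) b :
  measurable_fun setT (f : coord_space R k [set` Lam] -> R) ->
  measurable_fun setT (f : grad_space R k setT -> R) ->
  (Lam `<=` Del)%fset -> b \in Del ->
  measurable_fun setT (f : grad_space R k [set` Del] -> R).
Proof.
move=> mc mg /fsubsetP LD bD.
pose c (phi : Om) : Om := fun x => height_sub (phi x) (phi b).
have -> : f = f \o c.
  apply/funext => phi /=.
  apply: (grad_fun_invariant (S := setT) (F := f)) => // x y _ _.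
  by apply: height_val_inj; rewrite !height_valB; ring.
apply: (@measurableT_comp _ _ _ _ _ _ (f : coord_space R k [set` Lam] -> R)) => //.
apply: (@measurability _ _ _ (coord_space R k [set` Lam]) setT
  (c : grad_space R k [set` Del] -> coord_space R k [set` Lam]) (coord_generator [set` Lam]) erefl).
move=> _ [_ [x /= xL [B mB <-]] <-]; rewrite !setTI.
have := @measurable_grad_space R k d [set` Del] b x bD (LD _ xL) measurableT B mB.
by rewrite setTI.
Qed.

Lemma grad_coord_measurable (f : Om -> R) (Lam : {fset Zd d}) :
  measurable_fun setT (f : grad_space R k [set` Lam] -> R) ->
  measurable_fun setT (f : coord_space R k [set` Lam] -> R).
Proof.
move=> mf _ B mB; have := mf measurableT B mB; rewrite !setTI.
apply: smallest_sub; first exact: sigma_algebra_measurable.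
move=> _ [[x y] /= [xL yL] [D mD <-]]; rewrite setTI.
have mx z : z \in Lam -> measurable_fun setT (fun phi : coord_space R k [set` Lam] => (phi : Om) z).
  move=> zL _ V mV; rewrite setTI; apply: sub_sigma_algebra.
  by exists z => //; exists V => //; rewrite setTI.
have := measurable_height_sub (mx y yL) (mx x xL) => /(_ measurableT D mD).
by rewrite setTI.
Qed.

End test_convergence.

(** * Limits of measures in a level set *)

Section free_energy_levels.
Variables (R : realType) (k : height_kind) (d : nat).
Local Notation Om := (Omega R k d).
Local Notation P := (grad_prob R k d).
Variables (L : set (Zd d)) (Psi Xi Phi : potential R k d) (K : R) (N : nat) (b : nat -> R -> R).
Hypotheses (N0 : (0 < N)%N) (LN : forall v : Zd d, L (v *+ N)).
Hypothesis PsiP : periodic_gradient_potential L Psi.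
Hypothesis Psi_ge0 : forall Lam phi, (0 <= Psi Lam phi)%E.
Hypothesis XiP : periodic_gradient_potential L Xi.
Hypothesis Xi_norm : (potential_norm Xi < +oo)%E.
Hypothesis PhiE : forall Lam phi, Phi Lam phi = (Psi Lam phi + Xi Lam phi)%E.

Definition level (C : R) : set P := [set mu | invariant_grad_prob L mu /\
  forall j, (dv Phi K (box d (j.+1 * N)) mu <= (b j C)%:E)%E].

(** The cube of coordinates from [- j * N] to [(j + 1) * N - 1]. The boxes exhaust only an orthant;
    these translates under [L] exhaust the whole lattice. *)
Definition window j : {fset Zd d} :=
  shift_fset (const_mx (- j%:Z) *+ N) (box d (j.*2.+1 * N)).

Lemma mem_window j x : (x \in window j) =
  [forall i, - (j * N)%N%:Z <= x ord0 i < (j.+1 * N)%N%:Z].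
Proof.
rewrite mem_shift_fset mem_box; apply/forallP/forallP => H i; have := H i;
rewrite !mxE mulmxnE mxE -[_ *+ N]mulr_natr natz mulNr -PoszM;
rewrite -muln2 !mulSn ![(_ * 2 * N)%N]mulnAC muln2 -addnn;
move: (x ord0 i) (j * N)%N => z a; lia.
Qed.

Lemma window_mono i j : (i <= j)%N -> (window i `<=` window j)%fset.
Proof.
move=> ij; apply/fsubsetP => x; rewrite !mem_window => /forallP H; apply/forallP => l.
have := H l; have : (i * N <= j * N)%N by rewrite leq_mul2r ij orbT.
rewrite !mulSn; move: (x ord0 l) (i * N)%N (j * N)%N => z a c; lia.
Qed.

Lemma fset_window (Lam : {fset Zd d}) : exists j, (Lam `<=` window j)%fset.
Proof.
exists (\max_(x <- enum_fset Lam) l1 x)%N; apply/fsubsetP => x xL.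
rewrite mem_window; apply/forallP => i.
have : (`|x ord0 i| <= \max_(x <- enum_fset Lam) l1 x)%N.
  apply: leq_trans (@leq_bigmax_seq _ _ xpredT (@l1 d) x xL isT).
  by rewrite /l1 (bigD1 i)//= leq_addr.
set a := (\max_(_ <- _) _)%N; have : (a <= a * N)%N by rewrite leq_pmulr.
rewrite mulSn; move: (a * N)%N => c; move: (x ord0 i) => z; lia.
Qed.

Lemma window_ex x : exists j, x \in window j.
Proof. by have [j] := fset_window [fset x]%fset; rewrite fsub1set; exists j. Qed.

(** The side of the window is [j.*2.+1 * N], whence the index [j.*2]. *)
Lemma dv_window C j mu : level C mu -> (dv Phi K (window j) mu <= (b j.*2 C)%:E)%E.
Proof.
move=> [muP le]; rewrite (dv_shift PsiP XiP PhiE) //; apply/fset0Pn; exists 0.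
by apply: zero_box; rewrite muln_gt0 N0.
Qed.

Lemma level_slope C j mu : level C mu -> mu (~` slope_set K (window j)) = 0%E.
Proof.
move=> muC; have := dv_window j muC; apply: contraPeq => nz.
have : (0 < mu (~` slope_set K (window j)))%E.
  by rewrite lt0e nz /= measure_ge0.
by move=> /(dv_infinite PsiP Psi_ge0 XiP Xi_norm PhiE) ->.
Qed.

(** By dominated convergence the tilted masses of [F n] in the slope set tend to zero, and
    [dv_uniform_ac] turns this into a bound common to all measures of the level. *)
Lemma level_uniform_ac C j (F : (set Om)^nat) :
  (forall n, measurable (F n : set (grad_space R k [set` window j]))) ->
  nonincreasing_seq F -> \bigcap_n F n = set0 ->
  forall e : R, 0 < e -> exists n, level C `<=` [set mu : P | (mu (F n) <= e%:E)%E].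
Proof.
move=> mF ndF F0 e e0.
have [delta delta0 ac] := dv_uniform_ac PsiP Psi_ge0 XiP Xi_norm PhiE K (window j) (b j.*2 C) e0.
set nu := grad_ref_measure R k (window j) in ac.
set S := slope_set K (window j) in ac.
set w := (fun phi => expeR (0%:E - energy Phi (window j) phi)) in ac.
suff [n Fn] : exists n, (\int[nu]_(phi in S `&` F n) w phi <= delta%:E)%E.
  by exists n => mu muC; apply: ac Fn => //; exact: dv_window.
have [Eb Wb] := energy_ge Psi_ge0 XiP Xi_norm PhiE (window j).
have mE := @measurable_energy R k d L Psi Xi Phi PsiP XiP PhiE (window j).
have mS : measurable (S : set (grad_space R k [set` window j])).
  exact: (@measurable_slope_set R k d K (window j)).
have mw : measurable_fun setT (w : grad_space R k [set` window j] -> \bar R).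
  rewrite /w; apply: measurableT_comp; first exact: measurable_expeR.
  by apply: emeasurable_funB => //; exact: measurable_cst.
have [Z Z0 ZS] := @tilt_mass_fin _ _ _ nu (energy Phi (window j)) S Eb mS mE Wb
  (@grad_ref_measure_slope_set R k d K (window j)) 0.
have iw : nu.-integrable S w.
  apply/integrableP; split; first exact: measurable_funTS.
  under eq_integral do rewrite gee0_abs ?expeR_ge0//.
  exact: le_lt_trans ZS (ltry _).
apply: ecvg0_small => //.
pose f_ n (phi : Om) := (w phi * (\1_(F n) phi)%:E)%E.
have E n : (\int[nu]_(phi in S `&` F n) w phi = \int[nu]_(phi in S) f_ n phi)%E.
  rewrite integral_mkcondr; apply: eq_integral => phi _.
  by rewrite patchE /f_ indicE; case: (_ \in _); rewrite ?mule1 ?mule0.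
under eq_fun do rewrite E.
have [|||||_ _] := @dominated_convergence _ _ _ nu S mS f_ (cst 0%E) w.
- move=> n; apply: emeasurable_funM; first exact: measurable_funTS.
  by apply/measurable_EFinP; exact: measurable_indic.
- exact: measurable_cst.
- apply: aeW => phi _.
  have [n nF] : exists n, ~ F n phi.
    apply/existsNP => H; have : (\bigcap_n F n) phi by move=> n _; exact: H.
    by rewrite F0.
  apply: cvg_near_cst; exists n => // i /= ni.
  rewrite /f_ indicE memNset ?mule0// => Fi; apply: nF.
  by move/subsetPset : (ndF _ _ ni); apply.
- exact: iw.
- apply: aeW => phi n _; rewrite /f_ abseM gee0_abs ?expeR_ge0// indicE.
  by case: (_ \in _); rewrite /= ?normr1 ?normr0 ?mule1 ?mule0// expeR_ge0.
- by rewrite integral_cst// mul0e.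
Qed.

(** The point is that the limit stays in the level: invariance and the bounds on [dv] are both
    statements about cylinder events or cylinder functions, where the limit is explicit. *)
Lemma level_closed (U : set_system P) C : UltraFilter U -> U (level C) ->
  exists2 nu, level C nu & forall f, bounded_grad_cylinder f ->
    expectation_of f @ U --> expectation_of f nu.
Proof.
move=> UU UC; have PU : ProperFilter U by exact: ultra_proper.
have [||nu [nu0 nuU]] := ultralimit_probability (K := K) UU window_mono window_ex.
- move=> j F mF ndF F0 e e0; have [n Fn] := level_uniform_ac C mF ndF F0 e0.
  by exists n; apply: filterS Fn UC.
- by move=> j; apply: filterS UC => mu; exact: level_slope.
have cvg f : bounded_grad_cylinder f -> expectation_of f @ U --> expectation_of f nu.
  move=> [[Lam mc] mg [M fM]].
  (* The origin is added as a base point, since [Lam] may be empty. *)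
  have [j Lj] := fset_window (Lam `|` [fset 0])%fset.
  have mj : measurable_fun setT (f : grad_space R k [set` window j] -> R).
    apply: (cylinder_grad_measurable mc mg (b := 0)).
      by apply: fsubset_trans Lj; exact: fsubsetUl.
    by apply: (fsubsetP Lj); rewrite !inE eqxx orbT.
  apply: (expectation_cvg PU mg fM) => a; apply: nuU; exists j.
  rewrite (_ : [set phi | _] = setT `&` f @^-1` `[a, +oo[%classic); first exact: mj.
  by apply/seteqP; split => phi; rewrite /= in_itv/= andbT; [move=> ?|case].
exists nu => //; split; first split => //.
  move=> t Lt A mA.
  have msh : measurable_fun setT
      (shift_height t : grad_space R k setT -> grad_space R k setT).
    exact: measurable_shift_height.
  (* A shifted cylinder is a cylinder in a larger window, so invariance passes to the limit there.
     Cylinders are stable under intersection, and uniqueness of measures gives the rest. *)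
  have same (B : set Om) : cylinders window B ->
      nu (shift_height t @^-1` B) = nu B.
    move=> cB; have [j mB] := cB.
    have mB' : measurable (B : set (grad_space R k setT)) := grad_space_sub mB.
    have [i ti] := fset_window (shift_fset t (window j)).
    have cB' : cylinders window (shift_height t @^-1` B).
      exists i; have mti : measurable_fun setT
          (shift_height t : grad_space R k [set` window i] -> grad_space R k [set` window j]).
        apply: measurable_shift_height => x xj; apply: (fsubsetP ti).
        by rewrite mem_shift_fset addrK.
      by have := mti measurableT B mB; rewrite setTI.
    have mB'' : measurable (shift_height t @^-1` B : set (grad_space R k setT)).
      by have [l] := cB'; exact: grad_space_sub.
    rewrite -[LHS]fineK ?fin_num_measure// -[RHS]fineK ?fin_num_measure//; congr EFin.
    apply: (cvg_unique (@Rhausdorff R) (nuU _ cB')).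
    apply: cvg_trans (nuU _ cB); apply: near_eq_cvg.
    by apply: filterS UC => mu [[_ inv] _] /=; rewrite inv.
  have [m1 m1E] : exists m1 : {measure set (grad_space R k setT) -> \bar R},
      forall B, m1 B = nu (shift_height t @^-1` B).
    by exists (pushforward nu (shift_height t : grad_space R k setT -> grad_space R k setT)).
  have mG : @measurable _ (grad_space R k setT) = <<s cylinders window >>.
    exact/esym/(@cylinders_sigma R k d window window_mono window_ex).
  have GI : setI_closed (@cylinders R k d window).
    move=> B D cB cD; have [j [mB mD]] := cylinders_sub window_mono cB cD.
    by exists j; exact: measurableI.
  have GT (i : nat) : @cylinders R k d window setT by exists 0%N.
  have Gc : \bigcup_(i : nat) [set: grad_space R k [set: Zd d]] = setT.
    by apply/seteqP; split => // phi _; exists 0%N.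
  have e1 (B : set Om) : cylinders window B -> m1 B = nu B by move=> cB; rewrite m1E same.
  have fin1 (i : nat) : (m1 setT < +oo)%E.
    by rewrite m1E preimage_setT probability_setT ltry.
  have mu1 := measure_unique _ _ mG GI GT Gc m1 nu e1 fin1 A mA.
  exact: etrans (esym (m1E A)) mu1.
(* The bound on [dv] is passed to the limit test by test. *)
move=> j; apply: ge_ereal_sup => _ [g tg <-].
have [mg [M gM] _] := tg.
have mg' : measurable_fun setT (g : grad_space R k setT -> R) := dv_test_measurable tg.
have gcyl : bounded_grad_cylinder g.
  split => //; last by exists M.
  by exists (box d (j.+1 * N)); exact: grad_coord_measurable.
have fin (mu : P) : (\int[mu]_phi (g phi)%:E)%E = (expectation_of g mu)%:E.
  by rewrite fineK//; apply: integrable_fin_num => //; exact: (dv_test_integrable mu tg).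
rewrite fin lee_fin; apply: (cvgr_to_le (cvg _ gcyl)).
apply: filterS UC => mu [_ /(_ j) le].
by rewrite -lee_fin -fin; apply: le_trans le; exact: dv_test_ub.
Unshelve. all: exact: measurable_shift_height. Qed.

End free_energy_levels.

(** * Compactness, metrizability and the two topologies *)

Section compact_topology.
Variables (S T : topologicalType).

(** Reduces continuity and semicontinuity to statements on ultrafilters, the form in which limits
    inside the level sets are available. *)
Lemma nbhs_ultra (x : T) (V : set T) : ~ nbhs x V ->
  exists2 U : set_system T, UltraFilter U & U --> x /\ U (~` V).
Proof.
move=> nV; pose F := filter_from (nbhs x) (fun W => W `&` ~` V).
have FF : ProperFilter F.
  apply: filter_from_proper; last first.
    move=> W Wx; apply/set0P/eqP => W0; apply: nV; apply: filterS Wx => y Wy.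
    by apply: contrapT => nVy; have : set0 y by rewrite -W0.
  apply: filter_from_filter; first by exists setT; exact: filterT.
  by move=> W X Wx Xx; exists (W `&` X); [exact: filterI|move=> y [[]]].
have [U [UU FU]] := ultraFilterLemma FF; have PU : ProperFilter U by exact: ultra_proper.
exists U => //; split.
  by move=> W Wx; apply: FU; exists W => // y [].
by apply: FU; exists setT; [exact: filterT|move=> y []].
Qed.

Lemma compact_inverse_continuous (h : S -> T) (g : T -> S) : compact [set: S] ->
  hausdorff_space T -> continuous h -> cancel h g -> cancel g h -> continuous g.
Proof.
move=> cS hT ch hK gK y V gV; apply: contrapT => /nbhs_ultra[U UU [Uy UV]].
have PU : ProperFilter U by exact: ultra_proper.
have gUU : UltraFilter (g @ U) by exact: ultra_fmap.
have PgU : ProperFilter (g @ U) by exact: ultra_proper.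
move: cS; rewrite compact_ultra => /(_ (g @ U) gUU (@filterT _ (g @ U) _)) [x [_ gUx]].
have hx : h x = y.
  apply: hT => A B nA nB.
  have UA : U A.
    have UhA : U (fun z => A (h (g z))) by exact: (gUx _ (@ch x A nA)).
    by apply: filterS UhA => z; rewrite gK.
  have UB : U B by exact: Uy.
  exact: (filter_ex (filterI UA UB)).
have : U (g @^-1` V) by apply: gUx; rewrite -(hK x) hx.
by move=> UV'; have [z []] := filter_ex (filterI UV UV').
Qed.

End compact_topology.

(** * Metrizing a compact space by countably many functions *)

Section metrization.
Variables (R : realType) (T : topologicalType) (f : nat -> T -> R).
Hypotheses (f1 : forall i x, `|f i x| <= 1).
Hypothesis fsep : forall x y, (forall i, f i x = f i y) -> x = y.
Hypothesis fc : forall i, continuous (f i).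

(** A copy of [T] that carries the metric, while [T] keeps its topology; the identity maps compare
    the two. *)
Definition embedded of (forall i x, `|f i x| <= 1) &
  (forall x y, (forall i, f i x = f i y) -> x = y) : Type := T.
Local Notation M := (embedded f1 fsep).
HB.instance Definition _ := Choice.copy M T.

Let term (x y : T) i : R := `|f i x - f i y| / 2 ^+ i.
(** A supremum of weighted differences needs no convergence of series and inherits the triangle
    inequality termwise. *)
Definition embed_dist (x y : M) : R := sup (range (term x y)).

Let term_le2 x y i : term x y i <= 2.
Proof.
rewrite /term ler_pdivrMr ?exprn_gt0// (le_trans (ler_normB _ _))//.
apply: (@le_trans _ _ 2); first by rewrite -[2]/(1 + 1) lerD.
by rewrite ler_pMr// exprn_ege1// ler1n.
Qed.

Let term_sup x y : has_sup (range (term x y)).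
Proof.
by split; [exists (term x y 0%N); exists 0%N|exists 2 => _ [i _ <-]].
Qed.

Lemma embed_dist_ge x y i : `|f i x - f i y| / 2 ^+ i <= embed_dist x y.
Proof. by apply: ub_le_sup; [exact: (term_sup x y).2|exists i]. Qed.

Lemma embed_dist_le x y (e : R) : (forall i, `|f i x - f i y| / 2 ^+ i <= e) ->
  embed_dist x y <= e.
Proof. by move=> H; apply: ge_sup; [exact: (term_sup x y).1|move=> _ [i _ <-]; exact: H]. Qed.

Let embed_dist0 x : embed_dist x x = 0.
Proof.
apply/eqP; rewrite eq_le; apply/andP; split.
  by apply: embed_dist_le => i; rewrite subrr normr0 mul0r.
by have := embed_dist_ge x x 0%N; rewrite subrr normr0 mul0r.
Qed.

Let embed_dist_eq0 x y : embed_dist x y = 0 -> x = y.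
Proof.
move=> xy0; apply: fsep => i; apply/eqP; rewrite -subr_eq0 -normr_le0.
have := embed_dist_ge x y i; rewrite xy0 ler_pdivrMr ?exprn_gt0//.
by rewrite mul0r.
Qed.

Let embed_dist_sym x y : embed_dist x y = embed_dist y x.
Proof.
by congr sup; apply/seteqP; split => _ [i _ <-]; exists i => //; rewrite /term distrC.
Qed.

Let embed_dist_triangle y x z : embed_dist x z <= embed_dist x y + embed_dist y z.
Proof.
apply: embed_dist_le => i.
apply: le_trans (lerD (embed_dist_ge x y i) (embed_dist_ge y z i)).
by rewrite -mulrDl ler_pM2r ?invr_gt0 ?exprn_gt0// ler_distD.
Qed.

HB.instance Definition _ := isMetric.Build R M embed_dist0 embed_dist_eq0
  embed_dist_sym embed_dist_triangle.

Lemma embed_continuous : continuous (id : T -> M).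
Proof.
move=> x V /nbhs_ballP[e /= e0 eV].
(* From index [n] on every term is at most [2 / 2 ^+ n], so nearness in finitely many [f i]
   suffices. *)
have [n ne] : exists n, 2 / 2 ^+ n <= e / 2.
  have [n _ /(_ n (leqnn n)) Hn] := nbhs_infty_ger (4 / e).
  exists n; rewrite ler_pdivrMr ?exprn_gt0//.
  have : n%:R <= 2 ^+ n :> R by rewrite -natrX ler_nat ltnW// ltn_expl.
  move=> /(le_trans Hn); rewrite ler_pdivrMr// => H; lra.
have near_f p : \forall y \near x, forall i, (i < p)%N -> `|f i x - f i y| < e / 2.
  elim: p => [|p IH]; first exact: filterE.
  have /cvgrPdist_lt/(_ (e / 2)) H := @fc p x.
  apply: filterS2 (IH) (H _) => [y Hy Hp i|]; last by rewrite divr_gt0.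
  by rewrite ltnS leq_eqVlt => /orP[/eqP ->|/Hy].
apply: filterS (near_f n) => y Hy; apply: eV; rewrite ballEmdist /=.
apply: (@le_lt_trans _ _ (e / 2)); last by rewrite ltr_pdivrMr// ltr_pMr// ltr1n.
apply: embed_dist_le => i; case: (ltnP i n) => [/Hy/ltW le|ni].
  apply: le_trans le; rewrite ler_pdivrMr ?exprn_gt0// ler_peMr// exprn_ege1// ler1n.
  by [].
apply: le_trans ne; apply: (@le_trans _ _ (2 / 2 ^+ i)).
  rewrite ler_pM2r ?invr_gt0 ?exprn_gt0//.
  by rewrite (le_trans (ler_normB _ _))// -[2]/(1 + 1) lerD.
rewrite ler_pM2l// lef_pV2 ?posrE ?exprn_gt0// ler_weXn2l// ler1n.
by [].
Qed.

Hypothesis cT : compact [set: T].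

Lemma embed_compact : compact [set: M].
Proof.
have -> : [set: M] = (id : T -> M) @` [set: T] by rewrite image_id.
apply: continuous_compact cT; apply: continuous_subspaceT; exact: embed_continuous.
Qed.

Lemma embed_inverse_continuous : continuous (id : M -> T).
Proof.
exact: (@compact_inverse_continuous T M id id cT (@metric_hausdorff R M) embed_continuous).
Qed.

(** Without a finite net the complements of finite unions of [e]-balls generate a proper filter; an
    ultrafilter above it would converge to a point and avoid the ball around that point. *)
Lemma embed_net (e : R) : 0 < e -> exists D : {fset M}, forall x, exists2 y, y \in D & ball y e x.
Proof.
move=> e0; apply: contrapT => /forallNP noD.
pose F := filter_from [set: {fset M}] (fun D => [set x | forall y, y \in D -> ~ ball y e x]).
have FF : ProperFilter F.
  apply: filter_from_proper; last first.
    move=> D _; have /existsNP[x nx] := noD D; exists x => y yD yx.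
    by apply: nx; exists y.
  apply: filter_from_filter; first by exists fset0.
  move=> D1 D2 _ _; exists (D1 `|` D2)%fset => // x H.
  by split=> y yD; apply: H; rewrite inE yD ?orbT.
have [U [UU FU]] := ultraFilterLemma FF; have PU : ProperFilter U by exact: ultra_proper.
have := embed_compact; rewrite compact_ultra => /(_ U UU (@filterT _ U _))[x [_ Ux]].
have Ux1 : U (ball x e) by apply: Ux; exact: nbhsx_ballx.
have Ux2 : U [set y | forall z, z \in [fset x]%fset -> ~ ball z e y].
  by apply: FU; exists [fset x]%fset.
have [y [xy nxy]] := filter_ex (filterI Ux1 Ux2).
by apply: (nxy x) xy; rewrite inE.
Qed.

Lemma compact_polish : polish R T.
Proof.
have inv0 (n : nat) : 0 < n.+1%:R^-1 :> R by rewrite invr_gt0 ltr0n.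
have /choice[D DP] (n : nat) := embed_net (inv0 n).
split.
  exists (\bigcup_n [set` D n] : set T).
    by apply: bigcup_countable => // n _; exact/finite_set_countable/finite_fset.
  move=> O [x Ox] oO.
  have : nbhs (x : M) O by apply: embed_inverse_continuous; exact: open_nbhs_nbhs.
  move=> /nbhs_ballP[e /= e0 eO].
  have [n ne] : exists n, n.+1%:R^-1 < e.
    by have [n] := ltr_add_invr e0; rewrite add0r; exists n.
  have [y yD yx] := DP n x.
  exists y; split; last by exists n.
  by apply: eO; apply: ball_sym; apply: le_ball yx; exact: ltW.
exists (M : metricType R), id, id; split; first split => //.
- exact: embed_continuous.
- exact: embed_inverse_continuous.
move=> F PF /cauchyP cF.
(* An ultrafilter above [F] converges by compactness, and the Cauchy property carries the limit over
   to [F]. *)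
have [U [UU FU]] := ultraFilterLemma PF; have PU : ProperFilter U by exact: ultra_proper.
have := embed_compact; rewrite compact_ultra => /(_ U UU (@filterT _ U _))[x [_ Ux]].
exists x => V /nbhs_ballP[e /= e0 eV].
have e3 : 0 < e / 3 by rewrite divr_gt0.
have [y Fy] := cF (e / 3) e3.
have [z [zy zx]] := filter_ex (filterI (FU _ Fy) (Ux _ (nbhsx_ballx x _ e3))).
apply: filterS Fy => w yw; apply: eV.
have -> : e = e / 3 + e / 3 + e / 3 by lra.
by apply: ball_triangle yw; apply: ball_triangle zx (ball_sym zy).
Qed.

End metrization.

Lemma separating_hausdorff (R : realType) (T : topologicalType) (I : Type) (f : I -> T -> R) :
  (forall x y, (forall i, f i x = f i y) -> x = y) ->
  (forall i, continuous (f i)) -> hausdorff_space T.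
Proof.
move=> fsep fc x y xy; apply: fsep => i; apply: (@Rhausdorff R) => A B nA nB.
have [z [zA zB]] := xy _ _ (@fc i x A nA) (@fc i y B nB).
by exists (f i z).
Qed.

(** The topologies live on bundled probabilities, so Hausdorff separation needs equality of records;
    all fields but the set function are proofs. *)
Lemma probability_eq d (T : measurableType d) (R : realType) (mu nu : probability T R) :
  (forall A, mu A = nu A) -> mu = nu.
Proof.
move: mu nu => [m1 [[a1 i1] [b1] [c1] [e1] [f1] [g1] [h1]]].
move=> [m2 [[a2 i2] [b2] [c2] [e2] [f2] [g2] [h2]]] H.
have mm : m1 = m2 by apply/funext.
subst m2; rewrite (Prop_irrelevance a2 a1) (Prop_irrelevance i2 i1).
rewrite (Prop_irrelevance b2 b1) (Prop_irrelevance c2 c1) (Prop_irrelevance e2 e1).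
by rewrite (Prop_irrelevance f2 f1) (Prop_irrelevance g2 g1) (Prop_irrelevance h2 h1).
Qed.

(** * A countable separating family of continuous cylinder functions *)

Section separating_family.
Variables (R : realType) (k : height_kind) (d : nat).
Local Notation Om := (Omega R k d).
Local Notation P := (grad_prob R k d).
Implicit Types (l : seq (Zd d * Zd d * rat)).

Definition slope (p : Zd d * Zd d) (phi : Om) : R :=
  height_val (height_sub (phi p.2) (phi p.1)).

(** A Lipschitz approximation of the indicator of [a <= v], equal to it for all large [n] at each
    fixed [v]. *)
Definition ramp n (a v : R) : R := Num.min 1 (Num.max 0 (1 + n%:R * (v - a))).

(** Rational thresholds keep the family countable. As [n] grows the products converge to the
    indicators of the sets [slopes_ge l], a pi-system that generates the gradient sigma-algebra. *)
Definition ramps n l (phi : Om) : R := \prod_(p <- l) ramp n (ratr p.2) (slope p.1 phi).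

Definition slopes_ge l : set Om := [set phi | forall p, p \in l -> ratr p.2 <= slope p.1 phi].

Lemma ramp01 n a v : 0 <= ramp n a v <= 1.
Proof. by rewrite /ramp le_min ler01 le_max lexx/= ge_min lexx. Qed.

Lemma ramps01 n l phi : 0 <= ramps n l phi <= 1.
Proof.
rewrite /ramps; elim/big_ind: _ => [|x y /andP[x0 x1] /andP[y0 y1]|p _].
- by rewrite ler01 lexx.
- by rewrite mulr_ge0//= mulr_ile1.
- exact: ramp01.
Qed.

Lemma ramp_ge n a v : a <= v -> ramp n a v = 1.
Proof.
move=> av; apply/min_idPl; rewrite le_max; apply/orP; right.
by rewrite lerDl mulr_ge0// subr_ge0.
Qed.

Lemma ramp_lt a v : v < a -> \forall n \near \oo, ramp n a v = 0.
Proof.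
move=> va; near=> n; have : (a - v)^-1 <= n%:R by near: n; exact: nbhs_infty_ger.
have av : 0 < a - v by rewrite subr_gt0.
rewrite -[(a - v)^-1]mul1r ler_pdivrMr// => H.
rewrite /ramp; have -> : Num.max 0 (1 + n%:R * (v - a)) = 0.
  by apply/max_idPl; lra.
by apply/min_idPr.
Unshelve. all: by end_near. Qed.

Lemma ramps_cvg l phi : \forall n \near \oo, ramps n l phi = \1_(slopes_ge l) phi.
Proof.
have [H|nH] := pselect (slopes_ge l phi).
  apply: nearW => n; rewrite indicE mem_set// /ramps big_seq big1// => p pl.
  by apply: ramp_ge; exact: H.
have /existsNP[p /not_implyP[pl /negP]] := nH; rewrite -ltNge => /ramp_lt lt.
apply: filterS lt => n rn; rewrite indicE memNset// /ramps (big_rem p)//=.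
by rewrite rn mul0r.
Qed.

Lemma measurable_slope (S : set (Zd d)) p : S p.1 -> S p.2 ->
  measurable_fun setT (slope p : grad_space R k S -> R).
Proof.
move=> S1 S2; apply: (measurableT_comp (@measurable_height_val R k)).
exact: measurable_grad_space.
Qed.

Lemma measurable_ramps n l (S : set (Zd d)) :
  (forall p, p \in l -> S p.1.1 /\ S p.1.2) ->
  measurable_fun setT (ramps n l : grad_space R k S -> R).
Proof.
elim: l => [|p l IH] H.
  rewrite (_ : ramps n [::] = cst 1); first exact: measurable_cst.
  by apply/funext => phi; rewrite /ramps big_nil.
rewrite (_ : ramps n (p :: l) = (fun phi => ramp n (ratr p.2) (slope p.1 phi) * ramps n l phi)).
  have [S1 S2] := H p (mem_head _ _).
  apply: measurable_funM; last by apply: IH => p' p'l; apply: H; rewrite in_cons p'l orbT.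
  apply: measurable_minr; first exact: measurable_cst.
  apply: measurable_maxr; first exact: measurable_cst.
  apply: measurable_funD; first exact: measurable_cst.
  apply: measurable_funM; first exact: measurable_cst.
  by apply: measurable_funB; [exact: measurable_slope|exact: measurable_cst].
by apply/funext => phi; rewrite /ramps big_cons.
Qed.

Lemma ramps_cylinder n l : bounded_grad_cylinder (ramps n l).
Proof.
split.
- exists ([fset p.1.1 | p in l] `|` [fset p.1.2 | p in l])%fset.
  apply: grad_coord_measurable; apply: measurable_ramps => p pl.
  by split; rewrite /= inE; apply/orP; [left|right]; exact: in_imfset.
- exact: measurable_ramps.
- exists 1 => phi; have /andP[H0 H1] := ramps01 n l phi.
  by rewrite ger0_norm.
Qed.

Lemma sup_norm_continuousM (f g : Om -> R) : (forall phi, `|f phi| <= 1) ->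
  (forall phi, `|g phi| <= 1) -> sup_norm_continuous f -> sup_norm_continuous g ->
  sup_norm_continuous (fun phi => f phi * g phi).
Proof.
move=> f1 g1 fc gc phi e e0; have e2 : 0 < e / 2 by rewrite divr_gt0.
have [d1 d10 H1] := fc phi _ e2; have [d2 d20 H2] := gc phi _ e2.
exists (Num.min d1 d2); first by rewrite lt_min d10.
move=> psi H.
have {}H1 : `|f psi - f phi| < e / 2.
  by apply: H1 => x; have := H x; rewrite lt_min => /andP[].
have {}H2 : `|g psi - g phi| < e / 2.
  by apply: H2 => x; have := H x; rewrite lt_min => /andP[].
have -> : f psi * g psi - f phi * g phi =
    f psi * (g psi - g phi) + (f psi - f phi) * g phi by ring.
apply: le_lt_trans (ler_normD _ _) _; rewrite !normrM [e]splitr.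
apply: ler_ltD; first by apply: le_trans (ltW H2); rewrite ler_piMl.
by apply: le_lt_trans H1; rewrite ler_piMr.
Qed.

Lemma ramp_lipschitz n a v w : `|ramp n a w - ramp n a v| <= n%:R * `|w - v|.
Proof.
have clip (x y : R) : `|Num.min 1 (Num.max 0 x) - Num.min 1 (Num.max 0 y)| <= `|x - y|.
  have cP (z : R) : [\/ z <= 0 /\ Num.min 1 (Num.max 0 z) = 0,
      0 <= z <= 1 /\ Num.min 1 (Num.max 0 z) = z |
      1 <= z /\ Num.min 1 (Num.max 0 z) = 1].
    have [z0|z0] := leP 0 z; last by constructor 1; split; [exact: ltW|exact/min_idPr].
    have [z1|z1] := leP 1 z; first by constructor 3.
    by constructor 2; rewrite ltW.
  rewrite ler_norml; have := ler_norm (x - y); have := ler_norm (y - x).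
  rewrite distrC => h1 h2; apply/andP.
  by case: (cP x) => -[? ->]; case: (cP y) => -[? ->]; split; lra.
rewrite /ramp; apply: le_trans (clip _ _) _.
have -> : 1 + n%:R * (w - a) - (1 + n%:R * (v - a)) = n%:R * (w - v) by ring.
by rewrite normrM ger0_norm.
Qed.

Lemma ramp_continuous n p (a : R) : sup_norm_continuous (fun phi => ramp n a (slope p phi)).
Proof.
move=> phi e e0; have n1 : 0 < n.+1%:R :> R by rewrite ltr0n.
(* [n.+1] avoids division by zero; the factor 2 is for the two endpoints of a slope. *)
exists (e / n.+1%:R / 2); first by rewrite !divr_gt0.
move=> psi H; apply: le_lt_trans (ramp_lipschitz _ _ _ _) _.
have -> : slope p psi - slope p phi = (height_val (psi p.2) - height_val (phi p.2)) -
    (height_val (psi p.1) - height_val (phi p.1)).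
  by rewrite /slope !height_valB; ring.
have lt : `|(height_val (psi p.2) - height_val (phi p.2)) -
    (height_val (psi p.1) - height_val (phi p.1))| < e / n.+1%:R.
  apply: le_lt_trans (ler_normB _ _) _; rewrite [e / _]splitr.
  by apply: ltrD; exact: H.
apply: (@le_lt_trans _ _ (n.+1%:R * `|height_val (psi p.2) - height_val (phi p.2) -
    (height_val (psi p.1) - height_val (phi p.1))|)).
  by rewrite ler_wpM2r// ler_nat.
by rewrite mulrC -ltr_pdivlMr.
Qed.

Lemma ramps_continuous n l : sup_norm_continuous (ramps n l).
Proof.
elim: l => [|p l IH].
  rewrite (_ : ramps n [::] = fun=> 1); last by apply/funext => phi; rewrite /ramps big_nil.
  by move=> phi e e0; exists 1 => // psi _; rewrite subrr normr0.
rewrite (_ : ramps n (p :: l) = (fun phi => ramp n (ratr p.2) (slope p.1 phi) * ramps n l phi)).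
  apply: sup_norm_continuousM => //; last exact: ramp_continuous.
    by move=> phi; have /andP[H0 H1] := ramp01 n (ratr p.2) (slope p.1 phi); rewrite ger0_norm.
  by move=> phi; have /andP[H0 H1] := ramps01 n l phi; rewrite ger0_norm.
by apply/funext => phi; rewrite /ramps big_cons.
Qed.

Lemma measurable_slopes_ge l : measurable (slopes_ge l : set (grad_space R k [set: Zd d])).
Proof.
elim: l => [|p l IH].
  by rewrite (_ : slopes_ge [::] = setT); [exact: measurableT|apply/seteqP; split].
rewrite (_ : slopes_ge (p :: l) = (setT `&` slope p.1 @^-1` `[ratr p.2, +oo[%classic) `&` slopes_ge l).
  by apply: measurableI => //; exact: (@measurable_slope setT p.1).
apply/seteqP; split => [phi H|phi [[_ /=]]].
  split; last by move=> p' p'l; apply: H; rewrite in_cons p'l orbT.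
  by split => //=; rewrite in_itv/= andbT; apply: H; rewrite mem_head.
by rewrite in_itv/= andbT => H1 H2 p'; rewrite in_cons => /orP[/eqP ->|/H2].
Qed.

Lemma slopes_ge_sigma :
  @measurable _ (grad_space R k [set: Zd d]) = <<s range slopes_ge >>.
Proof.
apply/seteqP; split; last first.
  apply: smallest_sub; first exact: sigma_algebra_measurable.
  by move=> _ [l _ <-]; exact: measurable_slopes_ge.
apply: smallest_sub; first exact: smallest_sigma_algebra.
move=> _ [[x y] _ [B mB <-]]; rewrite setTI.
pose S := g_sigma_algebraType (range slopes_ge).
pose f (phi : Om) := height_sub (phi y) (phi x).
have sig : sigma_algebra setT [set B : set (heights R k) | measurable (f @^-1` B : set S)].
  split => /=.
  - by rewrite preimage_set0.
  - by move=> D mD; rewrite setTD preimage_setC; exact: measurableC.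
  - by move=> D mD; rewrite preimage_bigcup; exact: bigcupT_measurable.
move: mB; rewrite heights_measurable_rays; apply: (smallest_sub sig) => _ [a _ <-] /=.
(* A real threshold is reached through rational ones: [a <= v] fails exactly when some rational
   [r < a] has [v < r]. *)
rewrite (_ : f @^-1` _ = ~` \bigcup_(r in [set: rat])
    [set phi | ratr r < a /\ ~ slopes_ge [:: ((x, y), r)] phi]).
  apply: measurableC; apply: countable_bigcupT_measurable => [|r]; first exact: countableP.
  have [ra|ra] := pselect (ratr r < a); last first.
    by rewrite (_ : [set _ | _] = set0)//; apply/seteqP; split => // phi [].
  rewrite (_ : [set _ | _] = ~` slopes_ge [:: ((x, y), r)]).
    by apply: measurableC; apply: sub_sigma_algebra; exists [:: ((x, y), r)].
  by apply/seteqP; split => phi /= => [[]|].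
have sgE r phi : slopes_ge [:: ((x, y), r)] phi <-> ratr r <= slope (x, y) phi.
  split=> [H|H p]; first by have := H ((x, y), r); rewrite mem_head; apply.
  by rewrite inE => /eqP ->.
apply/seteqP; split => [phi /= aphi [r _ [ra]]|phi H /=].
  by rewrite sgE; apply; apply: le_trans (ltW ra) aphi.
rewrite leNgt; apply/negP => /rat_in_itvoo[r]; rewrite in_itv/= => /andP[r1 r2].
apply: H; exists r => //; split => //; rewrite sgE => r3.
by move: (lt_le_trans r1 r3); rewrite ltxx.
Qed.

Lemma slopes_geI : setI_closed (range slopes_ge).
Proof.
move=> _ _ [l1 _ <-] [l2 _ <-]; exists (l1 ++ l2) => //.
apply/seteqP; split => [phi H|phi [H1 H2] p].
  by split=> p pl; apply: H; rewrite mem_cat pl ?orbT.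
by rewrite mem_cat => /orP[]; [exact: H1|exact: H2].
Qed.

Lemma ramps_separate (mu nu : P) :
  (forall n l, expectation_of (ramps n l) mu = expectation_of (ramps n l) nu) ->
  forall A : set (grad_space R k setT), measurable A -> mu A = nu A.
Proof.
move=> H A mA.
have ml l : measurable (slopes_ge l : set (grad_space R k setT)).
  by rewrite slopes_ge_sigma; apply: sub_sigma_algebra; exists l.
have lim (m : P) l : (\int[m]_phi (ramps n l phi)%:E)%E @[n --> \oo] --> m (slopes_ge l).
  have [|||||_ _] := @dominated_convergence _ _ _ m setT measurableT
    (fun n phi => (ramps n l phi)%:E) (fun phi => (\1_(slopes_ge l) phi)%:E) (cst 1%E).
  - by move=> n; apply/measurable_EFinP; exact: measurable_ramps.
  - by apply/measurable_EFinP; exact: measurable_indic.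
  - apply: aeW => phi _; apply: cvg_near_cst.
    by apply: filterS (ramps_cvg l phi) => n ->.
  - exact: finite_measure_integrable_cst.
  - apply: aeW => phi n _ /=; rewrite lee_fin.
    by have /andP[H0 H1] := ramps01 n l phi; rewrite ger0_norm.
  - by rewrite integral_indic// setIT.
have fin (m : P) n l : (\int[m]_phi (ramps n l phi)%:E)%E = (expectation_of (ramps n l) m)%:E.
  rewrite /expectation_of /Rintegral fineK//; apply: integrable_fin_num => //.
  apply: (@bounded_integrable _ _ _ m _ 1); first exact: measurable_ramps.
  by move=> phi; have /andP[H0 H1] := ramps01 n l phi; rewrite ger0_norm.
have e1 B : range slopes_ge B -> mu B = nu B.
  move=> [l _ <-]; apply: (cvg_unique (@ereal_hausdorff R) (lim mu l)).
  rewrite (_ : (fun n => _) = (fun n => \int[nu]_phi (ramps n l phi)%:E)%E); first exact: lim.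
  by apply/funext => n; rewrite !fin H.
have GT (i : nat) : range slopes_ge [set: Om].
  by exists [::] => //; apply/seteqP; split.
have Gc : \bigcup_(i : nat) [set: grad_space R k [set: Zd d]] = setT.
  by apply/seteqP; split => // phi _; exists 0%N.
have fin1 (i : nat) : (mu setT < +oo)%E by rewrite probability_setT ltry.
exact: (measure_unique _ _ slopes_ge_sigma slopes_geI GT Gc mu nu e1 fin1 A mA).
Qed.

End separating_family.

(** * Level sets in the two topologies *)

Section level_topology.
Variables (R : realType) (k : height_kind) (d : nat).
Local Notation Om := (Omega R k d).
Local Notation P := (grad_prob R k d).
Variables (Pinv : set P) (H : P -> \bar R).
Hypothesis P0 : forall mu, Pinv mu -> zero_off_measurable mu.
Local Notation lev C := [set mu : P | Pinv mu /\ (H mu <= C%:E)%E].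
Hypothesis lev_closed : forall (U : set_system P) C, UltraFilter U -> U (lev C) ->
  exists2 nu, lev C nu & forall f, bounded_grad_cylinder f ->
    expectation_of f @ U --> expectation_of f nu.

(** Numbers that encode no pair give the empty product, the constant 1. *)
Definition test_ramp (i : nat) : Om -> R :=
  let p := odflt (0%N, [::]) (choice.unpickle i) in ramps p.1 p.2.

Lemma test_ramp01 i phi : 0 <= test_ramp i phi <= 1.
Proof. exact: ramps01. Qed.

Lemma test_ramp_cylinder i : bounded_grad_cylinder (test_ramp i).
Proof. exact: ramps_cylinder. Qed.

Lemma test_ramp_separate (mu nu : P) : zero_off_measurable mu -> zero_off_measurable nu ->
  (forall i, expectation_of (test_ramp i) mu = expectation_of (test_ramp i) nu) -> mu = nu.
Proof.
move=> mu0 nu0 e; apply: probability_eq => A.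
have [mA|nA] := pselect (measurable (A : set (grad_space R k setT))); last first.
  by rewrite mu0// nu0.
apply: ramps_separate mA => n l.
by have := e (choice.pickle (n, l)); rewrite /test_ramp choice.pickleK.
Qed.

Lemma expectation_ramp_le1 i mu : `|expectation_of (test_ramp i) mu| <= 1.
Proof.
have int : mu.-integrable setT (EFin \o (test_ramp i : grad_space R k setT -> R)).
  have [_ mf _] := test_ramp_cylinder i.
  apply: (@bounded_integrable _ _ _ mu _ 1) => // phi.
  by have /andP[h0 h1] := test_ramp01 i phi; rewrite ger0_norm.
rewrite ger0_norm.
  rewrite -[leRHS](_ : \int[mu]_phi (cst 1 phi) = 1); last first.
    by rewrite Rintegral_cst//= probability_setT mulr1.
  apply: le_Rintegral => //; first exact: finite_measure_integrable_cst.
  by move=> phi _; have /andP[] := test_ramp01 i phi.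
by apply: Rintegral_ge0 => phi _; have /andP[] := test_ramp01 i phi.
Qed.

Section test_class.
Variable F : set (Om -> R).
Hypothesis F_ramp : forall i, F (test_ramp i).
Hypothesis F_cyl : forall f, F f -> bounded_grad_cylinder f.

Definition test_eval (S : set (test_topology F)) i (mu : set_type S) : R :=
  expectation_of (test_ramp i) (set_val mu).

Lemma test_eval_continuous (S : set (test_topology F)) i : continuous (@test_eval S i).
Proof.
move=> mu; have /cvg_test : (nbhs mu) --> mu by [].
by apply; exact: F_ramp.
Qed.

Lemma test_eval_separate (S : set (test_topology F)) : S `<=` Pinv -> forall x y : set_type S,
  (forall i, test_eval i x = test_eval i y) -> x = y.
Proof.
move=> SP x y e; apply: val_inj; apply: test_ramp_separate e.
  by apply/P0/SP/set_valP.
by apply/P0/SP/set_valP.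
Qed.

Lemma level_compact C : compact [set: set_type (lev C : set (test_topology F))].
Proof.
rewrite compact_ultra => U UU _; have PU : ProperFilter U by exact: ultra_proper.
have UU' : UltraFilter ((set_val : set_type (lev C : set (test_topology F)) -> P) @ U).
  exact: ultra_fmap.
have UC : U [set mu | lev C (set_val mu)].
  by apply: filterS (@filterT _ U _) => mu _; exact: set_valP.
have [nu nuC nuU] := lev_closed UU' UC.
exists (exist _ nu (mem_set nuC)); split => //; apply/cvg_test => f Ff.
exact: nuU (F_cyl Ff).
Qed.

Lemma level_polish C : polish R (set_type (lev C : set (test_topology F))).
Proof.
have sub : (lev C : set P) `<=` Pinv by move=> mu [].
apply: (compact_polish (f := @test_eval (lev C : set (test_topology F)))).
- by move=> i x; exact: expectation_ramp_le1.
- exact: test_eval_separate.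
- exact: test_eval_continuous.
- exact: level_compact.
Qed.

Lemma level_hausdorff C : hausdorff_space (set_type (lev C : set (test_topology F))).
Proof.
apply: (@separating_hausdorff R _ nat (@test_eval _)).
- by apply: test_eval_separate => mu [].
- exact: test_eval_continuous.
Qed.

(** If semicontinuity failed at [x], an ultrafilter converging to [x] would contain a level set that
    omits [x]. By [lev_closed] it has a limit in that level, and the separating functions identify
    this limit with [x]. *)
Lemma level_lower_semicontinuous :
  lower_semicontinuous (fun mu : set_type (Pinv : set (test_topology F)) => H (set_val mu)).
Proof.
move=> x a ax; exists [set y : set_type (Pinv : set (test_topology F)) | (a%:E < H (set_val y))%E] => //.
apply: contrapT => /nbhs_ultra[U UU [Ux UV]].
have PU : ProperFilter U by exact: ultra_proper.
have UU' : UltraFilter ((set_val : set_type (Pinv : set (test_topology F)) -> P) @ U).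
  exact: ultra_fmap.
have Ua : U [set mu | lev a (set_val mu)].
  apply: filterS UV => mu nlt; split; first exact: set_valP.
  by rewrite leNgt; exact/negP.
have [nu [nuP nua] nuU] := lev_closed UU' Ua.
suff : nu = set_val x by move=> nux; move: ax; rewrite -nux ltNge nua.
apply: test_ramp_separate => [||i]; [exact: P0|exact/P0/set_valP|].
have H1 := nuU _ (test_ramp_cylinder i).
have H2 : (expectation_of (test_ramp i) \o set_val) @ U -->
    expectation_of (test_ramp i) (set_val x).
  by move/cvg_test : Ux; apply.
exact: (cvg_unique (@Rhausdorff R) H1 H2).
Qed.

End test_class.

(** The identity from the finer to the coarser topology is a continuous bijection from a compact
    space onto a Hausdorff space. *)
Lemma level_open_eq (F F' : set (Om -> R)) C :
  (forall i, F (test_ramp i)) -> (forall i, F' (test_ramp i)) ->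
  (forall f, F f -> bounded_grad_cylinder f) -> F' `<=` F ->
  @open (set_type (lev C : set (test_topology F))) =
  @open (set_type (lev C : set (test_topology F'))).
Proof.
move=> Fr Fr' Fc F'F.
pose S : topologicalType := set_type (lev C : set (test_topology F)).
pose T : topologicalType := set_type (lev C : set (test_topology F')).
have hc : continuous (id : S -> T).
  move=> x; apply/(@cvg_test R k d F' _ (nbhs (x : S)) x (nbhs_filter (x : S))) => f Ff.
  by have /cvg_test : (nbhs (x : S)) --> (x : S) by []; apply; exact: F'F.
have gc : continuous (id : T -> S).
  have hT : hausdorff_space T by exact: (@level_hausdorff F' Fr' C).
  have cS : compact [set: S] by exact: level_compact.
  have K1 : cancel (id : S -> T) (id : T -> S) by [].
  have K2 : cancel (id : T -> S) (id : S -> T) by [].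
  exact: (compact_inverse_continuous cS hT hc K1 K2).
apply/seteqP; split => V oV.
  by move/continuousP: gc => /(_ V oV).
by move/continuousP: hc => /(_ V oV).
Qed.

End level_topology.

Unset Implicit Arguments.

Theorem theorem4p1 (R : realType) (k : height_kind) (d : nat)
    (L : set 'rV[int]_d) (Phi : potential R k d) :
  (2 <= d)%N -> full_rank_sublattice L -> strong_plus_weak L Phi ->
  let P : set (grad_prob R k d) := invariant_grad_prob L in
  let H : grad_prob R k d -> \bar R := specific_free_energy Phi in
  let M (C : R) : set (grad_prob R k d) :=
    [set mu | P mu /\ (H mu <= C%:E)%E] in
  [/\ (* well-defined, with values in R \cup {+oo} *)
      forall mu, P mu -> cvgn (box_free_energy Phi mu) /\ H mu != -oo%E,
      (* affine *)
      forall (t : {i01 R}) (mu nu : grad_prob R k d), P mu -> P nu ->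
        P (mixture t mu nu) /\
        H (mixture t mu nu) =
          (t%:num%:E * H mu + (1 - t%:num)%:E * H nu)%E,
      (* bounded below *)
      exists c : R, forall mu, P mu -> (c%:E <= H mu)%E,
      (* lower-semicontinuous *)
      (let P_loc : topologicalType :=
         set_type (P : set (local_topology R k d)) in
       lower_semicontinuous (fun mu : P_loc => H (set_val mu))) /\
      (let P_weak : topologicalType :=
         set_type (P : set (weak_local_topology R k d)) in
       lower_semicontinuous (fun mu : P_weak => H (set_val mu))) &
      forall C : R,
        let M_loc : topologicalType :=
          set_type (M C : set (local_topology R k d)) in
        let M_weak : topologicalType :=
          set_type (M C : set (weak_local_topology R k d)) in
        [/\ compact [set: M_loc] /\ polish R M_loc,
            compact [set: M_weak] /\ polish R M_weak &
            @open M_loc = @open M_weak]].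
Proof.
move=> d2 fullL [Psi [Xi [strong weak PhiE]]] P H M.
have d0 : (0 < d)%N := ltnW d2.
have [PsiP Psi_ge0 _ [A [q [[Agraph qquasi _] _ lipP _]]]] := strong.
have [XiP Xi_norm Xi_am] := weak.
have [N N0 LN] := lattice_multiple fullL.
have qL : forall t x y, L t -> q (x + t) (y + t) = q x y by case: qquasi.
have [K K1 [n0 slopeP]] := slope_bound_exists N0 LN Agraph qL.
have HE mu : P mu -> H mu = dv_lim Xi Phi K N mu.
  by move=> muP; exact: (specific_free_energyE d0 N0 LN K1 PsiP Psi_ge0 XiP Xi_norm Xi_am PhiE lipP slopeP).
have Hge mu : P mu -> ((- (ln (fine (ref_measure R k (height_ball K))) + xi_norm Xi))%:E <= H mu)%E.
  move=> muP; rewrite HE//.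
  exact: (dv_lim_ge d0 N0 LN K1 PsiP Psi_ge0 XiP Xi_norm Xi_am PhiE lipP slopeP).
(* The bounds of [dv_lim_leP], which make [M C] an instance of [level]. *)
pose b j (C : R) := (j.+1 * N)%:R ^+ d * C + (ln (fine (ref_measure R k (height_ball K))) +
  fine (lower_exterior_bound Xi (box d (j.+1 * N)))).
have levE C : M C = level L Phi K N b C.
  apply/seteqP; split => mu [muP le]; split => //.
    by move: le; rewrite HE// dv_lim_leP.
  by rewrite HE// dv_lim_leP.
have lev_closed (U : set_system (grad_prob R k d)) C : UltraFilter U -> U (M C) ->
    exists2 nu, M C nu & forall f, bounded_grad_cylinder f ->
      expectation_of f @ U --> expectation_of f nu.
  rewrite levE.
  exact: (level_closed N0 LN PsiP Psi_ge0 XiP Xi_norm PhiE).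
have P0 mu : P mu -> zero_off_measurable mu by case.
pose loc := @bounded_grad_cylinder R k d.
pose weak_loc := [set f : Omega R k d -> R | bounded_grad_cylinder f /\ sup_norm_continuous f].
have loc_ramp i : loc (@test_ramp R k d i) := @test_ramp_cylinder R k d i.
have weak_ramp i : weak_loc (@test_ramp R k d i).
  by split; [exact: test_ramp_cylinder|exact: ramps_continuous].
have weak_cyl f : weak_loc f -> bounded_grad_cylinder f by case.
split.
- move=> mu muP; split.
    apply/cvg_ex; exists (dv_lim Xi Phi K N mu).
    exact: (box_free_energy_cvg d0 N0 LN K1 PsiP Psi_ge0 XiP Xi_norm Xi_am PhiE lipP slopeP).
  by rewrite -ltNye (lt_le_trans _ (Hge mu muP))// ltNyr.
- move=> t mu nu muP nuP; split; first exact: mixture_invariant.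
  have mixP := mixture_invariant t muP nuP.
  rewrite !HE//.
  exact: (dv_lim_mixture d0 N0 LN K1 PsiP Psi_ge0 XiP Xi_norm Xi_am PhiE lipP slopeP).
- by eexists; exact: Hge.
- split.
    exact: (level_lower_semicontinuous (H := H) P0 lev_closed loc_ramp).
  exact: (level_lower_semicontinuous (H := H) P0 lev_closed weak_ramp).
- move=> C; split.
  + split; first exact: (level_compact (H := H) lev_closed).
    exact: (level_polish (H := H) P0 lev_closed loc_ramp).
  + split; first exact: (level_compact (H := H) lev_closed weak_cyl).
    exact: (level_polish (H := H) P0 lev_closed weak_ramp weak_cyl).
  + exact: (level_open_eq (H := H) P0 lev_closed C loc_ramp weak_ramp (fun f lf => lf) weak_cyl).
Qed.
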